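(* Let $d\in\mathbb{N}$, $\alpha\in(0,1)$ and $\beta\in(0,2)$. Assume that the spectral measure $\mu$ has a strictly positive density and that $\omega_\mu$ is strictly positive and $(d+1+[\beta])$-times continuously differentiable on $S^{d-1}$. Let $$\kappa_2=\kappa_2(d,\beta)=\begin{cases}\frac{d}{d-2\beta}&\text{if }d>2\beta,\\ \infty&\text{otherwise.}\end{cases}$$ For $1\le p<\infty$, the kernel $Y(t,\cdot)$ belongs to $L_p(\mathbb{R}^d)$ for all $t>0$ if and only if $1\le p<\kappa_2$. Moreover, for every $1\le p<\kappa_2$ the two-sided estimate $$\|Y(t,\cdot)\|_p\asymp t^{-\frac{\alpha d}{\beta}\left(1-\frac1p\right)+(\alpha-1)},\quad t>0,$$ holds. In the case $d<2\beta$, this two-sided estimate remains true for $p=\infty$.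
   Context: $[\beta]$ is the largest integer not exceeding $\beta$. Let $\mu$ (the spectral measure) be a centrally symmetric finite non-negative Borel measure on the unit sphere $S^{d-1}\subset\mathbb{R}^d$. Saying that $\mu$ has a density means $\mu(d\eta)=\varrho(\eta)\,d\eta$ with $\varrho$ continuous on $S^{d-1}$. Put $\omega_\mu(\theta)=\int_{S^{d-1}}|\theta\cdot\eta|^\beta\mu(d\eta)$ for $\theta\in S^{d-1}$, and $\psi(\xi)=\|\xi\|^\beta\omega_\mu(\xi/\|\xi\|)$ for $\xi\in\mathbb{R}^d$, $\psi(0)=0$. Let $G(t,x)=(2\pi)^{-d}\int_{\mathbb{R}^d}e^{ix\cdot\xi}e^{-t\psi(\xi)}d\xi$, the Green function of $\partial_t v+\Psi_\beta(-i\nabla)v=0$, $v|_{t=0}=\delta_0$, where $\Psi_\beta(-i\nabla)v=\mathcal{F}^{-1}[\psi\,\mathcal{F}v]$. Let $G_\alpha(t,s)$ be the Green function of $\partial_t v(t,s)+\frac{d^\alpha}{ds^\alpha}v(t,s)=0$, $G_\alpha(0,s)=\delta(s)$, where $\frac{d^\alpha}{ds^\alpha}f(s)=\frac{1}{\Gamma(-\alpha)}\int_0^\infty\frac{f(s-\tau)-f(s)}{\tau^{1+\alpha}}d\tau$ (so $G_\alpha(1,\cdot)$ is the one-sided $\alpha$-stable density with Laplace transform $e^{-\sigma^\alpha}$). For $t>0$, $x\in\mathbb{R}^d$ define $$Y(t,x)=\int_0^\infty t^{\alpha-1}G(t^\alpha s,x)s^{-\frac1\alpha}G_\alpha(1,s^{-\frac1\alpha})ds.$$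 $f\asymp g$ for $t>0$ means there are constants $C_1,C_2>0$ (independent of $t$) with $C_1g(t)\le f(t)\le C_2g(t)$ for all $t>0$. *)

(* Defs.v *)
From HB Require Import structures.
From mathcomp Require Import all_boot all_order all_algebra.
From mathcomp Require Import all_classical all_reals all_analysis.
From mathcomp Require Import measurable_realfun.
From mathcomp Require Import complex.

Set Implicit Arguments.
Unset Strict Implicit.
Unset Printing Implicit Defensive.

Import Order.TTheory GRing.Theory Num.Theory.
Import numFieldNormedType.Exports.
Local Open Scope classical_set_scope.
Local Open Scope ring_scope.

Section euclidean_measurable.
Context {R : realType} {n : nat}.

HB.instance Definition _ := @isMeasurable.Build (sigma_display (@open 'rV[R]_n))
  'rV[R]_n <<s @open 'rV[R]_n >> (@sigma_algebra0 _ setT _)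
  (@sigma_algebraC _ _) (@sigma_algebra_bigcup _ setT _).

Lemma rV_open_measurable (U : set 'rV[R]_n) : open U -> measurable U.
Proof. exact: sub_gen_smallest. Qed.

Lemma measurable_coord_rV (i : 'I_n) :
  measurable_fun [set: 'rV[R]_n] (fun v : 'rV[R]_n => v ord0 i).
Proof.
apply: (measurability _ (RGenOpens.measurableE R)).
move=> _ [_ [a [b ->]] <-]; rewrite setTI; apply: rV_open_measurable.
by apply: open_comp; [move=> ? _; exact: coord_continuous | exact: interval_open].
Qed.

Lemma measurable_fun_rV d (T : measurableType d) (f : T -> 'rV[R]_n) :
  (forall i, measurable_fun [set: T] (fun t => f t ord0 i)) ->
  measurable_fun [set: T] f.
Proof.
move=> mf; apply: (measurability (@open 'rV[R]_n)) => //.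
move=> _ [U oU <-]; rewrite setTI.
pose c (q : 'rV[rat]_n * rat) : 'rV[R]_n := \row_i ratr (q.1 ord0 i).
pose F (q : 'rV[rat]_n * rat) : set T :=
  [set t | [/\ 0 < q.2, ball (c q) (ratr q.2) `<=` U &
     forall i, (`|ratr (q.1 ord0 i) - f t ord0 i| < ratr q.2 :> R)]].
have -> : f @^-1` U = \bigcup_q F q.
  apply/seteqP; split => [t /= Uft|t [q _ [q0 qU]] h]; last first.
    apply: qU; split; first by rewrite ltr0q.
    by move=> i j; rewrite ord1 /c mxE; exact: h.
  have /nbhs_ballP[e /= e0 eU] : nbhs (f t) U by exact: open_nbhs_nbhs.
  have /rat_in_itvoo[r] : 0 < e / 2 by rewrite divr_gt0.
  rewrite in_itv/= => /andP[r0 re].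
  have /choice[q Hq] : forall i, exists q : rat,
      `|ratr q - f t ord0 i| < ratr r :> R.
    move=> i; have /rat_in_itvoo[q] : f t ord0 i < f t ord0 i + ratr r.
      by rewrite ltrDl.
    rewrite in_itv/= => /andP[h1 h2]; exists q.
    by rewrite ger0_norm ?subr_ge0 ?(ltW h1)// ltrBlDl.
  exists (\row_i q i, r) => //; split => /=; first by rewrite -(ltr0q R).
  - move=> v [_ /= hv]; apply: eU; split => // i j.
    have := hv i j; rewrite ord1 /c /ball/= !mxE => hj.
    rewrite (splitr e) (le_lt_trans (ler_distD (ratr (q j)) _ _))//.
    by rewrite ltrD// ?(lt_trans hj)// distrC (lt_trans (Hq j)).
  - by move=> i; rewrite mxE.
apply: countable_bigcupT_measurable => [|q]; first exact: countableP.
have [/andP[q0 /asboolP qU]|nq] :=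
    boolP ((0 < q.2) && `[< ball (c q) (ratr q.2) `<=` U >]); last first.
  rewrite (_ : F q = set0)//; apply/seteqP; split => // t [q0 qU _].
  by move/negP: nq; apply; rewrite q0; exact/asboolP.
rewrite (_ : F q = \bigcap_(i in [set: 'I_n])
    ((fun t => f t ord0 i) @^-1` ball (ratr (q.1 ord0 i) : R) (ratr q.2 : R))).
  apply: fin_bigcap_measurable => // i _.
  rewrite -[X in measurable X]setTI; apply: mf => //.
  by apply: open_measurable; exact: ball_open.
apply/seteqP; split => [t [_ _ h] i _ //=|t h]; first exact: h.
by split => // i; exact: h.
Qed.

End euclidean_measurable.

Section lebesgue_rV.
Context {R : realType}.
Local Notation leb1 := (@lebesgue_measure R).

Definition rV_cons n (z : measurableTypeR R * 'rV[R]_n) : 'rV[R]_n.+1 :=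
  row_mx (z.1 : R)%:M z.2 : 'rV_(1 + n).

Definition rV_uncons n (v : 'rV[R]_n.+1) : measurableTypeR R * 'rV[R]_n :=
  (v ord0 ord0, rsubmx (v : 'rV_(1 + n))).

Lemma rV_cons0 n z : @rV_cons n z ord0 ord0 = z.1.
Proof.
rewrite /rV_cons (_ : ord0 = lshift n (ord0 : 'I_1)); last exact: val_inj.
by rewrite (@row_mxEl _ 1 1 n) mxE.
Qed.

Lemma rV_consS n z i : @rV_cons n z ord0 (lift ord0 i) = z.2 ord0 i.
Proof.
by rewrite /rV_cons (_ : lift ord0 i = rshift 1 i) ?(@row_mxEr _ 1 1 n)//; exact: val_inj.
Qed.

Lemma rV_consK n : cancel (@rV_cons n) (@rV_uncons n).
Proof.
move=> z; rewrite /rV_uncons rV_cons0; case: z => x v /=; congr pair.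
by rewrite /rV_cons row_mxKr.
Qed.

Lemma rV_unconsE n (v : 'rV[R]_n.+1) i : (rV_uncons v).2 ord0 i = v ord0 (lift ord0 i).
Proof. by rewrite mxE; congr (v _ _); exact: val_inj. Qed.

Lemma measurable_rV_cons n : measurable_fun setT (@rV_cons n).
Proof.
apply: measurable_fun_rV => i; case: (unliftP ord0 i) => [j|] ->.
  under eq_fun do rewrite rV_consS.
  exact: measurableT_comp (measurable_coord_rV j) measurable_snd.
by under eq_fun do rewrite rV_cons0; exact: measurable_fst.
Qed.

Lemma measurable_rV_uncons n : measurable_fun setT (@rV_uncons n).
Proof.
apply/measurable_fun_pairP; split; first exact: measurable_coord_rV.
apply: measurable_fun_rV => i.
rewrite (_ : (fun _ => _) = fun v : 'rV[R]_n.+1 => v ord0 (lift ord0 i)).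
  exact: measurable_coord_rV.
by apply/funext => v; rewrite -rV_unconsE.
Qed.

Section step.
Variables (n : nat) (m : {sigma_finite_measure set 'rV[R]_n -> \bar R}).

Definition lebesgue_step : set 'rV[R]_n.+1 -> \bar R :=
  pushforward (leb1 \x m)%E (@rV_cons n).

Let mcons := @measurable_rV_cons n.

Let step0 : lebesgue_step set0 = 0%E.
Proof. exact: measure0. Qed.

Let step_ge0 A : (0 <= lebesgue_step A)%E.
Proof. exact: measure_ge0. Qed.

Let step_sigma_additive : semi_sigma_additive lebesgue_step.
Proof.
rewrite /lebesgue_step.
exact: (@measure_semi_sigma_additive _ _ _
  (pushforward (leb1 \x m)%E (@rV_cons n) : {measure set _ -> \bar R})).
Qed.

HB.instance Definition _ := isMeasure.Build _ _ _ lebesgue_step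
  step0 step_ge0 step_sigma_additive.

Let step_sigma_finite : sigma_finite setT lebesgue_step.
Proof.
have /sigma_finiteP[G [TG ndG mG]] := sigma_finiteT m.
have /sigma_finiteP[F [TF ndF mF]] :=
  sigma_finiteT (leb1 : {sigma_finite_measure set _ -> \bar R}).
exists (fun k => @rV_uncons n @^-1` (F k `*` G k)).
  rewrite -preimage_bigcup (_ : \bigcup_k _ = setT) ?preimage_setT//.
  apply/seteqP; split => // -[x y] _.
  have [k _ Fkx] : (\bigcup_k F k) x by rewrite -TF.
  have [l _ Gly] : (\bigcup_k G k) y by rewrite -TG.
  exists (maxn k l) => //; split => /=.
    by move: x Fkx; exact/subsetPset/ndF/leq_maxl.
  by move: y Gly; exact/subsetPset/ndG/leq_maxr.
move=> k; have [mFk Fk] := mF k; have [mGk Gk] := mG k; split.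
  rewrite -[X in measurable X]setTI; apply: measurable_rV_uncons => //.
  exact: measurableX.
rewrite /lebesgue_step /pushforward -comp_preimage.
rewrite (_ : _ \o _ = id) ?preimage_id; last first.
  by apply/funext => z /=; exact: rV_consK.
by rewrite product_measure1E// lte_mul_pinfty// ge0_fin_numE.
Qed.

HB.instance Definition _ := @Measure_isSigmaFinite.Build _ _ _
  lebesgue_step step_sigma_finite.

End step.

Fixpoint lebesgue_rV (n : nat) : {sigma_finite_measure set 'rV[R]_n -> \bar R} :=
  match n with
  | 0 => dirac (0 : 'rV[R]_0)
  | n'.+1 => lebesgue_step (lebesgue_rV n')
  end.

Lemma lebesgue_rV_box n (a b : 'rV[R]_n) :
  (forall i, a ord0 i <= b ord0 i) ->
  lebesgue_rV n
    [set v : 'rV[R]_n | forall i, v ord0 i \in `]a ord0 i, b ord0 i]] =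
  (\prod_i (b ord0 i - a ord0 i))%:E.
Proof.
elim: n a b => [|n IH] a b ab.
  by rewrite /= big_ord0 diracE mem_set//= => -[].
rewrite big_ord_recl /= /lebesgue_step /pushforward.
have := IH (rV_uncons a).2 (rV_uncons b).2.
have -> : @rV_cons n @^-1`
    [set v : 'rV[R]_n.+1 | forall i, v ord0 i \in `]a ord0 i, b ord0 i]] =
  ([set` `]a ord0 ord0, b ord0 ord0]] : set (measurableTypeR R)) `*`
  [set v : 'rV[R]_n | forall i, v ord0 i \in
    `](rV_uncons a).2 ord0 i, (rV_uncons b).2 ord0 i]].
  apply/seteqP; split => z /=.
    move=> h; split => /=; first by have := h ord0; rewrite rV_cons0.
    by move=> i; have := h (lift ord0 i); rewrite rV_consS !rV_unconsE.
  move=> [h1 h2] i; case: (unliftP ord0 i) => [j|] ->; last by rewrite rV_cons0.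
  by have := h2 j; rewrite rV_consS !rV_unconsE.
rewrite product_measure1E//=; last first.
  rewrite (_ : mkset _ = \bigcap_(i in [set: 'I_n])
    ((fun v : 'rV[R]_n => v ord0 i) @^-1`
     [set` `](rV_uncons a).2 ord0 i, (rV_uncons b).2 ord0 i]])).
    apply: fin_bigcap_measurable => // i _.
    by rewrite -[X in measurable X]setTI; apply: measurable_coord_rV.
  by apply/seteqP; split => [v h i _|v h i]; exact: h.
move=> ->; last by move=> i; rewrite !rV_unconsE.
rewrite lebesgue_measure_itv/= lte_fin EFinM; congr (_ * _)%E; last first.
  by congr EFin; apply: eq_bigr => i _; rewrite !rV_unconsE.
by case: ltgtP (ab ord0) => // -> _; rewrite subrr.
Qed.

End lebesgue_rV.

Section euclidean_geometry.
Context {R : realType} {d : nat}.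
Implicit Types x y : 'rV[R]_d.

Definition dot x y : R := \sum_i x ord0 i * y ord0 i.

(* The library norm on 'rV[R]_d is the sup norm; this is the Euclidean one. *)
Definition enorm x : R := Num.sqrt (dot x x).

Definition sphere : set 'rV[R]_d := [set x | enorm x = 1].

Definition normalize x : 'rV[R]_d := (enorm x)^-1 *: x.

Lemma measurable_enorm : measurable_fun setT enorm.
Proof.
apply: (measurableT_comp (continuous_measurable_fun
  (@sqrt_continuous R))).
apply: measurable_sum => i.
by apply: measurable_funM; exact: measurable_coord_rV.
Qed.

Lemma measurable_normalize : measurable_fun setT normalize.
Proof.
apply: measurable_fun_rV => i; under eq_fun do rewrite mxE.
apply: measurable_funM; last exact: measurable_coord_rV.
under eq_fun do rewrite -powR_inv1 ?sqrtr_ge0//.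
exact: (measurableT_comp (measurable_powR _) measurable_enorm).
Qed.

Definition punctured_ball : set 'rV[R]_d := [set x | 0 < enorm x <= 1].

Lemma measurable_punctured_ball : measurable punctured_ball.
Proof.
rewrite (_ : punctured_ball = enorm @^-1` [set` `]0, 1]]).
  by rewrite -[X in measurable X]setTI; apply: measurable_enorm.
by apply/seteqP; split => x /=; rewrite in_itv.
Qed.

Definition cone_measure (A : set 'rV[R]_d) : \bar R :=
  lebesgue_rV d (normalize @^-1` A `&` punctured_ball).

Let mnormalize := measurable_normalize.

Let cone_measureE : cone_measure =
  pushforward (mrestr (lebesgue_rV d) measurable_punctured_ball) normalize.
Proof. by []. Qed.

Let cone0 : cone_measure set0 = 0%E.
Proof. by rewrite cone_measureE; exact: measure0. Qed.

Let cone_ge0 A : (0 <= cone_measure A)%E.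
Proof. exact: measure_ge0. Qed.

Let cone_sigma_additive : semi_sigma_additive cone_measure.
Proof. by rewrite cone_measureE; exact: measure_semi_sigma_additive. Qed.

HB.instance Definition _ := isMeasure.Build _ _ _ cone_measure
  cone0 cone_ge0 cone_sigma_additive.

(* Surface measure of the unit sphere, as in polar coordinates: the measure of
   A is d times the Lebesgue measure of the cone {r eta | 0 < r <= 1, eta in A}.
   For d = 1 it is the counting measure on {-1, 1}. *)
Definition surface_measure : set 'rV[R]_d -> \bar R :=
  mscale (d%:R%:nng : {nonneg R}) cone_measure.

HB.instance Definition _ := Measure.on surface_measure.

End euclidean_geometry.

Section smoothness.
Context {R : realType} {d : nat}.

(* For U open, class C^k on U: partial derivatives up to order k exist and are
   continuous on U. *)
Fixpoint Ck_on (k : nat) (U : set 'rV[R]_d) (F : 'rV[R]_d -> R) : Prop :=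
  (forall x, U x -> {for x, continuous F}) /\
  match k with
  | 0 => True
  | k'.+1 => forall i : 'I_d,
      (forall x, U x -> derivable F x (delta_mx ord0 i)) /\
      Ck_on k' U (fun x => 'D_(delta_mx ord0 i) F x)
  end.

(* Class C^k on the submanifold S^(d-1): near each point, the restriction of a
   C^k function of the ambient variables. *)
Definition Ck_sphere (k : nat) (f : 'rV[R]_d -> R) : Prop :=
  forall x, sphere x -> exists (U : set 'rV[R]_d) (F : 'rV[R]_d -> R),
    [/\ open U, U x, Ck_on k U F & forall y, U y -> sphere y -> F y = f y].

End smoothness.

Section spectral_measure.
Context {R : realType} {d : nat}.
Variable mu : {finite_measure set 'rV[R]_d -> \bar R}.

(* A measure on the sphere is a Borel measure on R^d that vanishes off it. *)
Definition spectral_measure : Prop :=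
  mu (~` sphere) = 0%E /\
  forall A : set 'rV[R]_d, measurable A -> mu (-%R @^-1` A) = mu A.

Definition has_positive_density : Prop :=
  exists rho : 'rV[R]_d -> R,
    [/\ {within sphere, continuous rho},
        forall eta, sphere eta -> 0 < rho eta &
        forall A : set 'rV[R]_d, measurable A ->
          mu A = (\int[surface_measure]_(eta in A `&` sphere) (rho eta)%:E)%E].

Definition omega (beta : R) (theta : 'rV[R]_d) : R :=
  \int[mu]_(eta in sphere) (`|dot theta eta| `^ beta).

Definition psi (beta : R) (xi : 'rV[R]_d) : R :=
  if xi == 0 then 0 else enorm xi `^ beta * omega beta (normalize xi).

End spectral_measure.

Section complex_valued.
Context d (T : measurableType d) {R : realType}.
Variable mu : {measure set T -> \bar R}.

Definition cintegral (D : set T) (f : T -> R[i]) : R[i] :=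
  Complex (\int[mu]_(x in D) complex.Re (f x))
          (\int[mu]_(x in D) complex.Im (f x)).

Definition cLnorm (p : \bar R) (f : T -> R[i]) : \bar R :=
  Lnorm mu p (fun x => (ComplexField.Normc.normc (f x))%:E).

Definition cLp (p : \bar R) (f : T -> R[i]) : Prop :=
  [/\ measurable_fun setT (fun x => complex.Re (f x)),
      measurable_fun setT (fun x => complex.Im (f x)) &
      (cLnorm p f < +oo)%E].

End complex_valued.

Definition expi {R : realType} (y : R) : R[i] := (cos y +i* sin y)%C.

Section green.
Context {R : realType} {d : nat}.
Variables (beta : R) (mu : {finite_measure set 'rV[R]_d -> \bar R}).

Definition green (t : R) (x : 'rV[R]_d) : R[i] :=
  (((2 * pi) ^- d)%:C * cintegral (lebesgue_rV d) setT
    (fun xi => expi (dot x xi) * (expR (- (t * psi mu beta xi)))%:C))%C.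

End green.

Section fractional_green.
Context {R : realType}.
Variable alpha : R.
Local Notation leb1 := (@lebesgue_measure R).

Definition Euler_Gamma (z : R) : R :=
  \int[leb1]_(u in `]0, +oo[) (u `^ (z - 1) * expR (- u)).

(* The factor is 1 / Gamma(-alpha), rewritten through
   Gamma(1 - alpha) = - alpha Gamma(-alpha) because Euler's integral only
   converges at positive arguments. *)
Definition frac_derive (f : R -> R) (s : R) : R :=
  - alpha / Euler_Gamma (1 - alpha) *
  \int[leb1]_(tau in `]0, +oo[) ((f (s - tau) - f s) / tau `^ (1 + alpha)).

(* g is the Green function of d/dt v + d^alpha/ds^alpha v = 0, v(0,.) = delta:
   the classical solution for t > 0 among one-sided probability densities that
   tends to delta weakly as t -> 0+. Within this class the Laplace transform of
   g t is forced to be exp(- t sigma^alpha), so g t is the one-sided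
   alpha-stable density. *)
Record is_frac_green (g : R -> R -> R) : Prop := {
  frac_green_ge0 : forall t s, 0 < t -> 0 <= g t s ;
  frac_green_one_sided : forall t s, 0 < t -> s < 0 -> g t s = 0 ;
  frac_green_mass : forall t, 0 < t -> (\int[leb1]_s (g t s)%:E = 1)%E ;
  frac_green_derivable : forall t s, 0 < t ->
    derivable (g ^~ s) t 1 /\ derivable (g t) s 1 ;
  frac_green_C1 : forall t s, 0 < t ->
    [/\ {for (t, s), continuous (fun z : R * R => g z.1 z.2)},
        {for (t, s), continuous (fun z : R * R => derive1 (g ^~ z.2) z.1)} &
        {for (t, s), continuous (fun z : R * R => derive1 (g z.1) z.2)}] ;
  frac_green_equation : forall t s, 0 < t ->
    derive1 (g ^~ s) t + frac_derive (g t) s = 0 ;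
  frac_green_initial : forall phi : R -> R, continuous phi ->
    (exists M, forall s, `|phi s| <= M) ->
    (fun t => \int[leb1]_s (g t s * phi s)) @ 0^'+ --> phi 0
}.

End fractional_green.

Section kernel_Y.
Context {R : realType} {d : nat}.
Variables (alpha beta : R) (mu : {finite_measure set 'rV[R]_d -> \bar R}).
Variable Galpha : R -> R -> R.

Definition kernelY (t : R) (x : 'rV[R]_d) : R[i] :=
  cintegral (@lebesgue_measure R) `]0, +oo[ (fun s =>
    ((t `^ (alpha - 1))%:C * green beta mu (t `^ alpha * s) x *
     (s `^ (- alpha^-1) * Galpha 1 (s `^ (- alpha^-1)))%:C)%C).

End kernel_Y.

Definition kappa2 {R : realType} (d : nat) (beta : R) : \bar R :=
  if 2 * beta < d%:R then (d%:R / (d%:R - 2 * beta))%:E else +oo%E.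

Definition asymp {R : realType} (f : R -> \bar R) (g : R -> R) : Prop :=
  exists C1 C2 : R, [/\ 0 < C1, 0 < C2 &
    forall t, 0 < t -> ((C1 * g t)%:E <= f t <= (C2 * g t)%:E)%E].

(* Main.v *)
(* The kernel scales exactly, Y(t,x) = t^(alpha-1-alpha d/beta)
   Y(1, t^(-alpha/beta) x), so everything reduces to deciding when
   Y(1,.) = int_0^oo G(s,.) m(s) ds is in L_p, where
   m(s) = s^(-1/alpha) g(s^(-1/alpha)) and g = G_alpha(1,.).

   G >= 0: by |u|^beta = C int_0^oo (1 - cos (u r)) r^(-1-beta) dr the function
   exp(-t psi) is a limit of exponentials of mixtures of cosines, hence
   positive definite.  Testing against products of Laplace kernels then gives
   G(1,.) in L_1; G(1,.) is bounded, and bounded below near 0.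

   For g, pair the fractional equation with a tent of width K on the half-line.
   The adjoint derivative of the tent is comparable to K^(-alpha), so the mass
   of the tent obeys a two-sided linear differential inequality in t; this
   gives P(S > K) ~ K^(-alpha) at infinity and enough decay at 0, that is
   int_0^oo s^(-a) m(s) ds < oo for 0 <= a < 2, while m has mass at least
   c v^2 on an interval [k v, l v] for v <= 1.

   With a = (d/beta)(1 - 1/p), Hoelder's inequality with weight s^(-a) bounds
   ||Y(1,.)||_p when a < 2, which is p < kappa_2.  Conversely Y(1,x) is at
   least c r^(2 beta - d) on the cube of side r, whose p-th power has integrals
   over shrinking cubes bounded below once p >= kappa_2. *)
Require Import Defs.
From HB Require Import structures.
From mathcomp Require Import all_boot all_order all_algebra.
From mathcomp Require Import all_classical all_reals all_analysis.
From mathcomp Require Import measurable_realfun ess_sup_inf.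
From mathcomp Require Import complex ring lra.
Import Order.TTheory GRing.Theory Num.Theory.
Import numFieldNormedType.Exports.
Local Open Scope classical_set_scope.
Local Open Scope ring_scope.

Set Implicit Arguments.
Unset Strict Implicit.
Unset Printing Implicit Defensive.

(** * Integrals of real functions *)

(** Nothing is known of [g] beyond the properties in [is_frac_green]. Under u = s^(-1/alpha) the
    moment int s^(-a) m(s) ds becomes alpha int g(u) u^(alpha (a-1)) du, whose exponent runs through
    [-alpha, alpha) as a runs through [0, 2). The upper end is the tail exponent of [g]; it fixes
    the threshold a = 2 and with it kappa_2. The lower end asks for a moment of order -alpha. The
    tent is chosen because its drop over a distance tau lies between min(tau/K, 1) times the tent
    and min(tau/K, 1): both differential inequalities then carry the same constant, and no Laplace
    transform has to be inverted. Nonnegativity of G has to come before the norm estimates: it turns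
    oscillatory integrals into Tonelli integrals in [0, +oo], where the subordinated integral may be
    infinite at a point while its L_p norm is finite. The exponent a is the one for which Hoelder's
    weight reproduces itself: with a p = (d/beta)(p - 1), integration in x leaves exactly the moment
    of order -a that Hoelder's inequality already produced. *)

Section real_integrals.
Context d (T : measurableType d) (R : realType).
Variable mu : {measure set T -> \bar R}.
Implicit Types (D : set T) (f g : T -> R).

Lemma integrable_le_dom D f g : measurable D -> measurable_fun D f ->
  mu.-integrable D (EFin \o g) -> (forall x, D x -> `|f x| <= g x) ->
  mu.-integrable D (EFin \o f).
Proof.
move=> mD mf ig fg; apply: le_integrable ig => //; first exact/measurable_EFinP.
by move=> x Dx /=; rewrite lee_fin (le_trans (fg x Dx))// ler_norm.
Qed.

Lemma integrable_scale D f (c : R) : measurable D ->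
  mu.-integrable D (EFin \o f) -> mu.-integrable D (EFin \o (fun x => c * f x)).
Proof. by move=> mD intf; exact: (integrableZl mD c intf). Qed.

Lemma integrable_add D f g : measurable D ->
  mu.-integrable D (EFin \o f) -> mu.-integrable D (EFin \o g) ->
  mu.-integrable D (EFin \o (fun x => f x + g x)).
Proof. by move=> mD intf intg; exact: (integrableD mD intf intg). Qed.

Lemma integrable_sub D f g : measurable D ->
  mu.-integrable D (EFin \o f) -> mu.-integrable D (EFin \o g) ->
  mu.-integrable D (EFin \o (fun x => f x - g x)).
Proof. by move=> mD intf intg; exact: (integrableB mD intf intg). Qed.

Lemma integrable_ge0_lty D f : measurable D -> measurable_fun D f ->
  (forall x, D x -> 0 <= f x) -> (\int[mu]_(x in D) (f x)%:E < +oo)%E ->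
  mu.-integrable D (EFin \o f).
Proof.
move=> mD mf f0 fy; apply/integrableP; split; first exact/measurable_EFinP.
rewrite (eq_integral (fun x => (f x)%:E))// => x /set_mem Dx /=.
by rewrite ger0_norm ?f0.
Qed.

Lemma Rintegral_EFin D f : measurable D -> mu.-integrable D (EFin \o f) ->
  (\int[mu]_(x in D) f x)%:E = (\int[mu]_(x in D) (f x)%:E)%E.
Proof. by move=> mD If; rewrite fineK//; exact: integrable_fin_num. Qed.

Lemma Rintegral_dct D (f_ : nat -> T -> R) f g : measurable D ->
  (forall n, measurable_fun D (f_ n)) ->
  (forall x, D x -> f_ ^~ x @ \oo --> f x) ->
  mu.-integrable D (EFin \o g) ->
  (forall n x, D x -> `|f_ n x| <= g x) ->
  mu.-integrable D (EFin \o f) /\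
  (fun n => \int[mu]_(x in D) f_ n x) @ \oo --> \int[mu]_(x in D) f x.
Proof.
move=> mD mf_ ff ig fg.
have mf : measurable_fun D f by exact: (@measurable_fun_cvg _ _ _ D f_).
have [|||||If _ cv] := @dominated_convergence _ _ _ mu D mD
  (fun n => EFin \o f_ n) (EFin \o f) (EFin \o g).
- by move=> n; exact/measurable_EFinP.
- exact/measurable_EFinP.
- by apply: aeW => x Dx; apply: cvg_EFin; [exact: nearW|exact: ff].
- exact: ig.
- by apply: aeW => x n Dx /=; rewrite lee_fin fg.
split=> //; move: cv; rewrite -(@fineK _ (\int[mu]_(x in D) _)%E) //=.
  by move=> /fine_cvg.
exact: integrable_fin_num.
Qed.

Lemma Rintegral_le_cst D f g (c : R) : measurable D -> measurable_fun D f ->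
  mu.-integrable D (EFin \o g) -> (forall x, D x -> `|f x| <= c) ->
  (forall x, D x -> 0 <= g x) ->
  `|\int[mu]_(x in D) (f x * g x)| <= c * \int[mu]_(x in D) g x.
Proof.
move=> mD mf ig fc g0.
have mg : measurable_fun D g by apply/measurable_EFinP; exact: (measurable_int mu).
have icg : mu.-integrable D (EFin \o (fun x => c * g x)).
  by apply: (integrableZl mD c ig).
have ifg : mu.-integrable D (EFin \o (fun x => f x * g x)).
  apply: integrable_le_dom icg _ => //; first exact: measurable_funM.
  by move=> x Dx; rewrite normrM (ger0_norm (g0 _ Dx)) ler_wpM2r ?fc ?g0.
rewrite (le_trans (le_normr_Rintegral _ _))// -RintegralZl//.
apply: le_Rintegral => //; first exact: integrable_norm.
by move=> x Dx; rewrite normrM (ger0_norm (g0 _ Dx)) ler_wpM2r ?fc ?g0.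
Qed.

End real_integrals.

(** * Fubini for integrands dominated by a product *)

Section fubini_dominated.
Context d1 d2 (T1 : measurableType d1) (T2 : measurableType d2) (R : realType).
Variable m1 : {sigma_finite_measure set T1 -> \bar R}.
Variable m2 : {sigma_finite_measure set T2 -> \bar R}.
Variables (D1 : set T1) (D2 : set T2) (F : T1 -> T2 -> R).
Variables (a : T1 -> R) (b : T2 -> R).
Hypotheses (mD1 : measurable D1) (mD2 : measurable D2).
Hypothesis mF : measurable_fun (D1 `*` D2) (fun z => F z.1 z.2).
Hypotheses (ia : m1.-integrable D1 (EFin \o a))
  (ib : m2.-integrable D2 (EFin \o b)).
Hypothesis Fab : forall x y, D1 x -> D2 y -> `|F x y| <= a x * b y.

(** Extension by zero, so that Fubini on the whole product can be used. It is bounded by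
    [|A x| * |B y|], whose double integral is a product of two finite ones; the absolute values are
    there because only the product [a x * b y] is known to be nonnegative. *)
Let H : T1 * T2 -> R := (fun z => F z.1 z.2) \_ (D1 `*` D2).
Let A : T1 -> R := a \_ D1.
Let B : T2 -> R := b \_ D2.

Let mD : measurable (D1 `*` D2). Proof. exact: measurableX. Qed.

Let mH : measurable_fun setT H.
Proof. by apply/(measurable_restrictT _ mD). Qed.

Let iA : m1.-integrable setT (EFin \o A).
Proof. by rewrite /A -restrict_EFin; apply/(integrable_mkcond _ mD1). Qed.

Let iB : m2.-integrable setT (EFin \o B).
Proof. by rewrite /B -restrict_EFin; apply/(integrable_mkcond _ mD2). Qed.

Let HAB x y : `|H (x, y)| <= `|A x| * `|B y|.
Proof.
rewrite /H /A /B /patch/= in_setX.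
case: (boolP (x \in D1)) => [/set_mem x1|_]; last first.
  by rewrite normr0 mulr_ge0.
case: (boolP (y \in D2)) => [/set_mem y1|_]; last first.
  by rewrite normr0 mulr_ge0.
by rewrite (le_trans (Fab x1 y1))// -normrM ler_norm.
Qed.

Let iH : (m1 \x m2)%E.-integrable setT (EFin \o H).
Proof.
apply/integrable12ltyP; first exact/measurable_EFinP.
apply: (@le_lt_trans _ _ (\int[m1]_x (`|A x|%:E * \int[m2]_y `|B y|%:E)))%E.
  apply: ge0_le_integral => //.
  - by move=> x _; exact: integral_ge0.
  - apply: (@measurable_fun_fubini_tonelli_F _ _ _ _ _ _ (fun z => `|(EFin \o H) z|)%E) => //.
    by apply: measurableT_comp => //; exact/measurable_EFinP.
  - apply/emeasurable_funM => //.
    by apply/measurable_EFinP/measurableT_comp => //; apply/measurable_EFinP; exact: (measurable_int m1).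
  - move=> x _; rewrite -ge0_integralZl//.
    + apply: ge0_le_integral => //.
      * apply: measurableT_comp => //; apply/measurable_EFinP.
        exact: (measurableT_comp mH (pair1_measurable x)).
      * apply/emeasurable_funM => //.
        by apply/measurable_EFinP/measurableT_comp => //; apply/measurable_EFinP; exact: (measurable_int m2).
      * by move=> y _ /=; rewrite -EFinM lee_fin.
    + by apply/measurable_EFinP/measurableT_comp => //; apply/measurable_EFinP; exact: (measurable_int m2).
rewrite ge0_integralZr//; last 2 first.
- by apply/measurable_EFinP/measurableT_comp => //; apply/measurable_EFinP; exact: (measurable_int m1).
- exact: integral_ge0.
case/integrableP: iA => _ /= Afin; case/integrableP: iB => _ /= Bfin.
by rewrite lte_mul_pinfty// ?integral_ge0// ge0_fin_numE// integral_ge0.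
Qed.

Let FE x : D1 x -> \int[m2]_(y in D2) F x y = \int[m2]_y H (x, y).
Proof.
move=> x1; rewrite Rintegral_mkcond; apply: eq_Rintegral => y _.
by rewrite /H /patch/= in_setX (mem_set x1).
Qed.

Let GE y : D2 y -> \int[m1]_(x in D1) F x y = \int[m1]_x H (x, y).
Proof.
move=> x1; rewrite Rintegral_mkcond; apply: eq_Rintegral => x _.
by rewrite /H /patch/= in_setX (mem_set x1) andbT.
Qed.

Let secx x : m2.-integrable setT (fun y => (EFin \o H) (x, y)).
Proof.
have mHx : measurable_fun setT (fun y => H (x, y)).
  exact: (measurableT_comp mH (pair1_measurable x)).
apply: (@integrable_le_dom _ _ _ _ _ _ (fun y => `|A x| * `|B y|)) => //.
exact: (integrableZl measurableT _ (integrable_norm iB)).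
Qed.

Let secy y : m1.-integrable setT (fun x => (EFin \o H) (x, y)).
Proof.
have mHx : measurable_fun setT (fun x => H (x, y)).
  exact: (measurableT_comp mH (pair2_measurable y)).
apply: (@integrable_le_dom _ _ _ _ _ _ (fun x => `|A x| * `|B y|)) => //.
exact: (integrableZr measurableT _ (integrable_norm iA)).
Qed.

Lemma integrable_Rintegral_dom :
  m1.-integrable D1 (EFin \o (fun x => \int[m2]_(y in D2) F x y)).
Proof.
have : m1.-integrable D1 (fun x => \int[m2]_y (EFin \o H) (x, y))%E.
  by apply: integrableS (integrable_fubini_F iH).
apply: eq_integrable => // x /set_mem x1 /=; rewrite FE// Rintegral_EFin//.
exact: secx.
Qed.

Lemma Rintegral_swap_dom :
  \int[m1]_(x in D1) \int[m2]_(y in D2) F x y =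
  \int[m2]_(y in D2) \int[m1]_(x in D1) F x y.
Proof.
transitivity (\int[m1]_x \int[m2]_y H (x, y)).
  rewrite Rintegral_mkcond; apply: eq_Rintegral => x _.
  rewrite /patch; case: (boolP (x \in D1)) => [/set_mem/FE//|x1].
  rewrite (@eq_Rintegral _ _ _ _ _ (cst 0)) ?Rintegral_cst ?mul0r// => y _.
  by rewrite /H /patch in_setX (negbTE x1).
transitivity (\int[m2]_y \int[m1]_x H (x, y)); last first.
  rewrite [RHS]Rintegral_mkcond; apply: eq_Rintegral => y _.
  rewrite /patch; case: (boolP (y \in D2)) => [/set_mem/GE//|y1].
  rewrite (@eq_Rintegral _ _ _ _ _ (cst 0)) ?Rintegral_cst ?mul0r// => x _.
  by rewrite /H /patch in_setX (negbTE y1) andbF.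
congr fine; transitivity (\int[m1]_x \int[m2]_y (EFin \o H) (x, y))%E.
  by apply: eq_integral => x _; rewrite Rintegral_EFin//; exact: secx.
rewrite (Fubini iH); apply: eq_integral => y _; rewrite Rintegral_EFin//; exact: secy.
Qed.

Lemma Rintegral_prod_dom :
  \int[(m1 \x m2)%E]_(z in D1 `*` D2) F z.1 z.2 =
  \int[m1]_(x in D1) \int[m2]_(y in D2) F x y /\
  (m1 \x m2)%E.-integrable (D1 `*` D2) (EFin \o (fun z => F z.1 z.2)).
Proof.
split; last first.
  by apply/(integrable_mkcond _ mD); rewrite restrict_EFin.
rewrite Rintegral_mkcond -/H.
transitivity (\int[m1]_x \int[m2]_y H (x, y)); last first.
  rewrite [RHS]Rintegral_mkcond; apply: eq_Rintegral => x _.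
  rewrite /patch; case: (boolP (x \in D1)) => [/set_mem/FE//|x1].
  rewrite (@eq_Rintegral _ _ _ _ _ (cst 0)) ?Rintegral_cst ?mul0r// => y _.
  by rewrite /H /patch in_setX (negbTE x1).
congr fine; have := integral12_prod_meas1 iH => <-.
by apply: eq_integral => x _; rewrite Rintegral_EFin//; exact: secx.
Qed.

End fubini_dominated.

(** * Powers, dilations and translations on the line *)

Section one_dimensional.
Context {R : realType}.
Local Notation leb := (@lebesgue_measure R).

(** Monotone convergence along an exhausting sequence of sets. It carries uniform bounds from
    compact segments, where a primitive or a substitution is available, to half-open or unbounded
    intervals. *)
Lemma integral_bigcup_le d (T : measurableType d) (m : {measure set T -> \bar R})
    (F : nat -> set T) (f : T -> \bar R) (M : \bar R) :
  nondecreasing_seq F -> (forall i, measurable (F i)) ->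
  measurable_fun (\bigcup_i F i) f ->
  (forall i x, F i x -> 0 <= f x)%E ->
  (forall i, \int[m]_(x in F i) f x <= M)%E ->
  (\int[m]_(x in \bigcup_i F i) f x <= M)%E.
Proof.
move=> ndF mF mf f0 fM.
have mfi i : measurable_fun (F i) f.
  by apply: measurable_funS mf; [exact: bigcup_measurable|exact: bigcup_sup].
have cv := @ge0_nondecreasing_set_cvg_integral _ _ _ F f m ndF mF mfi f0.
rewrite -(cvg_lim _ cv)//; apply: lime_le; first by apply/cvg_ex; eexists; exact: cv.
exact: nearW.
Qed.

Lemma itv0y_bigcup :
  `]0, +oo[%classic = \bigcup_n `[(n.+1%:R)^-1 : R, n.+1%:R]%classic.
Proof.
apply/seteqP; split => [x|x [n _]] /=; rewrite !in_itv/= ?andbT.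
  move=> x0; have [m mx] := ltr_add_invr (x0 : 0 < x).
  have [k kx] : exists k : nat, x <= k%:R.
    by exists (Num.bound x); rewrite ltW// archi_boundP// ltW.
  exists (maxn m k) => //=; rewrite in_itv/=; apply/andP; split.
    rewrite (le_trans _ (ltW mx))// add0r lef_pV2 ?posrE//.
    by rewrite ler_nat ltnS leq_maxl.
  by rewrite (le_trans kx)// ler_nat (leq_trans (leq_maxr m k)).
by move=> /andP[nx _]; rewrite (lt_le_trans _ nx).
Qed.

Lemma nondecreasing_itv0y :
  nondecreasing_seq (fun n => `[(n.+1%:R)^-1 : R, n.+1%:R]%classic).
Proof.
move=> m n mn; apply/subsetPset => x /=; rewrite !in_itv/= => /andP[h1 h2].
rewrite (le_trans _ h1) ?(le_trans h2) ?ler_nat ?ltnS//.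
by rewrite lef_pV2 ?posrE// ler_nat ltnS.
Qed.

Lemma continuous_powR_gt0 (a x : R) : 0 < x -> {for x, continuous (fun y : R => y `^ a)}.
Proof.
move=> x0; apply: differentiable_continuous; rewrite -derivable1_diffP.
by apply: derivable_powR; rewrite in_itv/= x0.
Qed.

Lemma integral_powR_segment (e a b : R) : e != 0 -> 0 < a -> a < b ->
  (\int[leb]_(x in `[a, b]) (x `^ (e - 1))%:E)%E =
    (e^-1 * (b `^ e - a `^ e))%:E.
Proof.
move=> e0 a0 ab.
rewrite (@continuous_FTC2 R _ (fun x => e^-1 * x `^ e))//.
- by rewrite -EFinB mulrBr.
- apply: derivable_within_continuous => x; rewrite in_itv/= => /andP[ax _].
  by apply: derivable_powR; rewrite in_itv/= andbT (lt_le_trans a0).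
- split.
  + move=> x; rewrite in_itv/= => /andP[ax _]; apply: derivableM => //.
    by apply: derivable_powR; rewrite in_itv/= andbT (lt_trans a0).
  + apply: cvgM; first exact: cvg_cst.
    by apply: cvg_at_right_filter; exact: continuous_powR_gt0.
  + apply: cvgM; first exact: cvg_cst.
    by apply: cvg_at_left_filter; apply: continuous_powR_gt0; rewrite (lt_trans a0).
- move=> x; rewrite in_itv/= => /andP[ax _].
  have x0 : 0 < x by rewrite (lt_trans a0).
  rewrite derive1E deriveZ/=; last by apply: derivable_powR; rewrite in_itv/= x0.
  rewrite -derive1E powR_derive1 ?in_itv/= ?x0//.
  by rewrite /GRing.scale/= mulrA mulVf// mul1r.
Qed.

Lemma integral_powR0 (a : R) : a < 1 ->
  (\int[leb]_(x in `]0%R, 1%R]) (x `^ (- a))%:E < +oo)%E.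
Proof.
move=> a1; apply: (@le_lt_trans _ _ ((1 - a)^-1)%:E); last exact: ltry.
(* Starting at 1/2 rather than 1 keeps every segment nondegenerate, as [integral_powR_segment]
   requires. *)
have -> : `]0, 1]%classic = \bigcup_n `[(n.+2%:R)^-1 : R, 1]%classic.
  apply/seteqP; split => [x|x [n _]] /=; rewrite !in_itv/=.
    move=> /andP[x0 x1]; have [m mx] := ltr_add_invr (x0 : 0 < x).
    exists m => //=; rewrite in_itv/= x1 andbT (le_trans _ (ltW mx))//.
    by rewrite add0r lef_pV2 ?posrE// ler_nat.
  by move=> /andP[nx ->]; rewrite (lt_le_trans _ nx).
apply: integral_bigcup_le => //.
- move=> m n mn; apply/subsetPset => x /=; rewrite !in_itv/= => /andP[h1 ->].
  by rewrite (le_trans _ h1)// lef_pV2 ?posrE// ler_nat !ltnS.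
- by apply/measurable_EFinP; apply: measurable_funTS; exact: measurable_powR.
- by move=> i x _; rewrite lee_fin powR_ge0.
have e1 : - a = (1 - a) - 1 by ring.
move=> i; under eq_integral do rewrite e1.
rewrite integral_powR_segment; last 3 first.
- by rewrite subr_eq0 gt_eqF.
- by [].
- by rewrite invf_lt1// ltr1n.
by rewrite lee_fin powR1 ler_piMr// ?invr_ge0 ?subr_ge0 ?(ltW a1)// gerBl powR_ge0.
Qed.

Lemma integral_powRy (b : R) : 1 < b ->
  (\int[leb]_(x in `[1%R, +oo[) (x `^ (- b))%:E < +oo)%E.
Proof.
move=> b1; apply: (@le_lt_trans _ _ ((b - 1)^-1)%:E); last exact: ltry.
have -> : `[1, +oo[%classic = \bigcup_n `[1 : R, n.+2%:R]%classic.
  apply/seteqP; split => [x|x [n _]] /=; rewrite !in_itv/= ?andbT.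
    move=> x1; exists (Num.bound x) => //=; rewrite in_itv/= x1/=.
    have x0 : 0 <= x by rewrite (le_trans _ x1).
    by rewrite (le_trans (ltW (archi_boundP x0)))// ler_nat -addn2 leq_addr.
  by move=> /andP[].
apply: integral_bigcup_le => //.
- move=> m n mn; apply/subsetPset => x /=; rewrite !in_itv/= => /andP[-> h2].
  by rewrite (le_trans h2)// ler_nat !ltnS.
- by apply/measurable_EFinP; apply: measurable_funTS; exact: measurable_powR.
- by move=> i x _; rewrite lee_fin powR_ge0.
move=> i; have -> : - b = (1 - b) - 1 by ring.
rewrite integral_powR_segment; last 3 first.
- by rewrite subr_eq0 lt_eqF.
- by [].
- by rewrite ltr1n.
rewrite lee_fin powR1 -(opprB b 1) invrN mulNr -mulrN opprB.
by rewrite ler_piMr// ?invr_ge0 ?subr_ge0 ?(ltW b1)// gerBl powR_ge0.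
Qed.

(** Comparison with x^(-a) at 0 and x^(-b) at infinity, the test behind most integrability claims on
    the half-line. One constant serves both ends, so its users add up the two constants they
    find. *)
Lemma integrable_powR_mix (a b C : R) (f : R -> R) : a < 1 -> 1 < b ->
  measurable_fun (`]0, +oo[ : set R) f ->
  (forall x, 0 < x -> x <= 1 -> `|f x| <= C * x `^ (- a)) ->
  (forall x, 1 <= x -> `|f x| <= C * x `^ (- b)) ->
  leb.-integrable `]0, +oo[ (EFin \o f).
Proof.
move=> a1 b1 mf fa fb.
have C0 : 0 <= C.
  by have := le_trans (normr_ge0 _) (fa 1 ltr01 (lexx _)); rewrite powR1 mulr1.
have mP e (D : set R) : measurable_fun D (fun x : R => (x `^ e)%:E).
  by apply/measurable_EFinP; apply: measurable_funTS; exact: measurable_powR.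
have E : `]0, +oo[%classic = `]0, 1] `|` `]1 : R, +oo[ by rewrite -itv_bndbnd_setU// bnd_simp.
have mf1 : measurable_fun (`]0, 1] : set R) (fun x => `|(f x)%:E|)%E.
  apply: measurableT_comp => //; apply/measurable_EFinP.
  by apply: measurable_funS mf => //; rewrite E => x; left.
have mf2 : measurable_fun (`]1, +oo[ : set R) (fun x => `|(f x)%:E|)%E.
  apply: measurableT_comp => //; apply/measurable_EFinP.
  by apply: measurable_funS mf => //; rewrite E => x; right.
apply/integrableP; split; first exact/measurable_EFinP.
rewrite E ge0_integral_setU//; first last.
- apply/disj_setPS => y [/=]; rewrite 2!in_itv/= => /andP[_ yx] /andP[].
  by rewrite ltNge yx.
- by apply/measurable_funU.
apply: lte_add_pinfty.
- apply: (@le_lt_trans _ _ (\int[leb]_(x in `]0%R, 1%R]) (C%:E * (x `^ (- a))%:E)))%E.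
    apply: ge0_le_integral => //.
    + by apply: measurable_funeM; exact: mP.
    + move=> x /=; rewrite in_itv/= => /andP[x0 x1].
      by rewrite -EFinM lee_fin fa.
  rewrite ge0_integralZl//; [|exact: mP|by move=> x _; rewrite lee_fin powR_ge0].
  by rewrite lte_mul_pinfty// integral_powR0.
- apply: (@le_lt_trans _ _ (\int[leb]_(x in `]1%R, +oo[) (C%:E * (x `^ (- b))%:E)))%E.
    apply: ge0_le_integral => //.
    + by apply: measurable_funeM; exact: mP.
    + move=> x /=; rewrite in_itv/= andbT => x1.
      by rewrite -EFinM lee_fin fb// ltW.
  rewrite ge0_integralZl//; [|exact: mP|by move=> x _; rewrite lee_fin powR_ge0].
  rewrite lte_mul_pinfty// integral_itv_obnd_cbnd//; exact: integral_powRy.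
Qed.

(* To move statements about nonnegative integrands to integrable ones. *)
Lemma Rintegral_transfer d1 d2 (T1 : measurableType d1) (T2 : measurableType d2)
    (m1 : {measure set T1 -> \bar R}) (m2 : {measure set T2 -> \bar R})
    (phi : T1 -> T2) (k : R) : 0 <= k -> measurable_fun setT phi ->
  (forall f : T2 -> \bar R, measurable_fun setT f -> (forall x, 0 <= f x)%E ->
    \int[m1]_x f (phi x) = k%:E * \int[m2]_x f x)%E ->
  forall g : T2 -> R, m2.-integrable setT (EFin \o g) ->
  m1.-integrable setT (EFin \o (g \o phi)) /\
  \int[m1]_x g (phi x) = k * \int[m2]_x g x.
Proof.
move=> k0 mphi H g ig.
have mg : measurable_fun setT (EFin \o g) by exact: (measurable_int m2).
have igphi : m1.-integrable setT (EFin \o (g \o phi)).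
  apply/integrableP; split; first exact: (measurableT_comp mg mphi).
  rewrite (H (fun y => `|(EFin \o g) y|)%E)//; last exact: measurableT_comp.
  by case/integrableP : ig => _ ?; rewrite lte_mul_pinfty.
split=> //; apply: EFin_inj.
rewrite EFinM !Rintegral_EFin// integralE [in RHS]integralE.
have -> : (\int[m1]_x (fun x => (g (phi x))%:E)^\+ x =
    k%:E * \int[m2]_x (EFin \o g)^\+ x)%E.
  rewrite -(H ((EFin \o g)^\+)%E); [|exact: measurable_funepos|by []].
  by apply: eq_integral => x _; exact: (congr1 (fun h => h x) (funepos_comp (EFin \o g) phi)).
have -> : (\int[m1]_x (fun x => (g (phi x))%:E)^\- x =
    k%:E * \int[m2]_x (EFin \o g)^\- x)%E.
  rewrite -(H ((EFin \o g)^\-)%E); [|exact: measurable_funeneg|by []].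
  by apply: eq_integral => x _; exact: (congr1 (fun h => h x) (funeneg_comp (EFin \o g) phi)).
rewrite -muleBr//; exact: integrable_add_def.
Qed.

(** Uniqueness of Lebesgue measure: [c] times its image under multiplication by [c] gives every
    interval its own length. *)
Lemma ge0_integral_scale_pos (c : R) (f : R -> \bar R) : 0 < c ->
  measurable_fun setT f -> (forall x, 0 <= f x)%E ->
  (\int[leb]_x f (c * x)%R = (c^-1)%:E * \int[leb]_x f x)%E.
Proof.
move=> c0 mf f0.
pose phi : measurableTypeR R -> measurableTypeR R := *%R c.
have mphi : measurable_fun setT phi by exact: mulrl_measurable.
pose m := mscale (NngNum (ltW c0)) (pushforward leb phi).
have mE A : measurable A -> leb A = m mphi A.
  move=> mA; apply: lebesgue_measure_unique => // _ [[a b]] _ <-.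
  change (leb `]a, b] = c%:E * leb (phi @^-1` `]a, b]))%E.
  have -> : phi @^-1` `]a, b] = `]c^-1 * a, c^-1 * b]%classic.
    apply/seteqP; split => x /=; rewrite !in_itv/=;
    by rewrite ltr_pdivrMl// ler_pdivlMl.
  rewrite !lebesgue_measure_itv/= !lte_fin ltr_pM2l ?invr_gt0//.
  case: ifPn => _; last by rewrite mule0.
  by rewrite -EFinD -EFinM -mulrBr mulrA mulfV ?gt_eqF// mul1r.
rewrite [in RHS](eq_measure_integral (m mphi)); last by move=> A mA _; exact: mE.
rewrite ge0_integral_mscale//= ge0_integral_pushforward//.
by rewrite muleA -EFinM mulVf ?gt_eqF// mul1e preimage_setT.
Qed.

Lemma ge0_integral_opp (f : R -> \bar R) :
  measurable_fun setT f -> (forall x, 0 <= f x)%E ->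
  (\int[leb]_x f (- x)%R = \int[leb]_x f x)%E.
Proof.
move=> mf f0.
rewrite [in RHS](eq_measure_integral (pushforward leb (-%R : _ -> measurableTypeR R))).
  by rewrite ge0_integral_pushforward// preimage_setT.
by move=> A mA _; exact/esym/lebesgue_measureN.
Qed.

Lemma ge0_integral_scale (c : R) (f : R -> \bar R) : c != 0 ->
  measurable_fun setT f -> (forall x, 0 <= f x)%E ->
  (\int[leb]_x f (c * x)%R = (`|c|^-1)%:E * \int[leb]_x f x)%E.
Proof.
move=> c0 mf f0; have [cp|cn|] := ltgtP 0 c.
- by rewrite ge0_integral_scale_pos// gtr0_norm.
- rewrite ltr0_norm// -ge0_integral_scale_pos ?oppr_gt0//.
  rewrite -(@ge0_integral_opp (fun x => f (- c * x))).
  + by apply: eq_integral => x _; rewrite mulrNN.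
  + by apply: measurableT_comp => //; exact: mulrl_measurable.
  + by [].
- by move=> cE; rewrite -cE eqxx in c0.
Qed.

Lemma ge0_integral_shift (c : R) (f : R -> \bar R) :
  measurable_fun setT f -> (forall x, 0 <= f x)%E ->
  (\int[leb]_x f (x + c)%R = \int[leb]_x f x)%E.
Proof.
move=> mf f0.
pose phi : measurableTypeR R -> measurableTypeR R := fun x => x + c.
have mphi : measurable_fun setT phi by exact: measurable_funD.
rewrite [in RHS](eq_measure_integral (pushforward leb phi)).
  by rewrite ge0_integral_pushforward// preimage_setT.
move=> A mA _; apply: lebesgue_measure_unique => // _ [[a b]] _ <-.
change (leb `]a, b] = leb (phi @^-1` `]a, b])).
have -> : phi @^-1` `]a, b] = `]a - c, b - c]%classic.
  by apply/seteqP; split => x /=; rewrite !in_itv/= ltrBlDr lerBrDr.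
rewrite /= !lebesgue_measure_itv/= !lte_fin ltrD2r.
by case: ifPn => // _; rewrite -!EFinD; congr EFin; ring.
Qed.

Lemma Rintegral_scale (c : R) (f : R -> R) : c != 0 ->
  leb.-integrable setT (EFin \o f) ->
  leb.-integrable setT (EFin \o (fun x => f (c * x))) /\
  \int[leb]_x f (c * x) = `|c|^-1 * \int[leb]_x f x.
Proof.
move=> c0 intf; apply: (Rintegral_transfer _ _ _ intf) => //.
by move=> g mg g0; rewrite ge0_integral_scale.
Qed.

Lemma Rintegral_shift (c : R) (f : R -> R) :
  leb.-integrable setT (EFin \o f) ->
  leb.-integrable setT (EFin \o (fun x => f (x + c))) /\
  \int[leb]_x f (x + c) = \int[leb]_x f x.
Proof.
move=> intf; have := @Rintegral_transfer _ _ _ _ leb leb (fun x => x + c) 1 ler01 _ _ f intf.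
rewrite mul1r; apply; first exact: measurable_funD.
by move=> g mg g0; rewrite ge0_integral_shift// mul1e.
Qed.

Lemma Rintegral_scale0y (c : R) (f : R -> R) : 0 < c ->
  leb.-integrable `]0, +oo[ (EFin \o f) ->
  leb.-integrable `]0, +oo[ (EFin \o (fun x => f (c * x))) /\
  \int[leb]_(x in `]0, +oo[) f (c * x) = c^-1 * \int[leb]_(x in `]0, +oo[) f x.
Proof.
move=> c0 intf.
have mI : measurable (`]0, +oo[%classic : set (measurableTypeR R)) by exact: measurable_itv.
have intf' : leb.-integrable setT (EFin \o (f \_ `]0, +oo[)).
  by rewrite -restrict_EFin; apply/(integrable_mkcond _ mI).
have [i1 i2] := @Rintegral_scale c (f \_ `]0, +oo[) (lt0r_neq0 c0) intf'.
have E : (fun x => (f \_ `]0, +oo[) (c * x)) = (fun x => f (c * x)) \_ `]0, +oo[.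
  apply/funext => x; rewrite /patch !mem_setE !in_itv/= !andbT.
  by rewrite pmulr_rgt0.
split.
  by apply/(integrable_mkcond _ mI); rewrite restrict_EFin -E.
rewrite [LHS]Rintegral_mkcond [in RHS]Rintegral_mkcond.
by move: i2; rewrite gtr0_norm// E.
Qed.

End one_dimensional.

(** * Lebesgue measure on row vectors *)

Section laplace_kernel.
Context {R : realType}.
Local Notation leb := (@lebesgue_measure R).

Definition laplace (delta xi : R) : R := expR (- (delta * `|xi|)).

Lemma laplace_ge0 delta xi : 0 <= laplace delta xi.
Proof. exact: expR_ge0. Qed.

Lemma laplaceN delta xi : laplace delta (- xi) = laplace delta xi.
Proof. by rewrite /laplace normrN. Qed.

Lemma continuous_laplace delta : continuous (laplace delta).
Proof.
move=> x; apply: continuous_comp; last exact: continuous_expR.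
apply: cvgN; apply: cvgM; first exact: cvg_cst.
exact: norm_continuous.
Qed.

Lemma laplace_cvg0 (delta : R) : 0 < delta ->
  expR (- (delta * u)) @[u --> +oo] --> 0.
Proof.
move=> d0.
apply: (@cvg_comp _ _ _ (fun u : R => delta * u) (fun y => expR (- y)) _ +oo).
  exact: gt0_cvgMry.
exact: cvgr_expR.
Qed.

Lemma integral_laplace_half (delta : R) : 0 < delta ->
  (\int[leb]_(u in `[0%R, +oo[) (laplace delta u)%:E = (delta^-1)%:E)%E.
Proof.
move=> d0.
pose F (u : R) := - delta^-1 * expR (- (delta * u)).
pose f (u : R) := expR (- (delta * u)).
have dF (u : R) : is_derive u 1 F (f u).
  apply: is_derive_eq; rewrite /f /GRing.scale/=.
  by field; rewrite gt_eqF.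
transitivity (\int[leb]_(u in `[0%R, +oo[) (f u)%:E)%E.
  apply: eq_integral => u; rewrite inE/= in_itv/= andbT => u0.
  by rewrite /laplace ger0_norm.
have cf : continuous f.
  move=> x; apply: continuous_comp; last exact: continuous_expR.
  by apply: cvgN; apply: cvgM; [exact: cvg_cst|exact: cvg_id].
rewrite (@ge0_continuous_FTC2y R f F 0 0).
- by rewrite /F mulr0 oppr0 expR0 mulr1 sub0e EFinN oppeK.
- by move=> x _; exact: expR_ge0.
- exact: continuous_subspaceT.
- by rewrite -[X in _ --> X](mulr0 (- delta^-1)); apply: cvgM; [exact: cvg_cst|exact: laplace_cvg0].
- by move=> x _; exact: ex_derive.
- apply: cvg_at_right_filter; apply: differentiable_continuous.
  by rewrite -derivable1_diffP; exact: ex_derive.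
- by move=> x _; rewrite derive1E; exact: derive_val.
Qed.

(** The summand 1 makes the integrand nonnegative, which is used by the fundamental theorem on the
    half-line and later by the reflection to the whole line; [Rintegral_cos_laplace] removes it
    again. The primitive comes from integrating by parts twice. *)
Lemma integral_cos_laplace_half (delta x : R) : 0 < delta ->
  (\int[leb]_(u in `[0%R, +oo[) ((1 + cos (x * u)) * laplace delta u)%:E =
   (delta^-1 + delta / (delta ^+ 2 + x ^+ 2))%:E)%E.
Proof.
move=> d0.
have q0 : delta ^+ 2 + x ^+ 2 != 0.
  by rewrite gt_eqF// ltr_pwDl ?sqr_ge0// exprn_gt0.
pose F (u : R) := (- delta^-1 + (x * sin (x * u) - delta * cos (x * u)) /
   (delta ^+ 2 + x ^+ 2)) * expR (- (delta * u)).
pose f (u : R) := (1 + cos (x * u)) * expR (- (delta * u)).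
have dF (u : R) : is_derive u 1 F (f u).
  apply: is_derive_eq; rewrite /f /GRing.scale/=.
  by field; rewrite q0 gt_eqF.
transitivity (\int[leb]_(u in `[0%R, +oo[) (f u)%:E)%E.
  apply: eq_integral => u; rewrite inE/= in_itv/= andbT => u0.
  by rewrite /laplace ger0_norm.
have cf : continuous f.
  move=> u; apply: cvgM.
    apply: cvgD; first exact: cvg_cst.
    apply: continuous_comp; last exact: continuous_cos.
    by apply: cvgM; [exact: cvg_cst|exact: cvg_id].
  apply: continuous_comp; last exact: continuous_expR.
  by apply: cvgN; apply: cvgM; [exact: cvg_cst|exact: cvg_id].
rewrite (@ge0_continuous_FTC2y R f F 0 0).
- rewrite /F !mulr0 sin0 cos0 oppr0 expR0 mulr1 sub0e -EFinN; congr EFin.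
  by field; rewrite q0 gt_eqF.
- by move=> u _; rewrite mulr_ge0 ?expR_ge0// -lerBlDl sub0r cos_geN1.
- exact: continuous_subspaceT.
- pose M := delta^-1 + (`|x| + delta) / (delta ^+ 2 + x ^+ 2).
  have FM u : `|F u| <= M * expR (- (delta * u)).
    rewrite normrM (ger0_norm (expR_ge0 _)) ler_wpM2r ?expR_ge0//.
    rewrite (le_trans (ler_normD _ _))// /M lerD//.
      by rewrite normrN ger0_norm// invr_ge0 ltW.
    have q1 : 0 <= (delta ^+ 2 + x ^+ 2)^-1 by rewrite invr_ge0 addr_ge0 ?sqr_ge0.
    rewrite normrM (ger0_norm q1) ler_wpM2r// (le_trans (ler_normB _ _))//.
    rewrite !normrM lerD//.
      by rewrite ler_piMr// ler_norml sin_geN1 sin_le1.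
    rewrite (ger0_norm (ltW d0)).
    by rewrite ler_piMr ?(ltW d0)// ler_norml cos_geN1 cos_le1.
  apply/cvgr0Pnorm_le => e e0.
  have : M * expR (- (delta * u)) @[u --> +oo] --> 0.
    by rewrite -[X in _ --> X](mulr0 M); apply: cvgM; [exact: cvg_cst|exact: laplace_cvg0].
  move/cvgr0Pnorm_le => /(_ e e0); apply: filterS => u.
  by apply: le_trans; rewrite (le_trans (FM u))// ler_norm.
- by move=> u _; exact: ex_derive.
- apply: cvg_at_right_filter; apply: differentiable_continuous.
  by rewrite -derivable1_diffP; exact: ex_derive.
- by move=> u _; rewrite derive1E; exact: derive_val.
Qed.

Lemma integrable_laplace (delta : R) : 0 < delta ->
  leb.-integrable setT (EFin \o laplace delta).
Proof.
move=> d0; apply: integrable_ge0_lty => //.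
- by apply: continuous_measurable_fun; exact: continuous_laplace.
- by move=> x _; exact: laplace_ge0.
rewrite ge0_symfun_integralT.
- by rewrite -set_itvcy integral_laplace_half// -EFinM ltry.
- by move=> x; exact: laplace_ge0.
- exact: continuous_laplace.
- by move=> x /=; rewrite laplaceN.
Qed.

Lemma Rintegral_laplace (delta : R) : 0 < delta ->
  \int[leb]_u laplace delta u = 2 * delta^-1.
Proof.
move=> d0; rewrite /Rintegral ge0_symfun_integralT.
- by rewrite -set_itvcy integral_laplace_half// -EFinM.
- by move=> x; exact: laplace_ge0.
- exact: continuous_laplace.
- by move=> x /=; rewrite laplaceN.
Qed.

Lemma measurable_cosM (x : R) : measurable_fun setT (fun u : R => cos (x * u)).
Proof.
apply: continuous_measurable_fun => u.
apply: continuous_comp; last exact: continuous_cos.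
by apply: cvgM; [exact: cvg_cst|exact: cvg_id].
Qed.

Lemma measurable_sinM (x : R) : measurable_fun setT (fun u : R => sin (x * u)).
Proof.
apply: continuous_measurable_fun => u.
apply: continuous_comp; last exact: continuous_sin.
by apply: cvgM; [exact: cvg_cst|exact: cvg_id].
Qed.

Lemma measurable_laplace (delta : R) : measurable_fun setT (laplace delta).
Proof. by apply: continuous_measurable_fun; exact: continuous_laplace. Qed.

Lemma normr_cos_le1 (x : R) : `|cos x| <= 1.
Proof. by rewrite ler_norml cos_geN1 cos_le1. Qed.

Lemma normr_sin_le1 (x : R) : `|sin x| <= 1.
Proof. by rewrite ler_norml sin_geN1 sin_le1. Qed.

Lemma integrable_cos_laplace (delta x : R) : 0 < delta ->
  leb.-integrable setT (EFin \o (fun u => cos (x * u) * laplace delta u)).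
Proof.
move=> d0; apply: (integrable_le_dom _ _ (integrable_laplace d0)) => //.
  by apply: measurable_funM; [exact: measurable_cosM|exact: measurable_laplace].
move=> u _; rewrite normrM (ger0_norm (laplace_ge0 _ _)) ler_piMl ?laplace_ge0//.
exact: normr_cos_le1.
Qed.

Lemma integrable_sin_laplace (delta x : R) : 0 < delta ->
  leb.-integrable setT (EFin \o (fun u => sin (x * u) * laplace delta u)).
Proof.
move=> d0; apply: (integrable_le_dom _ _ (integrable_laplace d0)) => //.
  by apply: measurable_funM; [exact: measurable_sinM|exact: measurable_laplace].
move=> u _; rewrite normrM (ger0_norm (laplace_ge0 _ _)) ler_piMl ?laplace_ge0//.
exact: normr_sin_le1.
Qed.

Lemma Rintegral_cos_laplace (delta x : R) : 0 < delta ->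
  \int[leb]_u (cos (x * u) * laplace delta u) =
  2 * delta / (delta ^+ 2 + x ^+ 2).
Proof.
move=> d0.
have q0 : delta ^+ 2 + x ^+ 2 != 0.
  by rewrite gt_eqF// ltr_pwDl ?sqr_ge0// exprn_gt0.
have : \int[leb]_u ((1 + cos (x * u)) * laplace delta u) =
    2 * (delta^-1 + delta / (delta ^+ 2 + x ^+ 2)).
  rewrite /Rintegral ge0_symfun_integralT.
  - by rewrite -set_itvcy integral_cos_laplace_half.
  - by move=> u; rewrite mulr_ge0 ?laplace_ge0// -lerBlDl sub0r cos_geN1.
  - move=> u; apply: cvgM; last exact: continuous_laplace.
    apply: cvgD; first exact: cvg_cst.
    apply: continuous_comp; last exact: continuous_cos.
    by apply: cvgM; [exact: cvg_cst|exact: cvg_id].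
  - by move=> u /=; rewrite laplaceN mulrN cosN.
have -> : (fun u => (1 + cos (x * u)) * laplace delta u) =
    (fun u => laplace delta u + cos (x * u) * laplace delta u).
  by apply/funext => u; rewrite mulrDl mul1r.
rewrite RintegralD//; [|exact: integrable_laplace|exact: integrable_cos_laplace].
rewrite Rintegral_laplace// => /(canRL (addKr _)) ->.
by field; rewrite q0 gt_eqF.
Qed.

Lemma Rintegral_sin_laplace (delta x : R) : 0 < delta ->
  \int[leb]_u (sin (x * u) * laplace delta u) = 0.
Proof.
move=> d0.
have n1 : (-1 : R) != 0 by rewrite oppr_eq0 oner_eq0.
have [_] := Rintegral_scale n1 (@integrable_sin_laplace _ x d0).
rewrite normrN1 invr1 mul1r.
have -> : (fun u => sin (x * (-1 * u)) * laplace delta (-1 * u)) =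
    (fun u => -1 * (sin (x * u) * laplace delta u)).
  by apply/funext => u; rewrite !mulN1r laplaceN mulrN sinN mulNr.
rewrite RintegralZl//; last exact: integrable_sin_laplace.
by move=> h; lra.
Qed.

End laplace_kernel.

Lemma normrM_le1 (R : realType) (c p : R) : `|c| <= 1 -> 0 <= p -> `|c * p| <= p.
Proof. by move=> c1 p0; rewrite normrM (ger0_norm p0) ler_piMl. Qed.

(** * Integration over row vectors, one coordinate at a time *)

Section lebesgue_rV_theory.
Context {R : realType}.
Local Notation leb := (@lebesgue_measure R).

Lemma ge0_integral_image d1 d2 (T1 : measurableType d1) (T2 : measurableType d2)
    (m1 : {measure set T1 -> \bar R}) (m2 : {measure set T2 -> \bar R})
    (phi : T1 -> T2) (f : T2 -> \bar R) : measurable_fun setT phi ->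
  (forall A, measurable A -> m2 A = m1 (phi @^-1` A)) ->
  measurable_fun setT f -> (forall x, 0 <= f x)%E ->
  (\int[m2]_x f x = \int[m1]_x f (phi x))%E.
Proof.
move=> mphi m12 mf f0.
rewrite (eq_measure_integral (pushforward m1 phi)); last first.
  by move=> A mA _; exact: m12.
by rewrite ge0_integral_pushforward// preimage_setT.
Qed.

Lemma integral_rV0 (f : 'rV[R]_0 -> \bar R) : measurable_fun setT f ->
  (\int[lebesgue_rV 0]_x f x = f 0%R)%E.
Proof.
move=> mf; transitivity (\int[dirac (0%R : 'rV[R]_0)]_x f x)%E; first by [].
by rewrite integral_dirac// diracE mem_set// mul1e.
Qed.

(** [lebesgue_rV n.+1] is by definition the image of a product measure under [rV_cons], so this is
    Tonelli after a change of variables. *)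
Lemma ge0_integral_rVS n (f : 'rV[R]_n.+1 -> \bar R) :
  measurable_fun setT f -> (forall x, 0 <= f x)%E ->
  (\int[lebesgue_rV n.+1]_x f x =
   \int[leb]_x \int[lebesgue_rV n]_v f (rV_cons (x, v)))%E.
Proof.
move=> mf f0.
have mc := @measurable_rV_cons R n.
rewrite (@ge0_integral_image _ _ _ _ (leb \x lebesgue_rV n)%E _ (@rV_cons R n))//.
rewrite (fubini_tonelli1 (f \o @rV_cons R n))//.
  exact: measurableT_comp mf mc.
by move=> x; exact: f0.
Qed.

Lemma measurable_scale_rV n (c : R) :
  measurable_fun setT (fun x : 'rV[R]_n => c *: x).
Proof.
apply: measurable_fun_rV => i; under eq_fun do rewrite mxE.
by apply: measurable_funM => //; exact: measurable_coord_rV.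
Qed.

Lemma scale_rV_cons n (c x : R) (v : 'rV[R]_n) :
  c *: rV_cons (x, v) = rV_cons (c * x, c *: v).
Proof.
apply/rowP => i; rewrite mxE; case: (unliftP ord0 i) => [j|] ->.
  by rewrite !rV_consS mxE.
by rewrite !rV_cons0.
Qed.

Lemma ge0_integral_rV_scale n (c : R) (f : 'rV[R]_n -> \bar R) : c != 0 ->
  measurable_fun setT f -> (forall x, 0 <= f x)%E ->
  (\int[lebesgue_rV n]_x f (c *: x)%R =
   (`|c| ^- n)%:E * \int[lebesgue_rV n]_x f x)%E.
Proof.
move=> c0; elim: n f => [|n IH] f mf f0.
  rewrite expr0 invr1 mul1e; apply: eq_integral => x _; congr f.
  by apply/rowP => -[].
rewrite ge0_integral_rVS//; last first.
  by apply: measurableT_comp => //; exact: measurable_scale_rV.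
have mfc : measurable_fun setT (fun z : measurableTypeR R * 'rV[R]_n => f (rV_cons z)).
  exact: measurableT_comp mf (@measurable_rV_cons R n).
pose g x := (\int[lebesgue_rV n]_v f (rV_cons (x, v)))%E.
have mg : measurable_fun setT g by exact: (measurable_fun_fubini_tonelli_F (fun z => f (rV_cons z))).
have g0 x : (0 <= g x)%E by exact: integral_ge0.
transitivity (\int[leb]_x ((`|c| ^- n)%:E * g (c * x)%R))%E.
  apply: eq_integral => x _; under eq_integral do rewrite scale_rV_cons.
  rewrite (IH (fun v => f (rV_cons (c * x, v))))//.
  exact: measurableT_comp mfc (pair1_measurable _).
rewrite ge0_integralZl//; last first.
  by apply: measurableT_comp => //; exact: mulrl_measurable.
rewrite ge0_integral_scale// muleA -EFinM ge0_integral_rVS//.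
by congr (_%:E * _)%E; rewrite exprS invfM mulrC.
Qed.

Lemma Rintegral_rV_scale n (c : R) (f : 'rV[R]_n -> R) : c != 0 ->
  (lebesgue_rV n).-integrable setT (EFin \o f) ->
  (lebesgue_rV n).-integrable setT (EFin \o (fun x => f (c *: x))) /\
  \int[lebesgue_rV n]_x f (c *: x) = `|c| ^- n * \int[lebesgue_rV n]_x f x.
Proof.
move=> c0 intf; apply: (Rintegral_transfer _ _ _ intf).
- by rewrite invr_ge0 exprn_ge0.
- exact: measurable_scale_rV.
- by move=> g mg g0; rewrite ge0_integral_rV_scale.
Qed.

Lemma Rintegral_rV_opp n (f : 'rV[R]_n -> R) :
  (lebesgue_rV n).-integrable setT (EFin \o f) ->
  \int[lebesgue_rV n]_x f (- x) = \int[lebesgue_rV n]_x f x.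
Proof.
move=> intf; have n1 : (-1 : R) != 0 by rewrite oppr_eq0 oner_eq0.
have [_] := Rintegral_rV_scale n1 intf; rewrite normrN1 expr1n invr1 mul1r => <-.
by apply: eq_Rintegral => x _; rewrite scaleN1r.
Qed.

(** The signed counterpart of [ge0_integral_rVS], with domination by a product in place of
    nonnegativity. *)
Lemma Rintegral_rVS n (F : 'rV[R]_n.+1 -> R) (a : R -> R) (b : 'rV[R]_n -> R) :
  measurable_fun setT F -> leb.-integrable setT (EFin \o a) ->
  (lebesgue_rV n).-integrable setT (EFin \o b) ->
  (forall x v, `|F (rV_cons (x, v))| <= a x * b v) ->
  (lebesgue_rV n.+1).-integrable setT (EFin \o F) /\
  \int[lebesgue_rV n.+1]_x F x =
  \int[leb]_x \int[lebesgue_rV n]_v F (rV_cons (x, v)).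
Proof.
move=> mF ia ib Fab.
have mc := @measurable_rV_cons R n.
have mFc : measurable_fun setT (fun z : measurableTypeR R * 'rV[R]_n => F (rV_cons (z.1, z.2))).
  rewrite (_ : (fun _ => _) = (fun z => F (rV_cons z))); last by apply/funext => -[].
  exact: measurableT_comp mF mc.
have [||E iF] := @Rintegral_prod_dom _ _ _ _ R leb (lebesgue_rV n) setT setT
  (fun x v => F (rV_cons (x, v))) a b measurableT measurableT _ ia ib _.
- by rewrite setXTT.
- by move=> x y _ _; exact: Fab.
rewrite setXTT in E iF.
have EF : (fun z : measurableTypeR R * 'rV[R]_n => F (rV_cons (z.1, z.2))) = F \o @rV_cons R n.
  by apply/funext => -[].
rewrite EF in E iF.
have iF' : (lebesgue_rV n.+1).-integrable setT (EFin \o F).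
  apply/integrableP; split; first exact/measurable_EFinP.
  rewrite (@ge0_integral_image _ _ _ _ (leb \x lebesgue_rV n)%E _ (@rV_cons R n))//.
    by case/integrableP : iF.
  by apply: measurableT_comp => //; exact/measurable_EFinP.
split=> //; rewrite -E; have [|_] := @Rintegral_transfer _ _ _ _ _ (leb \x lebesgue_rV n)%E
  (lebesgue_rV n.+1) (@rV_cons R n) 1 ler01 mc _ F iF'; last by rewrite mul1r => <-.
move=> f mf f0; rewrite mul1e.
by rewrite (@ge0_integral_image _ _ _ _ (leb \x lebesgue_rV n)%E _ (@rV_cons R n)).
Qed.

Lemma dot_rV_cons n (x : 'rV[R]_n.+1) (y : R) (w : 'rV[R]_n) :
  dot x (rV_cons (y, w)) = x ord0 ord0 * y + dot (rV_uncons x).2 w.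
Proof.
rewrite /dot big_ord_recl rV_cons0; congr (_ + _).
by apply: eq_bigr => i _; rewrite rV_consS rV_unconsE.
Qed.

Lemma measurable_dot n d (T : measurableType d) (f g : T -> 'rV[R]_n) :
  measurable_fun setT f -> measurable_fun setT g ->
  measurable_fun setT (fun t => dot (f t) (g t)).
Proof.
move=> mf mg; apply: measurable_sum => i; apply: measurable_funM.
- exact: measurableT_comp (measurable_coord_rV i) mf.
- exact: measurableT_comp (measurable_coord_rV i) mg.
Qed.

Lemma dot0r n (x : 'rV[R]_n) : dot x 0 = 0.
Proof. by rewrite /dot big1// => i _; rewrite mxE mulr0. Qed.

Lemma dotZr n c (x y : 'rV[R]_n) : dot x (c *: y) = c * dot x y.
Proof. by rewrite /dot mulr_sumr; apply: eq_bigr => i _; rewrite mxE mulrCA. Qed.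

Lemma dotZl n c (x y : 'rV[R]_n) : dot (c *: x) y = c * dot x y.
Proof. by rewrite /dot mulr_sumr; apply: eq_bigr => i _; rewrite mxE mulrA. Qed.

Lemma dotC n (x y : 'rV[R]_n) : dot x y = dot y x.
Proof. by apply: eq_bigr => i _; rewrite mulrC. Qed.

Lemma dotDl n (x y z : 'rV[R]_n) : dot (x + y) z = dot x z + dot y z.
Proof. by rewrite /dot -big_split; apply: eq_bigr => i _; rewrite mxE mulrDl. Qed.

Lemma dotNl n (x y : 'rV[R]_n) : dot (- x) y = - dot x y.
Proof. by rewrite -scaleN1r dotZl mulN1r. Qed.

Lemma measurable_coord_prod n (h : R -> R) : measurable_fun setT h ->
  measurable_fun setT (fun x : 'rV[R]_n => \prod_i h (x ord0 i)).
Proof.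
move=> mh; apply: measurable_prod => i _.
exact: measurableT_comp mh (measurable_coord_rV i).
Qed.

Lemma integrable_coord_prod n (h : R -> R) : (forall x, 0 <= h x) ->
  leb.-integrable setT (EFin \o h) ->
  (lebesgue_rV n).-integrable setT (EFin \o (fun x => \prod_i h (x ord0 i))) /\
  \int[lebesgue_rV n]_x (\prod_i h (x ord0 i)) = (\int[leb]_x h x) ^+ n.
Proof.
move=> h0 ih.
have mh : measurable_fun setT h by apply/measurable_EFinP; exact: (measurable_int leb).
elim: n => [|n [IH1 IH2]].
  split.
    apply/integrableP; split.
      by apply/measurable_EFinP; exact: measurable_coord_prod.
    rewrite integral_rV0; first by rewrite /= big_ord0 normr1 ltry.
    by apply: measurableT_comp => //; apply/measurable_EFinP; exact: measurable_coord_prod.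
  rewrite /Rintegral integral_rV0 ?big_ord0 ?expr0//.
  by apply/measurable_EFinP; exact: measurable_coord_prod.
have [||iF E] := @Rintegral_rVS n (fun x => \prod_i h (x ord0 i)) h
  (fun v => \prod_i h (v ord0 i)) _ ih IH1 _.
- exact: measurable_coord_prod.
- move=> x v; rewrite big_ord_recl rV_cons0 ger0_norm ?mulr_ge0 ?prodr_ge0//=.
  by under eq_bigr do rewrite rV_consS/=.
split=> //; rewrite E.
transitivity (\int[leb]_x (h x * (\int[leb]_x h x) ^+ n)).
  apply: eq_Rintegral => x _; rewrite -IH2 -RintegralZl//.
  apply: eq_Rintegral => v _; rewrite big_ord_recl rV_cons0/=.
  by under eq_bigr do rewrite rV_consS/=.
by rewrite RintegralZr// exprS.
Qed.

(** The sine integral has to be carried along: cos(x0 u + y.v) expands into cosines and sines of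
    y.v, and the sine part drops out because its integral over v vanishes. The outcome is a product
    of Cauchy kernels, which is nonnegative and whose mass does not depend on delta. *)
Lemma cos_laplace_rV n (delta : R) (x : 'rV[R]_n) : 0 < delta ->
  \int[lebesgue_rV n]_xi (cos (dot x xi) * \prod_i laplace delta (xi ord0 i)) =
    \prod_i (2 * delta / (delta ^+ 2 + x ord0 i ^+ 2)) /\
  \int[lebesgue_rV n]_xi (sin (dot x xi) * \prod_i laplace delta (xi ord0 i)) = 0.
Proof.
move=> d0; elim: n x => [|n IH] x.
  have mP := @measurable_coord_prod 0 _ (@measurable_laplace R delta).
  have md : measurable_fun setT (fun y => dot x y) by exact: measurable_dot.
  rewrite /Rintegral !integral_rV0.
  - by rewrite /= !big_ord0 dot0r cos0 sin0 mul0r mulr1.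
  - apply/measurable_EFinP; apply: measurable_funM => //.
    by apply: measurableT_comp md; apply: continuous_measurable_fun; exact: continuous_sin.
  - apply/measurable_EFinP; apply: measurable_funM => //.
    by apply: measurableT_comp md; apply: continuous_measurable_fun; exact: continuous_cos.
have [IHc IHs] := IH (rV_uncons x).2.
have [iP _] := @integrable_coord_prod n _ (laplace_ge0 delta) (integrable_laplace d0).
set P := (fun v : 'rV[R]_n => \prod_i laplace delta (v ord0 i)) in iP IHc IHs *.
have P0 v : 0 <= P v by rewrite prodr_ge0// => i _; exact: laplace_ge0.
have mP : measurable_fun setT P.
  by apply: measurable_coord_prod; exact: measurable_laplace.
have mcos (y : 'rV[R]_n) : measurable_fun setT (fun v => cos (dot y v)).
  by apply: measurableT_comp; [apply: continuous_measurable_fun; exact: continuous_cos|exact: measurable_dot].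
have msin (y : 'rV[R]_n) : measurable_fun setT (fun v => sin (dot y v)).
  by apply: measurableT_comp; [apply: continuous_measurable_fun; exact: continuous_sin|exact: measurable_dot].
have icos : (lebesgue_rV n).-integrable setT (EFin \o (fun v => cos (dot (rV_uncons x).2 v) * P v)).
  apply: (integrable_le_dom _ _ iP) => //; first exact: measurable_funM.
  by move=> v _; rewrite normrM_le1// normr_cos_le1.
have isin : (lebesgue_rV n).-integrable setT (EFin \o (fun v => sin (dot (rV_uncons x).2 v) * P v)).
  apply: (integrable_le_dom _ _ iP) => //; first exact: measurable_funM.
  by move=> v _; rewrite normrM_le1// normr_sin_le1.
have PE u v : \prod_i laplace delta (rV_cons (u, v) ord0 i) = laplace delta u * P v.
  by rewrite big_ord_recl rV_cons0/=; under eq_bigr do rewrite rV_consS/=.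
have mP1 : measurable_fun setT (fun v : 'rV[R]_n.+1 => \prod_i laplace delta (v ord0 i)).
  by apply: measurable_coord_prod; exact: measurable_laplace.
set x0 := x ord0 ord0.
split.
- have [||_ ->] := @Rintegral_rVS n (fun xi => cos (dot x xi) * \prod_i laplace delta (xi ord0 i))
    (laplace delta) P _ (integrable_laplace d0) iP _.
  + apply: measurable_funM => //.
    by apply: measurableT_comp; [apply: continuous_measurable_fun; exact: continuous_cos|exact: measurable_dot].
  + move=> u v; rewrite PE; apply: normrM_le1; first exact: normr_cos_le1.
    by rewrite mulr_ge0 ?laplace_ge0.
  rewrite big_ord_recl -[X in _ = X * _]Rintegral_cos_laplace//.
  have -> : \prod_(i < n) (2 * delta / (delta ^+ 2 + x ord0 (lift ord0 i) ^+ 2)) =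
    \prod_(i < n) (2 * delta / (delta ^+ 2 + (rV_uncons x).2 ord0 i ^+ 2)).
    by apply: eq_bigr => i _; rewrite rV_unconsE.
  rewrite -IHc -RintegralZr//; last exact: integrable_cos_laplace.
  apply: eq_Rintegral => u _.
  transitivity (\int[lebesgue_rV n]_v (cos (x0 * u) * laplace delta u * (cos (dot (rV_uncons x).2 v) * P v)
     - sin (x0 * u) * laplace delta u * (sin (dot (rV_uncons x).2 v) * P v))).
    apply: eq_Rintegral => v _; rewrite PE dot_rV_cons cosD -/x0; ring.
  rewrite RintegralB//; [|exact: integrable_scale|exact: integrable_scale].
  by rewrite !RintegralZl// IHs mulr0 subr0.
- have [||_ ->] := @Rintegral_rVS n (fun xi => sin (dot x xi) * \prod_i laplace delta (xi ord0 i))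
    (laplace delta) P _ (integrable_laplace d0) iP _.
  + apply: measurable_funM => //.
    by apply: measurableT_comp; [apply: continuous_measurable_fun; exact: continuous_sin|exact: measurable_dot].
  + move=> u v; rewrite PE; apply: normrM_le1; first exact: normr_sin_le1.
    by rewrite mulr_ge0 ?laplace_ge0.
  transitivity (\int[leb]_u ((\int[lebesgue_rV n]_v (cos (dot (rV_uncons x).2 v) * P v)) *
     (sin (x0 * u) * laplace delta u))).
    apply: eq_Rintegral => u _.
    transitivity (\int[lebesgue_rV n]_v (sin (x0 * u) * laplace delta u * (cos (dot (rV_uncons x).2 v) * P v)
       + cos (x0 * u) * laplace delta u * (sin (dot (rV_uncons x).2 v) * P v))).
      apply: eq_Rintegral => v _; rewrite PE dot_rV_cons sinD -/x0; ring.
    rewrite RintegralD//; [|exact: integrable_scale|exact: integrable_scale].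
    by rewrite !RintegralZl// IHs mulr0 addr0 mulrC.
  by rewrite RintegralZl ?Rintegral_sin_laplace ?mulr0//; exact: integrable_sin_laplace.
Qed.

Lemma lebesgue_rV_setT_gt0 n : (0 < lebesgue_rV n [set: 'rV[R]_n])%E.
Proof.
pose B := [set v : 'rV[R]_n | forall i, v ord0 i \in `](0 : 'rV[R]_n) ord0 i, (const_mx 1 : 'rV[R]_n) ord0 i]].
have mB : measurable B.
  rewrite (_ : B = \bigcap_(i in [set: 'I_n])
    ((fun v : 'rV[R]_n => v ord0 i) @^-1` [set` `](0 : 'rV[R]_n) ord0 i, (const_mx 1 : 'rV[R]_n) ord0 i]])).
    apply: fin_bigcap_measurable => // i _.
    by rewrite -[X in measurable X]setTI; apply: measurable_coord_rV.
  by apply/seteqP; split => [v h i _|v h i]; exact: h.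
apply: (@lt_le_trans _ _ (lebesgue_rV n B)); last by apply: le_measure; rewrite ?inE.
rewrite lebesgue_rV_box; last by move=> i; rewrite !mxE.
by rewrite lte_fin prodr_gt0// => i _; rewrite !mxE subr0.
Qed.

End lebesgue_rV_theory.

(** * Positive multipliers *)

(** No integrability is assumed: a real integral is [fine] of the difference of the integrals of the
    positive and negative parts, and each of these is measurable in the parameter by Tonelli. *)
Lemma measurable_Rintegral_param d1 d2 (T1 : measurableType d1)
    (T2 : measurableType d2) (R : realType)
    (m2 : {sigma_finite_measure set T2 -> \bar R}) (D : set T2)
    (F : T1 -> T2 -> R) : measurable D ->
  measurable_fun setT (fun z : T1 * T2 => F z.1 z.2) ->
  measurable_fun setT (fun x => \int[m2]_(y in D) F x y).
Proof.
move=> mD mF.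
pose H : T1 * T2 -> R := (fun z => F z.1 z.2) \_ (setT `*` D).
have mH : measurable_fun setT H.
  have mX : measurable (setT `*` D : set (T1 * T2)) by exact: measurableX.
  by apply/(measurable_restrictT _ mX); exact: measurable_funTS.
have mHp : measurable_fun setT ((EFin \o H)^\+)%E.
  by apply: measurable_funepos; exact/measurable_EFinP.
have mHn : measurable_fun setT ((EFin \o H)^\-)%E.
  by apply: measurable_funeneg; exact/measurable_EFinP.
have -> : (fun x => \int[m2]_(y in D) F x y) = (fun x =>
    fine ((\int[m2]_y ((EFin \o H)^\+)%E (x, y)) - (\int[m2]_y ((EFin \o H)^\-)%E (x, y)))%E).
  apply/funext => x; rewrite Rintegral_mkcond /Rintegral integralE.
  congr (fine (_ - _)); apply: eq_integral => y _.
    rewrite [RHS](_ : _ = ((EFin \o H)^\+ \o pair x)%E y)// -funepos_comp.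
    by congr ((_ ^\+)%E _); apply/funext => z; rewrite /H /patch/= in_setX in_setT.
  rewrite [RHS](_ : _ = ((EFin \o H)^\- \o pair x)%E y)// -funeneg_comp.
  by congr ((_ ^\-)%E _); apply/funext => z; rewrite /H /patch/= in_setX in_setT.
apply: measurableT_comp => //; apply: emeasurable_funB.
- exact: measurable_fun_fubini_tonelli_F.
- exact: measurable_fun_fubini_tonelli_F.
Qed.

Lemma cvgn_ge0 (R : realType) (u : nat -> R) (l : R) :
  u @ \oo --> l -> (forall n, 0 <= u n) -> 0 <= l.
Proof.
move=> ul u0; rewrite -(cvg_lim _ ul)//; apply: limr_ge; last exact: nearW.
by apply/cvg_ex; exists l.
Qed.

Lemma cvgn_le_cst (R : realType) (u : nat -> R) (l c : R) :
  u @ \oo --> l -> (forall n, u n <= c) -> l <= c.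
Proof.
move=> ul uc; rewrite -subr_ge0; apply: (@cvgn_ge0 _ (fun n => c - u n)).
  by apply: cvgB => //; exact: cvg_cst.
by move=> n; rewrite subr_ge0.
Qed.

Section positive_multipliers.
Context {R : realType} {n : nat}.
Local Notation L := (@lebesgue_rV R n).
Implicit Types (f g h : 'rV[R]_n -> R) (x y : 'rV[R]_n).

Definition cos_transform h x : R := \int[L]_xi (cos (dot x xi) * h xi).

(* Bounded positive definite functions, in a form that avoids Bochner's
   theorem: multiplying by them preserves nonnegativity of the transform. *)
Definition positive_multiplier f : Prop :=
  [/\ measurable_fun setT f, exists M : R, forall x, `|f x| <= M &
      forall h, L.-integrable setT (EFin \o h) ->
        (forall x, 0 <= cos_transform h x) ->
        forall x, 0 <= cos_transform (fun xi => f xi * h xi) x].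

Lemma measurable_cos_dot d (T : measurableType d) (u v : T -> 'rV[R]_n) :
  measurable_fun setT u -> measurable_fun setT v ->
  measurable_fun setT (fun t => cos (dot (u t) (v t))).
Proof.
move=> mu mv; apply: (@measurableT_comp _ _ _ _ _ _ cos).
  by apply: continuous_measurable_fun; exact: continuous_cos.
exact: measurable_dot.
Qed.

Lemma integrable_bounded_mul f h (M : R) : measurable_fun setT f ->
  (forall x, `|f x| <= M) -> L.-integrable setT (EFin \o h) ->
  L.-integrable setT (EFin \o (fun x => f x * h x)).
Proof.
move=> mf fM ih; have mh : measurable_fun setT h.
  by apply/measurable_EFinP; exact: (measurable_int L).
apply: (integrable_le_dom _ _ (integrable_scale M _ (integrable_norm ih))) => //.
  exact: measurable_funM.
by move=> x _ /=; rewrite normrM ler_wpM2r.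
Qed.

Lemma integrable_cos_mul h x : L.-integrable setT (EFin \o h) ->
  L.-integrable setT (EFin \o (fun xi => cos (dot x xi) * h xi)).
Proof.
apply: integrable_bounded_mul; first exact: measurable_cos_dot.
by move=> xi; exact: normr_cos_le1.
Qed.

Lemma positive_multiplier_cst (c : R) : 0 <= c -> positive_multiplier (fun=> c).
Proof.
move=> c0; split => //; first by exists `|c|.
move=> h ih h0 x; rewrite /cos_transform.
under eq_Rintegral do rewrite mulrCA.
by rewrite RintegralZl//; [rewrite mulr_ge0//; exact: h0|exact: integrable_cos_mul].
Qed.

(** cos(x.xi) cos(y.xi) is the mean of cos((x+y).xi) and cos((x-y).xi), so the new transform
    averages two translates of the old one. *)
Lemma positive_multiplier_cos y : positive_multiplier (fun xi => cos (dot y xi)).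
Proof.
split; first exact: measurable_cos_dot.
  by exists 1 => x; exact: normr_cos_le1.
move=> h ih h0 x; rewrite /cos_transform.
have -> : (fun xi => cos (dot x xi) * (cos (dot y xi) * h xi)) =
  (fun xi => 2^-1 * (cos (dot (x + y) xi) * h xi) + 2^-1 * (cos (dot (x - y) xi) * h xi)).
  apply/funext => xi; rewrite !dotDl dotNl cosD cosB; by field.
rewrite RintegralD//; [|by apply: integrable_scale => //; exact: integrable_cos_mul..].
rewrite !RintegralZl//; [|exact: integrable_cos_mul..].
by rewrite addr_ge0// mulr_ge0// ?invr_ge0//; exact: h0.
Qed.

Lemma positive_multiplierM f g : positive_multiplier f -> positive_multiplier g ->
  positive_multiplier (fun x => f x * g x).
Proof.
move=> [mf [M fM] f0] [mg [N gN] g0]; split; first exact: measurable_funM.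
  by exists (M * N) => x; rewrite normrM ler_pM.
move=> h ih h0 x.
have := f0 _ (integrable_bounded_mul mg gN ih) (g0 _ ih h0) x.
by congr (0 <= cos_transform _ x); apply/funext => xi; rewrite mulrA.
Qed.

Lemma positive_multiplierD f g : positive_multiplier f -> positive_multiplier g ->
  positive_multiplier (fun x => f x + g x).
Proof.
move=> [mf [M fM] f0] [mg [N gN] g0]; split; first exact: measurable_funD.
  by exists (M + N) => x; rewrite (le_trans (ler_normD _ _))// lerD.
move=> h ih h0 x; rewrite /cos_transform.
have -> : (fun xi => cos (dot x xi) * ((f xi + g xi) * h xi)) =
  (fun xi => cos (dot x xi) * (f xi * h xi) + cos (dot x xi) * (g xi * h xi)).
  by apply/funext => xi; ring.
rewrite RintegralD//; [|apply: integrable_cos_mul; exact: integrable_bounded_mul ih..].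
by rewrite addr_ge0//; [exact: f0|exact: g0].
Qed.

Lemma positive_multiplierX f k : positive_multiplier f ->
  positive_multiplier (fun x => f x ^+ k).
Proof.
move=> pf; elim: k => [|k IH].
  by under eq_fun do rewrite expr0; exact: positive_multiplier_cst.
by under eq_fun do rewrite exprS; exact: positive_multiplierM.
Qed.

Lemma positive_multiplier_sum (F : nat -> 'rV[R]_n -> R) k :
  (forall i, positive_multiplier (F i)) ->
  positive_multiplier (fun x => \sum_(0 <= i < k) F i x).
Proof.
move=> pF; elim: k => [|k IH].
  by under eq_fun do rewrite big_nil; exact: positive_multiplier_cst.
by under eq_fun do rewrite big_nat_recr//=; exact: positive_multiplierD.
Qed.

(** Dominated convergence with bound M |h|: the transforms converge pointwise, and a limit of
    nonnegative numbers is nonnegative. *)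
Lemma positive_multiplier_lim (F : nat -> 'rV[R]_n -> R) f (M : R) :
  (forall k, positive_multiplier (F k)) -> (forall k x, `|F k x| <= M) ->
  (forall x, F ^~ x @ \oo --> f x) -> positive_multiplier f.
Proof.
move=> pF FM Ff.
have mf : measurable_fun setT f.
  apply: (@measurable_fun_cvg _ _ _ setT F) => [k|x _]; last exact: Ff.
  by case: (pF k).
split=> //.
  exists M => x; apply: (@cvgn_le_cst _ (fun k => `|F k x|)) => //.
  by apply: cvg_norm; exact: Ff.
move=> h ih h0 x.
have mh : measurable_fun setT h.
  by apply/measurable_EFinP; exact: (measurable_int L).
have [|||||_ cv] := @Rintegral_dct _ _ _ L setT
  (fun k xi => cos (dot x xi) * (F k xi * h xi))
  (fun xi => cos (dot x xi) * (f xi * h xi)) (fun xi => M * `|h xi|).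
- by [].
- move=> k; apply: measurable_funM; first exact: measurable_cos_dot.
  by apply: measurable_funM => //; case: (pF k).
- move=> xi _; apply: cvgM; first exact: cvg_cst.
  by apply: cvgM; [exact: Ff|exact: cvg_cst].
- by apply: integrable_scale => //; exact: integrable_norm.
- move=> k xi _; rewrite !normrM.
  rewrite (le_trans (_ : _ <= 1 * (`|F k xi| * `|h xi|)))//.
    by rewrite ler_wpM2r ?mulr_ge0// normr_cos_le1.
  by rewrite mul1r ler_wpM2r.
by apply: (cvgn_ge0 cv) => k; case: (pF k) => _ _; exact.
Qed.

(** The exponential series has nonnegative coefficients, so its partial sums are sums of products of
    multipliers; they are bounded by exp(M) uniformly. *)
Lemma positive_multiplier_exp f : positive_multiplier f ->
  positive_multiplier (fun x => expR (f x)).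
Proof.
move=> pf; have [mf [M fM] _] := pf.
apply: (@positive_multiplier_lim (fun k x => series (exp_coeff (f x)) k) _ (expR M)).
- move=> k; rewrite /series/=; apply: positive_multiplier_sum => i.
  rewrite /exp_coeff/=; under eq_fun do rewrite mulrC.
  apply: positive_multiplierM; last exact: positive_multiplierX.
  by apply: positive_multiplier_cst; rewrite invr_ge0.
- move=> k x; rewrite (le_trans (ler_norm_sum _ _ _))//.
  have M0 : 0 <= M by rewrite (le_trans _ (fM x)).
  apply: (@le_trans _ _ (series (exp_coeff M) k)).
    apply: ler_sum => i _; rewrite /exp_coeff/= normrM normrX.
    by rewrite [X in _ * X]ger0_norm ?invr_ge0// ler_wpM2r ?invr_ge0// lerXn2r ?nnegrE.
  apply: nondecreasing_cvgn_le; last exact: is_cvg_series_exp_coeff.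
  apply: nondecreasing_series => i _ _.
  by rewrite /exp_coeff/= mulr_ge0 ?invr_ge0 ?exprn_ge0.
- by move=> x; exact: is_cvg_series_exp_coeff.
Qed.

(** Fubini writes the transform of the mixture as the mixture, with weights [w t], of the transforms
    at fixed [t]. *)
Lemma positive_multiplier_mix d (T : measurableType d)
    (nu : {sigma_finite_measure set T -> \bar R}) (D : set T) (w : T -> R)
    (F : T -> 'rV[R]_n -> R) (B : R) : measurable D -> measurable_fun setT w ->
  nu.-integrable D (EFin \o w) -> (forall t, D t -> 0 <= w t) ->
  measurable_fun setT (fun z : 'rV[R]_n * T => F z.2 z.1) ->
  (forall t x, D t -> `|F t x| <= B) ->
  (forall t, D t -> positive_multiplier (F t)) ->
  positive_multiplier (fun x => \int[nu]_(t in D) (w t * F t x)).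
Proof.
move=> mD mw iw w0 mF FB pF.
have mwF : measurable_fun setT (fun z : 'rV[R]_n * T => w z.2 * F z.2 z.1).
  by apply: measurable_funM => //; exact: measurableT_comp mw measurable_snd.
have mFt x : measurable_fun setT (F ^~ x).
  exact: (measurableT_comp mF (pair1_measurable x)).
split.
- exact: (@measurable_Rintegral_param _ _ _ _ _ nu D (fun x t => w t * F t x)).
- exists (B * \int[nu]_(t in D) w t) => x.
  under eq_Rintegral do rewrite mulrC.
  by apply: Rintegral_le_cst => //; [exact: measurable_funTS|move=> t; exact: FB].
move=> h ih h0 x.
have mh : measurable_fun setT h.
  by apply/measurable_EFinP; exact: (measurable_int L).
have -> : cos_transform (fun xi => \int[nu]_(t in D) (w t * F t xi) * h xi) x =
    \int[L]_xi \int[nu]_(t in D) (cos (dot x xi) * (w t * F t xi * h xi)).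
  apply: eq_Rintegral => xi _.
  have iwF : nu.-integrable D (EFin \o (fun t => w t * F t xi)).
    apply: (integrable_le_dom _ _ (integrable_scale B _ iw)) => //.
      by apply: measurable_funM; exact: measurable_funTS.
    move=> t Dt; rewrite mulrC normrM (ger0_norm (w0 _ Dt)).
    by rewrite ler_wpM2r ?w0 ?FB.
  rewrite -RintegralZr// -RintegralZl//.
  under eq_fun do rewrite mulrC.
  exact: integrable_scale.
rewrite (@Rintegral_swap_dom _ _ _ _ _ L nu setT D
  (fun xi t => cos (dot x xi) * (w t * F t xi * h xi)) (fun xi => B * `|h xi|) w)//.
- apply: Rintegral_ge0 => t Dt.
  have [mFt' _ Ft0] := pF t Dt.
  have -> : (fun xi => cos (dot x xi) * (w t * F t xi * h xi)) =
    (fun xi => w t * (cos (dot x xi) * (F t xi * h xi))).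
    by apply/funext => xi; ring.
  rewrite RintegralZl//; first by rewrite mulr_ge0 ?w0//; exact: Ft0.
  apply: integrable_cos_mul; apply: integrable_bounded_mul ih => //.
  by move=> xi; exact: (FB _ _ Dt).
- apply: measurable_funTS; apply: measurable_funM.
    by apply: measurable_cos_dot => //; exact: measurable_fst.
  by apply: measurable_funM => //; exact: measurableT_comp mh measurable_fst.
- by apply: integrable_scale => //; exact: integrable_norm.
- move=> xi t _ Dt; rewrite !normrM (ger0_norm (w0 _ Dt)).
  have -> : B * `|h xi| * w t = 1 * (w t * B * `|h xi|) by ring.
  rewrite ler_pM ?mulr_ge0 ?w0 ?normr_cos_le1//.
  by rewrite ler_wpM2r// ler_wpM2l ?w0// FB.
Qed.

Lemma cvg_prod_laplace (xi : 'rV[R]_n) :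
  (fun k : nat => \prod_(i < n) laplace (k.+1%:R^-1 : R) (xi ord0 i)) @ \oo --> (1 : R).
Proof.
rewrite [X in _ --> X](_ : 1 = \prod_(i < n) 1); last by rewrite big1.
apply: (@cvg_big R _ *%R 1 xpredT _ nat _ _ (fun i k => laplace (k.+1%:R^-1 : R) (xi ord0 i))).
  exact: mul_continuous.
move=> i _; rewrite [X in _ --> X](_ : 1 = expR (- (0 * `|xi ord0 i|))); last first.
  by rewrite mul0r oppr0 expR0.
apply: continuous_cvg; first exact: continuous_expR.
apply: cvgN; apply: cvgM; last exact: cvg_cst.
exact: cvg_harmonic.
Qed.

(** The definition needs, next to [f], an integrable factor with nonnegative transform. The products
    of Laplace kernels of rate 1/(k+1) are such factors by [cos_laplace_rV]; they tend to 1, so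
    dominated convergence removes them. *)
Lemma positive_multiplier_transform f : positive_multiplier f ->
  L.-integrable setT (EFin \o f) -> forall x, 0 <= cos_transform f x.
Proof.
move=> [mf _ pf] intf x.
pose P (k : nat) (xi : 'rV[R]_n) : R := \prod_(i < n) laplace (k.+1%:R^-1 : R) (xi ord0 i).
have k0 k : 0 < k.+1%:R^-1 :> R by rewrite invr_gt0.
have P01 k xi : 0 <= P k xi <= 1.
  apply/andP; split; first by apply: prodr_ge0 => i _; exact: laplace_ge0.
  apply: (@le_trans _ _ (\prod_(i < n) 1)); last by rewrite big1.
  apply: ler_prod => i _; rewrite laplace_ge0/= /laplace -expR0 ler_expR oppr_le0.
  by rewrite mulr_ge0// ltW.
have iP k : L.-integrable setT (EFin \o P k).
  by have [] := @integrable_coord_prod R n _ (laplace_ge0 k.+1%:R^-1) (integrable_laplace (k0 k)).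
have mP k : measurable_fun setT (P k).
  by apply: measurable_coord_prod; exact: measurable_laplace.
have [|||||_ cv] := @Rintegral_dct _ _ _ L setT
  (fun k xi => cos (dot x xi) * (f xi * P k xi))
  (fun xi => cos (dot x xi) * f xi) (fun xi => `|f xi|).
- by [].
- move=> k; apply: measurable_funM; first exact: measurable_cos_dot.
  exact: measurable_funM.
- move=> xi _; apply: cvgM; first exact: cvg_cst.
  rewrite -[X in _ --> X]mulr1; apply: cvgM; first exact: cvg_cst.
  exact: cvg_prod_laplace.
- exact: integrable_norm.
- move=> k xi _; rewrite !normrM (ger0_norm (proj1 (andP (P01 k xi)))).
  rewrite -[leRHS]mul1r ler_pM ?mulr_ge0 ?normr_cos_le1//.
    by case/andP: (P01 k xi).
  by rewrite ler_piMr//; case/andP: (P01 k xi).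
apply: (cvgn_ge0 cv) => k; apply: pf => // y.
rewrite /cos_transform (proj1 (cos_laplace_rV y (k0 k))).
apply: prodr_ge0 => i _; rewrite divr_ge0 ?mulr_ge0 ?(ltW (k0 k))//.
by rewrite addr_ge0 ?sqr_ge0.
Qed.

End positive_multipliers.

Section integral_positivity.
Context d (T : measurableType d) (R : realType).
Variable mu : {measure set T -> \bar R}.

Lemma Rintegral_gt0 (D E : set T) (f : T -> R) :
  measurable D -> measurable E -> E `<=` D -> mu.-integrable D (EFin \o f) ->
  (forall x, D x -> 0 <= f x) -> (forall x, E x -> 0 < f x) ->
  (0 < mu E)%E -> 0 < \int[mu]_(x in D) f x.
Proof.
move=> mD mE ED intf f0 fE muE.
have mf : measurable_fun D (EFin \o f) by exact: (measurable_int mu).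
rewrite lt_neqAle Rintegral_ge0// andbT; apply/negP => /eqP I0.
have /(ae_eq_integral_abs mu mD mf) [N [mN N0 subN]] :
    (\int[mu]_(x in D) `|(EFin \o f) x| = 0)%E.
  transitivity (\int[mu]_(x in D) f x)%:E; last by rewrite -I0.
  rewrite Rintegral_EFin//; apply: eq_integral => x /set_mem Dx /=.
  by rewrite ger0_norm ?f0.
have EN : E `<=` N.
  apply: subset_trans subN => x Ex /= /(_ (ED _ Ex)) /= [] fx0.
  by have := fE _ Ex; rewrite fx0 ltxx.
by move: muE; rewrite (subset_measure0 mE mN EN N0) ltxx.
Qed.

End integral_positivity.

Lemma lebesgue_measure_oo_gt0 (R : realType) (a b : R) : a < b ->
  (0 < @lebesgue_measure R `]a, b[)%E.
Proof. by move=> ab; rewrite lebesgue_measure_itv/= lte_fin ab lte_fin subr_gt0. Qed.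

(** * Levy representation of |u|^beta and its truncation *)

Section levy_constant.
Context {R : realType}.
Local Notation leb := (@lebesgue_measure R).

Lemma normr_sin_le (x : R) : `|sin x| <= `|x|.
Proof.
wlog x0 : x / 0 <= x.
  move=> h; have [/h//|/ltW x0] := leP 0 x.
  by rewrite -normrN -sinN -(normrN x); apply: h; rewrite oppr_ge0.
have cs : {within `[0, x], continuous (@sin R)}.
  by apply: continuous_subspaceT => y; exact: continuous_sin.
have [c _] := MVT_segment x0 (fun y _ => is_derive_sin y) cs.
by rewrite sin0 !subr0 => ->; rewrite normrM ler_piMl ?normr_cos_le1.
Qed.

Lemma onem_cosE (x : R) : 1 - cos x = 2 * sin (x / 2) ^+ 2.
Proof.
by rewrite {1}(_ : x = (x / 2) *+ 2) ?cos_mulr2n ?cos2sin2; [ring|rewrite mulr2n -splitr].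
Qed.

Lemma onem_cos_ge0 (x : R) : 0 <= 1 - cos x.
Proof. by rewrite subr_ge0 cos_le1. Qed.

Lemma onem_cos_le2 (x : R) : 1 - cos x <= 2.
Proof. by rewrite lerBlDl -lerBlDr (_ : 1 - 2 = -1) ?cos_geN1//; ring. Qed.

Lemma onem_cos_le_sqr (x : R) : 1 - cos x <= x ^+ 2.
Proof.
rewrite onem_cosE -real_normK ?num_real//.
have h : `|sin (x / 2)| <= `|x / 2| by exact: normr_sin_le.
rewrite (le_trans (_ : _ <= 2 * `|x / 2| ^+ 2))//.
  by rewrite ler_wpM2l// lerXn2r ?nnegrE.
rewrite real_normK ?num_real// expr_div_n.
by have := sqr_ge0 x; lra.
Qed.

Variable beta : R.
Hypothesis beta02 : 0 < beta < 2.

Let b0 : 0 < beta. Proof. by case/andP: beta02. Qed.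
Let b2 : beta < 2. Proof. by case/andP: beta02. Qed.

(** The reciprocal of the constant in front of the integral representation of |u|^beta; its explicit
    value is never computed. *)
Definition levy_const : R := \int[leb]_(r in `]0, +oo[) ((1 - cos r) * r `^ (- 1 - beta)).

Lemma measurable_onem_cosM (u : R) : measurable_fun setT (fun r : R => 1 - cos (r * u)).
Proof.
by apply: measurable_funB => //; under eq_fun do rewrite mulrC; exact: measurable_cosM.
Qed.

(** Near 0, 1 - cos r <= r^2 leaves r^(1-beta), integrable since beta < 2; at infinity, 1 - cos r <=
    2 leaves r^(-1-beta), integrable since beta > 0. *)
Lemma integrable_levy : leb.-integrable `]0, +oo[
  (EFin \o (fun r => (1 - cos r) * r `^ (- 1 - beta))).
Proof.
apply: (@integrable_powR_mix _ (beta - 1) (beta + 1) 2).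
- by move: b0 b2 => h1 h2; lra.
- by move: b0 b2 => h1 h2; lra.
- apply: measurable_funTS; apply: measurable_funM; last exact: measurable_powR.
  by have := measurable_onem_cosM 1; under eq_fun do rewrite mulr1.
- move=> x x0 x1; rewrite ger0_norm ?mulr_ge0 ?powR_ge0 ?onem_cos_ge0//.
  rewrite (le_trans (_ : _ <= x `^ 2 * x `^ (- 1 - beta)))//.
    by rewrite ler_wpM2r ?powR_ge0// powR_mulrn ?(ltW x0)// onem_cos_le_sqr.
  rewrite -powRD; last by rewrite (gt_eqF x0) implybT.
  rewrite (_ : 2 + (-1 - beta) = - (beta - 1)); last by ring.
  by rewrite ler_peMl ?powR_ge0// ler1n.
- move=> x x1; rewrite ger0_norm ?mulr_ge0 ?powR_ge0 ?onem_cos_ge0//.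
  rewrite (_ : -1 - beta = - (beta + 1)); last by ring.
  by rewrite ler_wpM2r ?powR_ge0 ?onem_cos_le2.
Qed.

Lemma levy_const_gt0 : 0 < levy_const.
Proof.
apply: (@Rintegral_gt0 _ _ _ _ _ (`]0, 1[%classic : set (measurableTypeR R))) => //.
- by move=> x /=; rewrite !in_itv/= => /andP[->].
- exact: integrable_levy.
- by move=> x _; rewrite mulr_ge0 ?powR_ge0 ?onem_cos_ge0.
- move=> x /=; rewrite in_itv/= => /andP[x0 x1].
  rewrite mulr_gt0 ?powR_gt0// onem_cosE mulr_gt0// exprn_gt0// sin2_gt0//.
  by rewrite divr_gt0//=; lra.
- exact: lebesgue_measure_oo_gt0.
Qed.

(** Dilation by |u|: the weight contributes |u|^(1+beta) and the measure |u|^(-1). The case u = 0 is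
    separate because a dilation needs a nonzero factor. *)
Lemma integrable_levyM (u : R) : leb.-integrable `]0, +oo[
    (EFin \o (fun r => (1 - cos (r * u)) * r `^ (- 1 - beta))) /\
  \int[leb]_(r in `]0, +oo[) ((1 - cos (r * u)) * r `^ (- 1 - beta)) =
    levy_const * `|u| `^ beta.
Proof.
have [->|u0] := eqVneq u 0.
  have -> : (fun r : R => (1 - cos (r * 0)) * r `^ (- 1 - beta)) = cst 0.
    by apply/funext => r; rewrite mulr0 cos0 subrr mul0r.
  split; first exact: integrable0.
  by rewrite Rintegral_cst// mul0r normr0 powR0 ?mulr0// gt_eqF.
have u1 : 0 < `|u| by rewrite normr_gt0.
have [i1 i2] := Rintegral_scale0y u1 integrable_levy.
have E r : 0 < r -> (1 - cos (r * u)) * r `^ (- 1 - beta) = `|u| `^ (1 + beta) *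
    ((1 - cos (`|u| * r)) * (`|u| * r) `^ (- 1 - beta)).
  move=> r0; rewrite powRM ?(ltW r0)//.
  have -> : cos (r * u) = cos (`|u| * r).
    by rewrite -cos_norm normrM (gtr0_norm r0) mulrC.
  have -> : `|u| `^ (-1 - beta) = (`|u| `^ (1 + beta))^-1 by rewrite -powRN opprD.
  by rewrite mulrCA mulVKf// gt_eqF// powR_gt0.
have mI : measurable (`]0, +oo[%classic : set (measurableTypeR R)) by exact: measurable_itv.
split.
  have := integrable_scale (`|u| `^ (1 + beta)) mI i1.
  apply: eq_integrable => // r; rewrite inE/= in_itv/= andbT => r0.
  by rewrite E.
transitivity (\int[leb]_(r in `]0, +oo[) (`|u| `^ (1 + beta) *
    ((1 - cos (`|u| * r)) * (`|u| * r) `^ (- 1 - beta)))).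
  by apply: eq_Rintegral => r; rewrite inE/= in_itv/= andbT => r0; rewrite E.
have E2 : `|u| `^ (1 + beta) * `|u|^-1 = `|u| `^ beta.
  rewrite -powR_inv1 ?(ltW u1)// -powRD; last by rewrite (gt_eqF u1) implybT.
  by congr (_ `^ _); ring.
rewrite (RintegralZl _ mI i1) i2 mulrA E2.
exact: mulrC.
Qed.

(* The Levy measure [r^(-1-beta) dr] restricted to jumps of size at least
   [1/(k+1)], which is finite. *)
Definition trunc_weight (k : nat) (r : R) : R :=
  r `^ (- 1 - beta) * \1_(`[k.+1%:R^-1, +oo[ : set R) r.

Lemma trunc_weight_ge0 k r : 0 <= trunc_weight k r.
Proof. by rewrite mulr_ge0 ?powR_ge0. Qed.

Lemma measurable_trunc_weight k : measurable_fun setT (trunc_weight k).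
Proof. by apply: measurable_funM => //; exact: measurable_powR. Qed.

Lemma integrable_trunc_weight k :
  leb.-integrable `]0, +oo[ (EFin \o trunc_weight k).
Proof.
apply: (@integrable_powR_mix _ 0 (beta + 1) (k.+1%:R `^ (beta + 1))).
- by [].
- by move: b0 b2 => h1 h2; lra.
- by apply: measurable_funTS; exact: measurable_trunc_weight.
- move=> x x0 x1; rewrite ger0_norm ?trunc_weight_ge0// oppr0 powRr0 mulr1.
  rewrite /trunc_weight indicE mem_setE in_itv/= andbT.
  case: (boolP (k.+1%:R^-1 <= x)) => kx /=; last by rewrite mulr0 powR_ge0.
  rewrite mulr1 (_ : -1 - beta = - (beta + 1)); last by ring.
  rewrite powRN -[leRHS]invrK lef_pV2 ?posrE ?invr_gt0 ?powR_gt0//.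
  have -> : (k.+1%:R `^ (beta + 1))^-1 = k.+1%:R^-1 `^ (beta + 1) :> R.
    by rewrite -powR_inv1 ?powR_ge0// -powRrM mulrC powRrM powR_inv1.
  by rewrite ge0_ler_powR ?nnegrE ?invr_ge0 ?(ltW x0)// addr_ge0// ltW.
- move=> x x1; rewrite ger0_norm ?trunc_weight_ge0//.
  rewrite (_ : - (beta + 1) = -1 - beta); last by ring.
  rewrite /trunc_weight mulrC ler_wpM2r ?powR_ge0//.
  apply: (@le_trans _ _ 1); first by rewrite indicE; case: (_ \in _).
  by rewrite -[leLHS](powRr0 k.+1%:R) ler_powR ?ler1n// addr_ge0// ltW.
Qed.

Lemma trunc_term_ge0 k r u : 0 <= trunc_weight k r * (1 - cos (r * u)).
Proof. by apply: mulr_ge0; [exact: trunc_weight_ge0|exact: onem_cos_ge0]. Qed.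

Definition trunc_symbol (k : nat) (u : R) : R :=
  \int[leb]_(r in `]0, +oo[) (trunc_weight k r * (1 - cos (r * u))).

Lemma integrable_trunc k u : leb.-integrable `]0, +oo[
  (EFin \o (fun r => trunc_weight k r * (1 - cos (r * u)))).
Proof.
apply: (integrable_le_dom _ _ (integrable_scale 2 _ (integrable_trunc_weight k))) => //.
  apply: measurable_funTS; apply: measurable_funM; first exact: measurable_trunc_weight.
  exact: measurable_onem_cosM.
move=> r _; rewrite (ger0_norm (trunc_term_ge0 _ _ _)).
by rewrite mulrC ler_wpM2r ?trunc_weight_ge0 ?onem_cos_le2.
Qed.

Lemma trunc_symbol_ge0 k u : 0 <= trunc_symbol k u.
Proof.
by apply: Rintegral_ge0 => r _; exact: trunc_term_ge0.
Qed.

Lemma trunc_symbol_le k u : trunc_symbol k u <= levy_const * `|u| `^ beta.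
Proof.
have [iu <-] := integrable_levyM u.
apply: le_Rintegral => //; first exact: integrable_trunc.
move=> r _; rewrite mulrC ler_wpM2l ?onem_cos_ge0// /trunc_weight.
by rewrite ler_piMr ?powR_ge0// indicE; case: (_ \in _).
Qed.

Lemma trunc_symbol_cvg u :
  trunc_symbol ^~ u @ \oo --> levy_const * `|u| `^ beta.
Proof.
have [iu <-] := integrable_levyM u.
have [|||||_ cv] := @Rintegral_dct _ _ _ leb `]0, +oo[
  (fun k r => trunc_weight k r * (1 - cos (r * u)))
  (fun r => (1 - cos (r * u)) * r `^ (- 1 - beta))
  (fun r => (1 - cos (r * u)) * r `^ (- 1 - beta)).
- exact: measurable_itv.
- move=> k; apply: measurable_funTS.
  by apply: measurable_funM; [exact: measurable_trunc_weight|exact: measurable_onem_cosM].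
- move=> r /=; rewrite in_itv/= andbT => r0.
  apply: cvg_near_cst; have [m mr] := ltr_add_invr r0.
  near=> k; rewrite /trunc_weight indicE mem_set ?mulr1 1?mulrC//=.
  rewrite in_itv/= andbT (le_trans _ (ltW mr))// add0r lef_pV2 ?posrE//.
  by rewrite ler_nat ltnS; near: k; exact: nbhs_infty_ge.
- exact: iu.
- move=> k r _; rewrite (ger0_norm (trunc_term_ge0 _ _ _)).
  rewrite mulrC ler_wpM2l ?onem_cos_ge0// /trunc_weight.
  by rewrite ler_piMr ?powR_ge0// indicE; case: (_ \in _).
exact: cv.
Unshelve. all: by end_near. Qed.

Definition trunc_cos (k : nat) (u : R) : R :=
  \int[leb]_(r in `]0, +oo[) (trunc_weight k r * cos (r * u)).

Definition trunc_mass (k : nat) : R :=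
  \int[leb]_(r in `]0, +oo[) trunc_weight k r.

(** Possible only after truncation, since the full weight r^(-1-beta) has infinite mass. The minus
    sign in front of the cosine part becomes a plus sign in the exponential of minus the symbol,
    which is what makes that exponential a positive multiplier. *)
Lemma trunc_symbolE k u : trunc_symbol k u = trunc_mass k - trunc_cos k u.
Proof.
rewrite /trunc_symbol; under eq_Rintegral do rewrite mulrBr mulr1.
rewrite RintegralB//; first exact: integrable_trunc_weight.
apply: (integrable_le_dom _ _ (integrable_trunc_weight k)) => //.
  apply: measurable_funTS; apply: measurable_funM; first exact: measurable_trunc_weight.
  by under eq_fun do rewrite mulrC; exact: measurable_cosM.
by move=> r _; rewrite mulrC normrM_le1 ?trunc_weight_ge0 ?normr_cos_le1.
Qed.

Lemma measurable_trunc_cos k : measurable_fun setT (trunc_cos k).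
Proof.
apply: (@measurable_Rintegral_param _ _ _ _ _ leb _
  (fun u r => trunc_weight k r * cos (r * u))) => //.
apply: measurable_funM.
  exact: measurableT_comp (measurable_trunc_weight k) measurable_snd.
apply: measurableT_comp; first by apply: continuous_measurable_fun; exact: continuous_cos.
by apply: measurable_funM; [exact: measurable_snd|exact: measurable_fst].
Qed.

Lemma trunc_cos_bound k u : `|trunc_cos k u| <= trunc_mass k.
Proof.
rewrite /trunc_cos; under eq_Rintegral do rewrite mulrC.
rewrite -[leRHS]mul1r; apply: Rintegral_le_cst => //.
- apply: measurable_funTS.
  by under eq_fun do rewrite mulrC; exact: measurable_cosM.
- exact: integrable_trunc_weight.
- by move=> r _; exact: normr_cos_le1.
- by move=> r _; exact: trunc_weight_ge0.
Qed.

Lemma positive_multiplier_trunc_cos n k (eta : 'rV[R]_n) :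
  positive_multiplier (fun xi => trunc_cos k (dot xi eta)).
Proof.
apply: (@positive_multiplier_mix _ _ _ _ leb _ _
  (fun r xi => cos (r * dot xi eta)) 1) => //.
- exact: measurable_trunc_weight.
- exact: integrable_trunc_weight.
- by move=> r _; exact: trunc_weight_ge0.
- apply: measurableT_comp; first by apply: continuous_measurable_fun; exact: continuous_cos.
  apply: measurable_funM; first exact: measurable_snd.
  by apply: measurable_dot => //; exact: measurable_fst.
- by move=> r xi _; exact: normr_cos_le1.
- move=> r _; have := positive_multiplier_cos (r *: eta).
  by under eq_fun do rewrite dotZl dotC.
Qed.

End levy_constant.

(** * The symbol *)

Section euclidean_norm.
Context {R : realType} {d : nat}.
Implicit Types x y : 'rV[R]_d.

Lemma enorm_ge0 x : 0 <= enorm x.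
Proof. exact: sqrtr_ge0. Qed.

Lemma enormZ c x : enorm (c *: x) = `|c| * enorm x.
Proof.
by rewrite /enorm dotZl dotZr mulrA -expr2 sqrtrM ?sqr_ge0// sqrtr_sqr.
Qed.

Lemma coord_le_enorm x i : `|x ord0 i| <= enorm x.
Proof.
rewrite -sqrtr_sqr ler_wsqrtr// /dot (bigD1 i)//= -expr2 lerDl.
by apply: sumr_ge0 => j _; rewrite -expr2 sqr_ge0.
Qed.

Lemma enorm_gt0 x : x != 0 -> 0 < enorm x.
Proof.
move=> x0; rewrite lt_neqAle enorm_ge0 andbT eq_sym; apply: contra x0 => /eqP e0.
apply/eqP/rowP => i; rewrite mxE; apply/eqP; rewrite -normr_eq0.
by rewrite -normr_le0 normr_id -e0 coord_le_enorm.
Qed.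

Lemma sphere_normalize x : x != 0 -> sphere (normalize x).
Proof.
move=> x0; rewrite /sphere/= /normalize enormZ.
by rewrite gtr0_norm ?invr_gt0 ?enorm_gt0// mulVf// gt_eqF// enorm_gt0.
Qed.

Lemma continuous_enorm : continuous (@enorm R d).
Proof.
move=> x; apply: continuous_comp; last exact: sqrt_continuous.
apply: (@cvg_big R _ +%R 0 xpredT _ _ (nbhs x) _ (fun i y => y ord0 i * y ord0 i)).
  exact: add_continuous.
by move=> i _; apply: cvgM; exact: coord_continuous.
Qed.

Lemma measurable_sphere : measurable (@sphere R d).
Proof.
rewrite (_ : sphere = enorm @^-1` [set 1]); last by [].
by rewrite -[X in measurable X]setTI; exact: measurable_enorm.
Qed.

Lemma compact_sphere : compact (@sphere R d).
Proof.
pose B := [set v : 'rV[R]_d | forall i, v ord0 i \in `[(-1), 1]].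
have cB : compact B.
  rewrite /B; apply: (@rV_compact R d (fun=> `[(-1), 1]%classic)) => _.
  exact: segment_compact.
apply: (subclosed_compact _ cB).
  rewrite (_ : sphere = enorm @^-1` [set 1]); last by [].
  by apply: preimage_closed => [x _|]; [exact: continuous_enorm|exact: closed_eq].
move=> x /= x1 i; rewrite in_itv/= -ler_norml -x1.
exact: coord_le_enorm.
Qed.

End euclidean_norm.

Section symbol.
Context {R : realType} {d : nat}.
Variables (beta : R) (mu : {finite_measure set 'rV[R]_d -> \bar R}).
Hypothesis beta02 : 0 < beta < 2.
Local Notation L := (@lebesgue_rV R d).
Local Notation psi := (psi mu beta).

Let b0 : 0 < beta. Proof. by case/andP: beta02. Qed.

Let mS : measurable (@sphere R d). Proof. exact: measurable_sphere. Qed.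

Lemma measurable_dot_powR (xi : 'rV[R]_d) (D : set 'rV[R]_d) :
  measurable_fun D (fun eta => `|dot xi eta| `^ beta).
Proof.
apply: measurable_funTS; apply: (measurableT_comp (measurable_powR beta)).
by apply: measurableT_comp => //; exact: measurable_dot.
Qed.

Lemma dot_sphere_le (xi eta : 'rV[R]_d) : sphere eta ->
  `|dot xi eta| <= \sum_i `|xi ord0 i|.
Proof.
move=> s1; rewrite (le_trans (ler_norm_sum _ _ _))//; apply: ler_sum => i _.
by rewrite normrM ler_piMr// -s1 coord_le_enorm.
Qed.

Lemma integrable_finite_bounded (f : 'rV[R]_d -> R) (M : R) (D : set 'rV[R]_d) :
  measurable D -> measurable_fun D f -> (forall x, D x -> `|f x| <= M) ->
  mu.-integrable D (EFin \o f).
Proof.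
move=> mD mf fM; apply: (@integrable_le_dom _ _ _ _ _ _ (cst M)) => //.
exact: finite_measure_integrable_cst.
Qed.

Lemma dot_powR_le (xi eta : 'rV[R]_d) : sphere eta ->
  `|dot xi eta| `^ beta <= (\sum_i `|xi ord0 i|) `^ beta.
Proof.
move=> s1; rewrite ge0_ler_powR ?(ltW b0) ?nnegrE ?dot_sphere_le//.
exact: sumr_ge0.
Qed.

Lemma integrable_dot_powR (xi : 'rV[R]_d) :
  mu.-integrable sphere (EFin \o (fun eta => `|dot xi eta| `^ beta)).
Proof.
apply: (@integrable_finite_bounded _ ((\sum_i `|xi ord0 i|) `^ beta)) => //.
  exact: measurable_dot_powR.
by move=> eta s1; rewrite ger0_norm ?powR_ge0 ?dot_powR_le.
Qed.

(** The powers of [enorm xi] cancel by homogeneity, and at the origin both sides vanish since beta >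
    0. In this form the definition by cases is never met again, except in [psi_lower_bound]. *)
Lemma psiE (xi : 'rV[R]_d) :
  psi xi = \int[mu]_(eta in sphere) (`|dot xi eta| `^ beta).
Proof.
rewrite /Defs.psi; case: eqVneq => [->|x0].
  rewrite (@eq_Rintegral _ _ _ _ _ (cst 0)) ?Rintegral_cst ?mul0r// => eta _.
  by rewrite dotC dot0r normr0 powR0// gt_eqF.
have e0 := enorm_gt0 x0.
rewrite /omega -RintegralZl//; last exact: integrable_dot_powR.
apply: eq_Rintegral => eta _; rewrite /normalize dotZl normrM.
rewrite powRM// ger0_norm ?invr_ge0 ?(ltW e0)// mulrA -powRM ?invr_ge0 ?(ltW e0)//.
by rewrite mulfV ?gt_eqF// powR1 mul1r.
Qed.

Lemma psi_ge0 (xi : 'rV[R]_d) : 0 <= psi xi.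
Proof. by rewrite psiE; apply: Rintegral_ge0 => eta _; exact: powR_ge0. Qed.

Lemma measurable_psi : measurable_fun setT psi.
Proof.
rewrite (_ : psi = fun xi => \int[mu]_(eta in sphere) (`|dot xi eta| `^ beta)).
  apply: (@measurable_Rintegral_param _ _ _ _ _ mu sphere
    (fun xi eta => `|dot xi eta| `^ beta)) => //.
  apply: (measurableT_comp (measurable_powR beta)).
  by apply: measurableT_comp => //; apply: measurable_dot.
by apply/funext => xi; exact: psiE.
Qed.

Lemma psiZ (c : R) (xi : 'rV[R]_d) : psi (c *: xi) = `|c| `^ beta * psi xi.
Proof.
rewrite !psiE -RintegralZl//; last exact: integrable_dot_powR.
by apply: eq_Rintegral => eta _; rewrite dotZl normrM powRM.
Qed.

Lemma psiN (xi : 'rV[R]_d) : psi (- xi) = psi xi.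
Proof. by rewrite !psiE; apply: eq_Rintegral => eta _; rewrite dotNl normrN. Qed.

(** With the Levy integral truncated, the exponential factors into a positive constant and the
    exponential of a mixture of cosines, over jump sizes and over directions on the sphere. These
    functions are bounded by 1 and converge to exp(-t psi). *)
Lemma positive_multiplier_expN_psi (t : R) : 0 <= t ->
  positive_multiplier (fun xi => expR (- (t * psi xi))).
Proof.
move=> t0; have c0 := levy_const_gt0 beta02.
pose c := levy_const beta.
pose f k (xi : 'rV[R]_d) := expR (- (t / c * \int[mu]_(eta in sphere) trunc_symbol beta k (dot xi eta))).
have mtc k : measurable_fun setT (trunc_cos beta k) by exact: measurable_trunc_cos.
have its k xi : mu.-integrable sphere (EFin \o (fun eta => trunc_cos beta k (dot xi eta))).
  apply: (@integrable_finite_bounded _ (trunc_mass beta k)) => //.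
    by apply: measurable_funTS; apply: measurableT_comp => //; exact: measurable_dot.
  by move=> eta _; exact: trunc_cos_bound.
apply: (@positive_multiplier_lim _ _ f _ 1).
- move=> k; pose m := fine (mu sphere).
  have -> : f k = (fun xi => expR (- (t / c * (trunc_mass beta k * m))) *
      expR (t / c * \int[mu]_(eta in sphere) (1 * trunc_cos beta k (dot xi eta)))).
    apply/funext => xi; rewrite /f -expRD; congr expR.
    have -> : \int[mu]_(eta in sphere) trunc_symbol beta k (dot xi eta) =
        trunc_mass beta k * m - \int[mu]_(eta in sphere) (1 * trunc_cos beta k (dot xi eta)).
      under eq_Rintegral do rewrite trunc_symbolE//.
      rewrite RintegralB ?Rintegral_cst//; last exact: finite_measure_integrable_cst.
      by congr (_ - _); apply: eq_Rintegral => eta _; rewrite mul1r.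
    by ring.
  apply: positive_multiplierM; first by apply: positive_multiplier_cst; exact: expR_ge0.
  apply: positive_multiplier_exp; apply: positive_multiplierM.
    by apply: positive_multiplier_cst; rewrite divr_ge0// ltW.
  apply: (@positive_multiplier_mix _ _ _ _ mu sphere (cst 1)
    (fun eta xi => trunc_cos beta k (dot xi eta)) (trunc_mass beta k)) => //.
  + exact: finite_measure_integrable_cst.
  + apply: measurableT_comp => //; apply: measurable_dot.
      exact: measurable_fst.
    exact: measurable_snd.
  + by move=> eta xi _; exact: trunc_cos_bound.
  + by move=> eta _; exact: positive_multiplier_trunc_cos.
- move=> k xi; rewrite ger0_norm ?expR_ge0// -expR0 ler_expR oppr_le0.
  rewrite mulr_ge0// ?divr_ge0// ?(ltW c0)//.
  by apply: Rintegral_ge0 => eta _; exact: trunc_symbol_ge0.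
- move=> xi; apply: continuous_cvg; first exact: continuous_expR.
  apply: cvgN.
  rewrite [X in _ --> X](_ : _ = t / c * (c * psi xi)); last first.
    by rewrite mulrA divfK// gt_eqF.
  apply: cvgM; first exact: cvg_cst.
  rewrite psiE -RintegralZl//; last exact: integrable_dot_powR.
  (* Domination by a constant: trunc_symbol(u) <= c |u|^beta, and |xi.eta| is at most the sum of the
     |xi_i| for unit eta. *)
  have [|||||_ cv] := @Rintegral_dct _ _ _ mu sphere
    (fun k eta => trunc_symbol beta k (dot xi eta))
    (fun eta => c * `|dot xi eta| `^ beta)
    (cst (c * (\sum_i `|xi ord0 i|) `^ beta)); last exact: cv.
  + by [].
  + move=> k; apply: measurable_funTS.
    under eq_fun do rewrite trunc_symbolE//.
    by apply: measurable_funB => //; apply: measurableT_comp => //; exact: measurable_dot.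
  + by move=> eta _; exact: trunc_symbol_cvg.
  + exact: finite_measure_integrable_cst.
  + move=> k eta s1; rewrite ger0_norm ?trunc_symbol_ge0//.
    rewrite (le_trans (trunc_symbol_le _ _ _))//.
    by rewrite ler_wpM2l ?(ltW c0)// dot_powR_le.
Qed.

(** By homogeneity it is enough to bound [omega] from below on the sphere, where a continuous
    positive function attains a positive minimum by compactness. Continuity is read off the local
    C^k extensions. *)
Lemma psi_lower_bound k : (forall theta, sphere theta -> 0 < omega mu beta theta) ->
  Ck_sphere k (omega mu beta) ->
  exists2 c, 0 < c & forall xi, c * enorm xi `^ beta <= psi xi.
Proof.
move=> om0 smooth.
have comega : {within sphere, continuous (omega mu beta)}.
  apply/subspace_continuousP => x Sx.
  have [U [F [oU Ux CkF FE]]] := smooth x Sx.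
  have cF : {for x, continuous F}.
    by case: k CkF {smooth} => [|k] [] h _; exact: h.
  change (omega mu beta @ within sphere (nbhs x) --> omega mu beta x).
  rewrite -(FE x Ux Sx).
  apply: (@cvg_trans _ (F @ within sphere (nbhs x))).
    apply: near_eq_cvg; rewrite near_withinE.
    have : nbhs x U by exact: open_nbhs_nbhs.
    by apply: filterS => y Uy Sy; rewrite FE.
  exact: cvg_within_filter.
(* If the sphere is empty, 0 is the only vector and any constant works. *)
have [[x0 Sx0]|nS] := pselect (@sphere R d !=set0); last first.
  exists 1 => // xi; have [->|x0] := eqVneq xi 0.
    by rewrite -(scale0r 0) enormZ normr0 mul0r powR0 ?mulr0 ?psi_ge0// gt_eqF.
  by case: nS; exists (normalize xi); exact: sphere_normalize.
have [|c /set_mem Sc cmin] := @compact_EVT_min _ _ (omega mu beta) sphere _ compact_sphere comega.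
  by exists x0.
exists (omega mu beta c); first exact: om0.
move=> xi; rewrite /Defs.psi; case: eqVneq => [->|xi0].
  by rewrite -(scale0r 0) enormZ normr0 mul0r powR0 ?mulr0// gt_eqF.
rewrite mulrC; apply: ler_wpM2l; first exact: powR_ge0.
by apply: cmin; rewrite inE; exact: sphere_normalize.
Qed.

End symbol.

(** * The Green function of the stable operator *)

Lemma eq_oppr_eq0 (R : realType) (a b : R) : b = a -> b = -1 * a -> a = 0.
Proof. by move=> -> h; lra. Qed.

Section even_integrals.
Context {R : realType}.
Local Notation leb := (@lebesgue_measure R).

Lemma integrable_even (f : R -> R) : measurable_fun setT f ->
  (forall x, f (- x) = f x) -> leb.-integrable `]0, +oo[ (EFin \o f) ->
  leb.-integrable setT (EFin \o f).
Proof.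
move=> mf fN intf.
have mI : measurable (`]0, +oo[%classic : set (measurableTypeR R)) by exact: measurable_itv.
have i1 : leb.-integrable setT (EFin \o (f \_ `]0, +oo[)).
  by rewrite -restrict_EFin; apply/(integrable_mkcond _ mI).
have n1 : (-1 : R) != 0 by rewrite oppr_eq0 oner_eq0.
have [i2 _] := Rintegral_scale n1 i1.
have m0 : measurable ([set 0] : set (measurableTypeR R)) by exact: measurable_set1.
have i3 : leb.-integrable setT (EFin \o (f \_ [set 0])).
  rewrite -restrict_EFin; apply/(integrable_mkcond _ m0).
  apply/integrableP; split; first by apply/measurable_EFinP; exact: measurable_funTS.
  by rewrite integral_set1.
(* The last summand covers the origin, which neither open half-line contains. *)
apply: (@integrable_le_dom _ _ _ leb setT f (fun x => `|(f \_ `]0, +oo[) x| +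
    (`|(f \_ `]0, +oo[) (-1 * x)| + `|(f \_ [set 0]) x|))) => // [|x _].
  apply: (integrable_add measurableT (integrable_norm i1)).
  exact: (integrable_add measurableT (integrable_norm i2) (integrable_norm i3)).
have [x0|x0|x0] := ltrgt0P x.
- by rewrite {1}/patch mem_setE in_itv/= x0/= lerDl addr_ge0.
- by rewrite addrCA {1}/patch mem_setE in_itv/= mulN1r oppr_gt0 x0/= fN lerDl addr_ge0.
- by rewrite addrA [f \_ [set 0]]/patch mem_set/= ?lerDr ?addr_ge0.
Qed.

Lemma integrable_expN_powR (a beta : R) : 0 < a -> 0 < beta ->
  leb.-integrable setT (EFin \o (fun u => expR (- (a * `|u| `^ beta)))).
Proof.
move=> a0 b0.
have mf : measurable_fun setT (fun u : R => expR (- (a * `|u| `^ beta))).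
  apply: measurableT_comp => //; apply: measurableT_comp => //.
  apply: measurable_funM => //.
  exact: (measurableT_comp (measurable_powR beta) (@normr_measurable R setT)).
apply: (integrable_even mf) => [x|]; first by rewrite normrN.
(* A single term of the exponential series gives exp(-y) <= (m+1)!/y^(m+1); with beta (m+1) >= 2
   this decays at least like x^(-2) at y = a x^beta. *)
have [m mb] : exists m : nat, 2 <= beta * m.+1%:R.
  exists (Num.bound (2 / beta)); rewrite -ler_pdivrMl// mulrC.
  have h0 : 0 <= 2 / beta by rewrite divr_ge0// ltW.
  by rewrite (le_trans (ltW (archi_boundP h0)))// ler_nat.
pose C : R := (m.+1)`!%:R / a ^+ m.+1.
have C0 : 0 < C by rewrite divr_gt0 ?exprn_gt0// ltr0n fact_gt0.
apply: (@integrable_powR_mix _ 0 2 (1 + C)) => //.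
- by rewrite ltr1n.
- exact: measurable_funTS.
- move=> x x0 x1; rewrite oppr0 powRr0 mulr1 ger0_norm ?expR_ge0//.
  rewrite (@le_trans _ _ 1)//; last by rewrite lerDl ltW.
  by rewrite -expR0 ler_expR oppr_le0 mulr_ge0 ?powR_ge0// ltW.
- move=> x x1; have x0 : 0 < x by rewrite (lt_le_trans ltr01).
  rewrite ger0_norm ?expR_ge0// (gtr0_norm x0).
  rewrite (@le_trans _ _ (C * x `^ (- 2)))//; last first.
    by rewrite ler_wpM2r ?powR_ge0// lerDr.
  have y0 : 0 < a * x `^ beta by rewrite mulr_gt0 ?powR_gt0.
  have z0 : 0 < C * x `^ (- 2) by rewrite mulr_gt0// powR_gt0.
  rewrite expRN invf_ple ?posrE ?expR_gt0//.
  apply: (@le_trans _ _ ((a * x `^ beta) ^+ m.+1 / (m.+1)`!%:R)); last first.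
    by rewrite (le_trans _ (expR_ge1Dxn m (ltW y0)))// lerDr.
  rewrite invfM powRN invrK /C invf_div mulrAC ler_wpM2r ?invr_ge0//.
  rewrite exprMn ler_wpM2l ?exprn_ge0 ?(ltW a0)//.
  rewrite -powR_mulrn ?powR_ge0// -powRrM ler_powR//.
Qed.

(** Dilation by delta reduces the kernel to delta = 1. The mass being the same for all delta is what
    makes the bound in [green_re_laplace_le] uniform. *)
Lemma integrable_cauchy (delta : R) : 0 < delta ->
  leb.-integrable setT (EFin \o (fun u => 2 * delta / (delta ^+ 2 + u ^+ 2))) /\
  \int[leb]_u (2 * delta / (delta ^+ 2 + u ^+ 2)) =
  \int[leb]_u (2 / (1 + u ^+ 2)).
Proof.
move=> d0.
have i1 : leb.-integrable setT (EFin \o (fun u : R => 2 / (1 + u ^+ 2))).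
  have p1 (u : R) : 0 < 1 + u ^+ 2 by rewrite ltr_pwDl ?sqr_ge0.
  have mf : measurable_fun setT (fun u : R => 2 / (1 + u ^+ 2)).
    apply: continuous_measurable_fun => u; apply: cvgM; first exact: cvg_cst.
    apply: cvgV; first by rewrite gt_eqF.
    by apply: cvgD; [exact: cvg_cst|exact: exprn_continuous].
  apply: integrable_even => //; first by move=> u; rewrite sqrrN.
  apply: (@integrable_powR_mix _ 0 2 2) => //.
  - by rewrite ltr1n.
  - exact: measurable_funTS.
  - move=> x _ _; rewrite oppr0 powRr0 mulr1 ger0_norm ?divr_ge0 ?(ltW (p1 _))//.
    by rewrite ler_pdivrMr// ler_peMr// lerDl sqr_ge0.
  - move=> x x1; have x0 : 0 < x by rewrite (lt_le_trans ltr01).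
    rewrite ger0_norm ?divr_ge0 ?(ltW (p1 _))// ler_pM2l//.
    rewrite powRN lef_pV2 ?posrE ?powR_gt0// powR_mulrn ?(ltW x0)//.
    by rewrite lerDr.
have di0 : delta^-1 != 0 by rewrite invr_eq0 gt_eqF.
have [i2 E] := Rintegral_scale di0 i1.
have F : (fun u => 2 * delta / (delta ^+ 2 + u ^+ 2)) =
    (fun u => delta^-1 * (2 / (1 + (delta^-1 * u) ^+ 2))).
  apply/funext => u; field.
  by rewrite !gt_eqF//= ltr_pwDl ?sqr_ge0 ?exprn_gt0.
rewrite F; split; first exact: integrable_scale.
rewrite RintegralZl// E gtr0_norm ?invr_gt0// invrK mulrA mulVf ?mul1r//.
by rewrite gt_eqF.
Qed.

End even_integrals.

(** * The Green function: positivity, integrability and size near the origin *)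

Section green_kernel.
Context {R : realType} {d : nat}.
Variables (beta : R) (mu : {finite_measure set 'rV[R]_d -> \bar R}) (c : R).
Hypothesis beta02 : 0 < beta < 2.
Hypothesis c0 : 0 < c.
Hypothesis d_gt0 : (0 < d)%N.
Local Notation psi := (psi mu beta).
Local Notation L := (@lebesgue_rV R d).
Local Notation leb := (@lebesgue_measure R).
Hypothesis psi_lower : forall xi, c * enorm xi `^ beta <= psi xi.

Let b0 : 0 < beta. Proof. by case/andP: beta02. Qed.

Definition semigroup (t : R) (xi : 'rV[R]_d) : R := expR (- (t * psi xi)).

Lemma semigroup_ge0 t xi : 0 <= semigroup t xi.
Proof. exact: expR_ge0. Qed.

Lemma semigroup_le1 t xi : 0 <= t -> semigroup t xi <= 1.
Proof.
move=> t0; rewrite -[leRHS]expR0 ler_expR oppr_le0 mulr_ge0//; exact: psi_ge0.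
Qed.

Lemma measurable_semigroup t : measurable_fun setT (semigroup t).
Proof.
apply: measurableT_comp => //; apply: measurableT_comp => //.
by apply: measurable_funM => //; exact: measurable_psi.
Qed.

(** [enorm] dominates every coordinate, so enorm(x)^beta is at least the mean of the |x_i|^beta; the
    exponential of the mean splits into a product of integrable functions of one variable. *)
Lemma integrable_semigroup t : 0 < t -> L.-integrable setT (EFin \o semigroup t).
Proof.
move=> t0.
pose a := t * (c / d%:R).
pose h (u : R) := expR (- (a * `|u| `^ beta)).
have dR : 0 < d%:R :> R by rewrite ltr0n.
have a0 : 0 < a by rewrite mulr_gt0// divr_gt0.
have h0 x : 0 <= h x by exact: expR_ge0.
have [ip _] := integrable_coord_prod d h0 (integrable_expN_powR a0 b0).
apply: (integrable_le_dom _ _ ip) => //; first exact: measurable_semigroup.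
move=> x _; rewrite ger0_norm ?semigroup_ge0// /h /semigroup.
rewrite -(big_morph expR (@expRD R) (@expR0 R)) ler_expR sumrN lerN2.
rewrite -mulr_sumr /a -mulrA ler_wpM2l ?(ltW t0)//.
apply: le_trans (psi_lower x).
rewrite -mulrA ler_wpM2l ?(ltW c0)// mulrC ler_pdivrMr//.
rewrite -[X in _ * X%:R]card_ord mulr_natr -sumr_const; apply: ler_sum => i _.
by rewrite ge0_ler_powR ?nnegrE ?coord_le_enorm ?enorm_ge0// ltW.
Qed.

Lemma integrable_sin_semigroup t x : 0 < t ->
  L.-integrable setT (EFin \o (fun xi => sin (dot x xi) * semigroup t xi)).
Proof.
move=> t0; apply: (integrable_bounded_mul (M := 1)); last exact: integrable_semigroup.
  apply: (@measurableT_comp _ _ _ _ _ _ sin).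
    by apply: continuous_measurable_fun; exact: continuous_sin.
  exact: measurable_dot.
by move=> xi; exact: normr_sin_le1.
Qed.

Definition green_re (t : R) (x : 'rV[R]_d) : R :=
  (2 * pi) ^- d * cos_transform (semigroup t) x.

Lemma semigroupN t xi : semigroup t (- xi) = semigroup t xi.
Proof. by rewrite /semigroup psiN. Qed.

(** [psi] is even, so the integrand is odd and reflection turns the integral into its negative. This
    is why G is real. *)
Lemma sin_transform0 t x : 0 < t ->
  \int[L]_xi (sin (dot x xi) * semigroup t xi) = 0.
Proof.
move=> t0; have := Rintegral_rV_opp (integrable_sin_semigroup x t0).
have E xi : sin (dot x (- xi)) * semigroup t (- xi) =
    -1 * (sin (dot x xi) * semigroup t xi).
  by rewrite semigroupN dotC dotNl dotC sinN mulN1r mulNr.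
have E2 : \int[L]_xi (sin (dot x (- xi)) * semigroup t (- xi)) =
    -1 * \int[L]_xi (sin (dot x xi) * semigroup t xi).
  rewrite -RintegralZl//; last exact: integrable_sin_semigroup.
  by apply: eq_Rintegral => xi _; exact: E.
move=> h; exact: (eq_oppr_eq0 h E2).
Qed.

Lemma greenE t x : 0 < t -> green beta mu t x = (green_re t x)%:C%C.
Proof.
move=> t0; rewrite /green /green_re /cintegral /cos_transform.
have -> : (fun xi => complex.Re (expi (dot x xi) * (expR (- (t * psi xi)))%:C)%C) =
    (fun xi => cos (dot x xi) * semigroup t xi).
  by apply/funext => xi; rewrite /expi /= mulr0 subr0.
have -> : (fun xi => complex.Im (expi (dot x xi) * (expR (- (t * psi xi)))%:C)%C) =
    (fun xi => sin (dot x xi) * semigroup t xi).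
  by apply/funext => xi; rewrite /expi /= mulr0 add0r.
rewrite sin_transform0//.
by apply/eqP; rewrite eq_complex/= !mul0r !mulr0 subr0 addr0 !eqxx.
Qed.

Lemma pi2d_gt0 : 0 < (2 * pi) ^- d :> R.
Proof. by rewrite invr_gt0 exprn_gt0// mulr_gt0// pi_gt0. Qed.

Lemma green_re_ge0 t x : 0 < t -> 0 <= green_re t x.
Proof.
move=> t0; rewrite mulr_ge0 ?(ltW pi2d_gt0)//.
apply: positive_multiplier_transform; last exact: integrable_semigroup.
by apply: positive_multiplier_expN_psi => //; exact: ltW.
Qed.

Lemma green_re_le t x : 0 < t -> green_re t x <= (2 * pi) ^- d * \int[L]_xi semigroup t xi.
Proof.
move=> t0; rewrite ler_wpM2l ?(ltW pi2d_gt0)//.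
apply: le_Rintegral => //.
- by apply: integrable_cos_mul; exact: integrable_semigroup.
- exact: integrable_semigroup.
- by move=> xi _; rewrite ler_piMl ?semigroup_ge0// cos_le1.
Qed.

(** Dilation of the frequency by t^(1/beta), under which [psi] is multiplied by t. *)
Lemma green_re_scale t x : 0 < t ->
  green_re t x = t `^ (- (d%:R / beta)) * green_re 1 (t `^ (- beta^-1) *: x).
Proof.
move=> t0; rewrite /green_re mulrCA; congr (_ * _).
have t1 : 0 < t `^ beta^-1 by exact: powR_gt0.
have [_] := @Rintegral_rV_scale _ _ (t `^ beta^-1) _ (lt0r_neq0 t1)
  (integrable_cos_mul (t `^ (- beta^-1) *: x) (integrable_semigroup ltr01)).
rewrite gtr0_norm//.
have -> : (t `^ beta^-1) ^- d = t `^ (- (d%:R / beta)).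
  by rewrite -powR_mulrn ?(ltW t1)// -powRrM powRN mulrC.
move=> <-; apply: eq_Rintegral => xi _.
rewrite dotZl dotZr mulrA -powRD; last by rewrite (gt_eqF t0) implybT.
rewrite addNr powRr0 mul1r /semigroup psiZ// (gtr0_norm t1) mul1r.
by rewrite -powRrM mulVf ?gt_eqF// powRr1// ltW.
Qed.

Lemma measurable_green_re : measurable_fun setT
  (fun z : measurableTypeR R * 'rV[R]_d => green_re z.1 z.2).
Proof.
apply: measurable_funM => //.
apply: (@measurable_Rintegral_param _ _ _ _ _ L setT
  (fun z xi => cos (dot z.2 xi) * semigroup z.1 xi)) => //.
apply: measurable_funM.
  apply: measurable_cos_dot; last exact: measurable_snd.
  exact: measurableT_comp measurable_snd measurable_fst.
apply: measurableT_comp => //; apply: measurableT_comp => //.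
apply: measurable_funM; first exact: measurableT_comp measurable_fst measurable_fst.
by apply: measurableT_comp; [exact: measurable_psi|exact: measurable_snd].
Qed.

Lemma measurable_green_re1 t : measurable_fun setT (green_re t).
Proof. exact: (measurableT_comp measurable_green_re (pair1_measurable t)). Qed.

(** Fubini moves the Laplace kernel to the frequency side, where it becomes a product of Cauchy
    kernels. The semigroup factor is at most 1, and what remains is the mass of that product. *)
Lemma green_re_laplace_le (delta : R) : 0 < delta ->
  \int[L]_x (green_re 1 x * \prod_i laplace delta (x ord0 i)) <=
  (2 * pi) ^- d * (\int[leb]_u (2 / (1 + u ^+ 2))) ^+ d.
Proof.
move=> d0.
have [iP _] := @integrable_coord_prod R d _ (laplace_ge0 delta) (integrable_laplace d0).
set P := fun x : 'rV[R]_d => \prod_i laplace delta (x ord0 i) in iP *.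
have P0 x : 0 <= P x by apply: prodr_ge0 => i _; exact: laplace_ge0.
have mP : measurable_fun setT P.
  by apply: measurable_coord_prod; exact: measurable_laplace.
have i1 := integrable_semigroup ltr01.
have m1 := measurable_semigroup 1.
have iC := @integrable_cauchy R delta d0.
have iF : L.-integrable setT (EFin \o (fun x => \int[L]_xi (cos (dot x xi) * semigroup 1 xi * P x))).
  apply: (@integrable_Rintegral_dom _ _ _ _ _ L L setT setT
    (fun x xi => cos (dot x xi) * semigroup 1 xi * P x) P (semigroup 1)) => //.
  - apply: measurable_funTS; apply: measurable_funM; last exact: measurableT_comp mP measurable_fst.
    apply: measurable_funM; last exact: measurableT_comp m1 measurable_snd.
    by apply: measurable_cos_dot; [exact: measurable_fst|exact: measurable_snd].
  - move=> x xi _ _; rewrite -mulrA [semigroup _ _ * _]mulrC.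
    by apply: normrM_le1; [exact: normr_cos_le1|rewrite mulr_ge0 ?semigroup_ge0].
rewrite (_ : \int[L]_x _ = (2 * pi) ^- d *
    \int[L]_x \int[L]_xi (cos (dot x xi) * semigroup 1 xi * P x)); last first.
  rewrite -RintegralZl//; apply: eq_Rintegral => x _.
  rewrite /green_re -mulrA; congr (_ * _).
  by rewrite -RintegralZr//; apply: integrable_cos_mul.
rewrite ler_wpM2l ?(ltW pi2d_gt0)//.
rewrite (@Rintegral_swap_dom _ _ _ _ _ L L setT setT
    (fun x xi => cos (dot x xi) * semigroup 1 xi * P x) P (semigroup 1))//; last 2 first.
- apply: measurable_funTS; apply: measurable_funM; last exact: measurableT_comp mP measurable_fst.
  apply: measurable_funM; last exact: measurableT_comp m1 measurable_snd.
  by apply: measurable_cos_dot; [exact: measurable_fst|exact: measurable_snd].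
- move=> x xi _ _; rewrite -mulrA [semigroup _ _ * _]mulrC.
  by apply: normrM_le1; [exact: normr_cos_le1|rewrite mulr_ge0 ?semigroup_ge0].
pose k (u : R) := 2 * delta / (delta ^+ 2 + u ^+ 2).
have k0 u : 0 <= k u.
  by rewrite divr_ge0 ?mulr_ge0 ?(ltW d0)// addr_ge0 ?sqr_ge0.
have [ik Ek] := iC.
have [iK EK] := @integrable_coord_prod R d k k0 ik.
rewrite -Ek -EK.
have E xi : \int[L]_x (cos (dot x xi) * semigroup 1 xi * P x) = semigroup 1 xi * \prod_i k (xi ord0 i).
  rewrite -(proj1 (cos_laplace_rV xi d0)) -RintegralZl//; last exact: integrable_cos_mul.
  by apply: eq_Rintegral => x _; rewrite dotC [cos _ * semigroup _ _]mulrC mulrA.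
under eq_Rintegral do rewrite E.
apply: le_Rintegral => //.
- apply: (integrable_bounded_mul (M := 1)) => // xi.
  by rewrite ger0_norm ?semigroup_ge0 ?semigroup_le1.
- by move=> xi _; rewrite ler_piMl ?prodr_ge0 ?semigroup_le1.
Qed.

(** As delta = 1/(k+1) tends to 0 the Laplace kernels increase to 1; since G >= 0, monotone
    convergence turns the uniform bound of [green_re_laplace_le] into a finite integral. *)
Lemma integrable_green_re1 : L.-integrable setT (EFin \o green_re 1).
Proof.
apply: integrable_ge0_lty => //; first exact: measurable_green_re1.
  by move=> x _; exact: green_re_ge0.
pose M := (2 * pi) ^- d * (\int[leb]_u (2 / (1 + u ^+ 2))) ^+ d : R.
pose P k (x : 'rV[R]_d) := \prod_i laplace (k.+1%:R^-1 : R) (x ord0 i).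
have k0 k : 0 < k.+1%:R^-1 :> R by rewrite invr_gt0.
have P0 k x : 0 <= P k x by apply: prodr_ge0 => i _; exact: laplace_ge0.
have mP k : measurable_fun setT (P k).
  by apply: measurable_coord_prod; exact: measurable_laplace.
have iP k : L.-integrable setT (EFin \o P k).
  by have [] := @integrable_coord_prod R d _ (laplace_ge0 k.+1%:R^-1) (integrable_laplace (k0 k)).
have cvP x : P ^~ x @ \oo --> (1 : R) by exact: cvg_prod_laplace.
have ndP x : nondecreasing_seq (P ^~ x).
  move=> m k mk; apply: ler_prod => i _; rewrite laplace_ge0/= ler_expR lerN2.
  by rewrite ler_wpM2r// lef_pV2 ?posrE// ler_nat.
have iGP k : L.-integrable setT (EFin \o (fun x => green_re 1 x * P k x)).
  apply: (integrable_bounded_mul (M := (2 * pi) ^- d * \int[L]_xi semigroup 1 xi)) => //.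
    exact: measurable_green_re1.
  by move=> x; rewrite ger0_norm ?green_re_ge0// green_re_le.
have mGP k : measurable_fun setT (fun x => (green_re 1 x * P k x)%:E).
  by apply/measurable_EFinP; apply: measurable_funM => //; exact: measurable_green_re1.
apply: (@le_lt_trans _ _ M%:E); last exact: ltry.
have -> : (\int[L]_x (green_re 1 x)%:E =
    \int[L]_x limn (fun k => (green_re 1 x * P k x)%:E))%E.
  apply: eq_integral => x _; apply/esym/cvg_lim => //.
  apply: cvg_EFin; first exact: nearW.
  rewrite -[X in _ --> X]mulr1; apply: cvgM; first exact: cvg_cst.
  exact: cvP.
rewrite monotone_convergence//; last 2 first.
- by move=> k x _; rewrite lee_fin mulr_ge0 ?green_re_ge0.
- move=> x _ m k mk; rewrite lee_fin ler_wpM2l ?green_re_ge0//.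
  exact: ndP.
apply: lime_le.
  apply: ereal_nondecreasing_is_cvgn => m k mk.
  apply: ge0_le_integral => //.
  + by move=> x _; rewrite lee_fin mulr_ge0 ?green_re_ge0.
  + move=> x _; rewrite lee_fin ler_wpM2l ?green_re_ge0//; exact: ndP.
apply: nearW => k; rewrite -Rintegral_EFin// lee_fin.
exact: green_re_laplace_le.
Qed.

(** Continuity at 0 in quantitative form. For |x_i| <= 1/(k+1), 1 - cos(x.xi) is at most the minimum
    of 2 and (S/(k+1))^2, with S the l^1 norm of xi, whatever x is. The integral of this minimum
    against the semigroup tends to 0 by dominated convergence. *)
Lemma green_re1_lower : exists rho e : R, [/\ 0 < rho, 0 < e &
  forall x : 'rV[R]_d, (forall i, `|x ord0 i| <= rho) -> e <= green_re 1 x].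
Proof.
have i1 := integrable_semigroup ltr01.
pose I := \int[L]_xi semigroup 1 xi.
have I0 : 0 < I.
  apply: (@Rintegral_gt0 _ _ _ _ _ setT) => //.
  - by move=> x _; exact: semigroup_ge0.
  - by move=> x _; exact: expR_gt0.
  - exact: lebesgue_rV_setT_gt0.
pose S (xi : 'rV[R]_d) := \sum_i `|xi ord0 i|.
have mS : measurable_fun setT S.
  apply: measurable_sum => i.
  by apply: measurableT_comp => //; exact: measurable_coord_rV.
pose q k xi := Num.min 2 ((k.+1%:R^-1 * S xi) ^+ 2) * semigroup 1 xi.
have q0 k xi : 0 <= Num.min 2 ((k.+1%:R^-1 * S xi) ^+ 2).
  by rewrite le_min sqr_ge0 andbT.
have mq k : measurable_fun setT (fun xi => Num.min 2 ((k.+1%:R^-1 * S xi) ^+ 2)).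
  apply: measurable_minr => //; apply: measurable_funX.
  exact: measurable_funM.
have [|||||_ cv] := @Rintegral_dct _ _ _ L setT q (cst 0) (fun xi => 2 * semigroup 1 xi).
- by [].
- by move=> k; apply: measurable_funM => //; exact: measurable_semigroup.
- move=> xi _; rewrite -[X in _ --> X](mul0r (semigroup 1 xi)).
  apply: cvgM; last exact: cvg_cst.
  have h : (k.+1%:R^-1 * S xi) ^+ 2 @[k --> \oo] --> (0 : R).
    rewrite [X in _ --> X](_ : 0 = (0 * S xi) ^+ 2); last by rewrite mul0r expr0n.
    have h0 : k.+1%:R^-1 * S xi @[k --> \oo] --> 0 * S xi.
      by apply: cvgM; [exact: cvg_harmonic|exact: cvg_cst].
    rewrite expr2; under eq_cvg do rewrite expr2.
    exact: cvgM.
  apply: (@squeeze_cvgr _ _ _ _ (cst 0) (fun k => (k.+1%:R^-1 * S xi) ^+ 2)) => //.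
    by apply: nearW => k; rewrite q0/= ge_min lexx orbT.
  exact: cvg_cst.
- exact: integrable_scale.
- move=> k xi _; rewrite ger0_norm ?mulr_ge0 ?semigroup_ge0//.
  by rewrite ler_wpM2r ?semigroup_ge0// ge_min lexx.
rewrite Rintegral_cst// mul0r in cv.
(* This k leaves at least half of I, which is G(1, 0) without the factor (2 pi)^(-d). *)
have /cvgr0Pnorm_lt/(_ (I / 2)) := cv; rewrite divr_gt0// => /(_ isT) [k _ /(_ k (leqnn k))] /= qk.
exists k.+1%:R^-1, ((2 * pi) ^- d * (I / 2)); split.
- by rewrite invr_gt0.
- by rewrite mulr_gt0 ?pi2d_gt0// divr_gt0.
move=> x xk; rewrite ler_wpM2l ?(ltW pi2d_gt0)//.
have iqk : L.-integrable setT (EFin \o q k).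
  apply: (integrable_bounded_mul (M := 2)) => // xi.
  by rewrite ger0_norm// ge_min lexx.
rewrite (@le_trans _ _ (I - \int[L]_xi q k xi))//.
  have := le_lt_trans (ler_norm _) qk; rewrite {2}(splitr I) => h; lra.
rewrite -RintegralB//; apply: le_Rintegral => //.
- exact: integrable_sub.
- exact: integrable_cos_mul.
move=> xi _; rewrite /q -[X in X - _]mul1r -mulrBl ler_wpM2r ?semigroup_ge0//.
rewrite lerBlDr -lerBlDl le_min onem_cos_le2/=.
rewrite (le_trans (onem_cos_le_sqr _))// -real_normK ?num_real// lerXn2r ?nnegrE//.
  by rewrite mulr_ge0// ?invr_ge0// sumr_ge0.
rewrite (le_trans (ler_norm_sum _ _ _))// mulr_sumr; apply: ler_sum => i _.
by rewrite normrM ler_wpM2r.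
Qed.

End green_kernel.

(** * The one-sided stable density *)

Section continuous_measurable_prod.
Context {R : realType}.

(* The product sigma-algebra on [R * R] is compared with the Borel sets of
   ['rV_2], where open sets are measurable by definition. *)
Lemma measurable_fun_continuous_pair (f : R * R -> R) :
  (forall z, 0 < z.1 -> {for z, continuous f}) ->
  measurable_fun ([set u : measurableTypeR R | 0 < u] `*` [set: measurableTypeR R]) f.
Proof.
move=> cf.
pose E (v : 'rV[R]_2) : R * R := (v ord0 ord0, v ord0 (lift ord0 ord0)).
pose J (z : measurableTypeR R * measurableTypeR R) : 'rV[R]_2 :=
  \row_i (if i == ord0 then z.1 else z.2).
have EJ z : E (J z) = z by rewrite /E /J !mxE; case: z.
have mJ : measurable_fun setT J.
  apply: measurable_fun_rV => i; under eq_fun do rewrite mxE.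
  by case: (i == ord0); [exact: measurable_fst|exact: measurable_snd].
have cE v : {for v, continuous E}.
  have c0 := @coord_continuous R 1 2 ord0 ord0 v.
  have c1 := @coord_continuous R 1 2 ord0 (lift ord0 ord0) v.
  exact: (cvg_pair c0 c1).
have mD : measurable ([set u : measurableTypeR R | 0 < u] `*` [set: measurableTypeR R]).
  apply: measurableX => //.
  by rewrite (_ : [set _ | _] = `]0, +oo[%classic); [exact: measurable_itv|rewrite set_itvoy].
move=> _; apply: (measurability _ (RGenOpens.measurableE R)) => //.
move=> _ [_ [a [b ->]] <-].
have -> : ([set u : measurableTypeR R | 0 < u] `*` setT) `&` f @^-1` `]a, b[ =
    J @^-1` [set v : 'rV[R]_2 | 0 < (E v).1 /\ f (E v) \in `]a, b[].
  apply/seteqP; split => z /=; rewrite EJ mxE/=.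
    by move=> [[? _] ?].
  by move=> [? ?].
rewrite -[X in measurable X]setTI; apply: mJ => //.
apply: rV_open_measurable; rewrite openE => v /= [v0 fv].
have : \forall w \near v, 0 < (E w).1.
  have c1 := @coord_continuous R 1 2 ord0 ord0 v.
  exact: (cvgr_gt _ c1 _ v0).
have : \forall w \near v, f (E w) \in `]a, b[.
  have c2 : {for v, continuous (f \o E)}.
    by apply: continuous_comp; [exact: cE|exact: cf].
  have ob : nbhs (f (E v)) (`]a, b[%classic : set R).
    by apply: open_nbhs_nbhs; split; [exact: interval_open|exact: fv].
  exact: (c2 _ ob).
by apply: filterS2 => w h1 h2; split.
Qed.

End continuous_measurable_prod.

(** * The tent and its adjoint fractional derivative *)

Section test_function.
Context {R : realType}.
Local Notation leb := (@lebesgue_measure R).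
Variables (alpha : R).
Hypothesis alpha01 : 0 < alpha < 1.

Let a0 : 0 < alpha. Proof. by case/andP: alpha01. Qed.
Let a1 : alpha < 1. Proof. by case/andP: alpha01. Qed.

(* The test function for the fractional equation: the adjoint fractional
   derivative of the tent lies between [C K^(-alpha) * tent] and
   [C K^(-alpha)] on the half-line, for the same constant [C]. *)
Definition tent (K s : R) : R := Num.min 1 (Num.max (1 - s / K) 0).

Lemma tent_ge0 K s : 0 <= tent K s.
Proof. by rewrite le_min ler01 le_max lexx orbT. Qed.

Lemma tent_le1 K s : tent K s <= 1.
Proof. by rewrite ge_min lexx. Qed.

Lemma tent0 K : tent K 0 = 1.
Proof. by rewrite /tent mul0r subr0 max_l ?min_l. Qed.

Lemma tent_eq0 K s : 0 < K -> K <= s -> tent K s = 0.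
Proof.
move=> K0 Ks; rewrite /tent max_r; first by rewrite min_r.
by rewrite subr_le0 ler_pdivlMr// mul1r.
Qed.

Lemma tentE K s : 0 < K -> 0 <= s -> tent K s = 1 - Num.min (s / K) 1.
Proof.
move=> K0 s0; rewrite /tent.
have sK : 0 <= s / K by rewrite divr_ge0// ltW.
have [h|h] := leP (s / K) 1.
  by rewrite max_l ?min_r// ?subr_ge0// gerBl.
by rewrite max_r ?min_r ?subrr// subr_le0 ltW.
Qed.

Lemma continuous_tent K : continuous (tent K).
Proof.
apply: (@min_fun_continuous _ R R (cst 1) (fun u => Num.max (1 - u / K) 0)).
  exact: cst_continuous.
apply: (@max_fun_continuous _ R R (fun u => 1 - u / K) (cst 0)); last exact: cst_continuous.
move=> s; by apply: cvgB; [exact: cvg_cst|apply: cvgM; [exact: cvg_id|exact: cvg_cst]].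
Qed.

Lemma measurable_tent K : measurable_fun setT (tent K).
Proof. by apply: continuous_measurable_fun; exact: continuous_tent. Qed.

(** An upper bound for the drop of the tent over a distance tau and, once multiplied by the tent, a
    lower bound. Linear at 0 and bounded, it is integrable against tau^(-1-alpha). *)
Definition step_weight (K tau : R) : R := Num.min (tau / K) 1.

Lemma step_weight_ge0 K tau : 0 < K -> 0 < tau -> 0 <= step_weight K tau.
Proof. by move=> K0 t0; rewrite le_min ler01 divr_ge0 ?ltW. Qed.

Lemma tent_diff_ge0 K s tau : 0 < K -> 0 < tau -> 0 <= tent K s - tent K (s + tau).
Proof.
move=> K0 t0; rewrite subr_ge0 /tent le_min !ge_min lexx/=.
apply/orP; right; rewrite ge_max !le_max lexx orbT andbT.
by apply/orP; left; rewrite lerB// ler_wpM2r ?invr_ge0 ?ltW// ltrDl.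
Qed.

Lemma tent_diff_le K s tau : 0 < K -> 0 < tau ->
  tent K s - tent K (s + tau) <= step_weight K tau.
Proof.
move=> K0 t0; rewrite /step_weight le_min; apply/andP; split; last first.
  by rewrite (le_trans _ (tent_le1 K s))// gerBl tent_ge0.
have tK : 0 <= tau / K by rewrite divr_ge0// ltW.
rewrite lerBlDr /tent (_ : (s + tau) / K = s / K + tau / K) ?mulrDl//.
move: (s / K) (tau / K) tK => x y y0.
rewrite /Num.min /Num.max.
by repeat case: ifPn; rewrite -?leNgt => *; lra.
Qed.

(** With x = s/K <= 1 and y = tau/K the drop is min(y, 1 - x). The factors 1 - x and min(y, 1) lie
    in [0, 1], so their product is below both y and 1 - x. *)
Lemma tent_diff_lower K s tau : 0 < K -> 0 <= s -> 0 < tau ->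
  tent K s * step_weight K tau <= tent K s - tent K (s + tau).
Proof.
move=> K0 s0 t0; rewrite !tentE// ?addr_ge0 ?(ltW t0)// /step_weight.
rewrite (_ : (s + tau) / K = s / K + tau / K) ?mulrDl//.
have tK : 0 <= tau / K by rewrite divr_ge0// ltW.
have sK : 0 <= s / K by rewrite divr_ge0// ltW.
move: (s / K) (tau / K) tK sK => x y y0 x0.
by rewrite /Num.min; repeat case: ifPn; rewrite -?leNgt => *; nra.
Qed.

Definition weight (tau : R) : R := tau `^ (- 1 - alpha).

Lemma weight_ge0 tau : 0 <= weight tau. Proof. exact: powR_ge0. Qed.

Lemma measurable_weight : measurable_fun setT weight.
Proof. exact: measurable_powR. Qed.

Lemma measurable_step_weight K : measurable_fun setT (step_weight K).
Proof. by apply: measurable_minr => //; exact: measurable_funM. Qed.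

Definition step_const : R :=
  \int[leb]_(tau in `]0, +oo[) (step_weight 1 tau * weight tau).

Lemma weight_mix (L M : R) (f : R -> R) : measurable_fun setT f ->
  (forall tau, 0 < tau -> `|f tau| <= L * tau) ->
  (forall tau, 0 < tau -> `|f tau| <= M) ->
  leb.-integrable `]0, +oo[ (EFin \o (fun tau => f tau * weight tau)).
Proof.
move=> mf fL fM.
have L0 : 0 <= L by have := le_trans (normr_ge0 _) (fL 1 ltr01); rewrite mulr1.
have M0 : 0 <= M by exact: le_trans (normr_ge0 _) (fM 1 ltr01).
apply: (@integrable_powR_mix _ alpha (1 + alpha) (L + M)).
- exact: a1.
- by rewrite ltrDl.
- by apply: measurable_funTS; apply: measurable_funM => //; exact: measurable_weight.
- move=> x x0 x1; rewrite normrM (ger0_norm (weight_ge0 _)).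
  apply: (@le_trans _ _ (L * x * weight x)).
    by rewrite ler_wpM2r ?weight_ge0 ?fL.
  rewrite -mulrA /weight -{1}(powRr1 (ltW x0)) -powRD; last by rewrite (gt_eqF x0) implybT.
  by rewrite (_ : 1 + (-1 - alpha) = - alpha) ?ler_wpM2r ?powR_ge0 ?lerDl//; ring.
- move=> x x1; have x0 : 0 < x by rewrite (lt_le_trans ltr01).
  rewrite normrM (ger0_norm (weight_ge0 _)) /weight opprD.
  rewrite ler_wpM2r ?powR_ge0// (le_trans (fM _ x0))//.
  by rewrite lerDr.
Qed.

(** Dilation by K reduces to K = 1: the weight contributes K^(-1-alpha) and the measure K. *)
Lemma integrable_step_weight K : 0 < K -> leb.-integrable `]0, +oo[
    (EFin \o (fun tau => step_weight K tau * weight tau)) /\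
  \int[leb]_(tau in `]0, +oo[) (step_weight K tau * weight tau) =
    step_const * K `^ (- alpha).
Proof.
have i1 : leb.-integrable `]0, +oo[
    (EFin \o (fun tau => step_weight 1 tau * weight tau)).
  apply: (@weight_mix 1 1); first exact: measurable_step_weight.
  - move=> tau t0; rewrite ger0_norm ?step_weight_ge0// /step_weight divr1 mul1r.
    by rewrite ge_min lexx.
  - move=> tau t0; rewrite ger0_norm ?step_weight_ge0// /step_weight.
    by rewrite ge_min lexx orbT.
move=> K0; have Ki : 0 < K^-1 by rewrite invr_gt0.
have [i2 E2] := Rintegral_scale0y Ki i1.
have mI : measurable (`]0, +oo[%classic : set (measurableTypeR R)) by exact: measurable_itv.
have E tau : 0 < tau -> step_weight K tau * weight tau =
    K `^ (- 1 - alpha) * (step_weight 1 (K^-1 * tau) * weight (K^-1 * tau)).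
  move=> t0; rewrite /step_weight divr1 [K^-1 * tau]mulrC /weight.
  rewrite powRM ?(ltW t0) ?(ltW Ki)//.
  have -> : K^-1 `^ (- 1 - alpha) = (K `^ (- 1 - alpha))^-1.
    by rewrite -[K^-1]powR_inv1 ?(ltW K0)// -powRrM mulN1r powRN.
  have : K `^ (- 1 - alpha) != 0 by rewrite gt_eqF// powR_gt0.
  move: (Num.min _ _) (tau `^ _) (K `^ _) => x y z z0.
  by field.
split.
  have := integrable_scale (K `^ (- 1 - alpha)) mI i2.
  apply: eq_integrable => // tau; rewrite inE/= in_itv/= andbT => t0.
  by rewrite E.
transitivity (\int[leb]_(tau in `]0, +oo[) (K `^ (- 1 - alpha) *
    (step_weight 1 (K^-1 * tau) * weight (K^-1 * tau)))).
  by apply: eq_Rintegral => tau; rewrite inE/= in_itv/= andbT => t0; rewrite E.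
rewrite (RintegralZl _ mI i2) E2 invrK mulrA mulrC; congr (_ * _).
rewrite -[X in _ * X](powRr1 (ltW K0)) -powRD; last by rewrite (gt_eqF K0) implybT.
by congr (_ `^ _); ring.
Qed.

Lemma step_const_gt0 : 0 < step_const.
Proof.
have [i1 _] := integrable_step_weight ltr01.
apply: (@Rintegral_gt0 _ _ _ _ _ (`]0, 1[%classic : set (measurableTypeR R))) => //.
- by move=> x /=; rewrite !in_itv/= => /andP[->].
- move=> x /=; rewrite in_itv/= andbT => x0.
  by rewrite mulr_ge0 ?weight_ge0 ?step_weight_ge0.
- move=> x /=; rewrite in_itv/= => /andP[x0 x1].
  by rewrite mulr_gt0 ?powR_gt0// lt_min divr1 x0 ltr01.
- exact: lebesgue_measure_oo_gt0.
Qed.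

(** The adjoint of [frac_derive] applied to the tent, without the factor alpha / Gamma(1 - alpha):
    the increments now look to the right. *)
Definition tent_adjoint (K s : R) : R :=
  \int[leb]_(tau in `]0, +oo[) ((tent K s - tent K (s + tau)) * weight tau).

Lemma integrable_tent_diff K s : 0 < K -> leb.-integrable `]0, +oo[
  (EFin \o (fun tau => (tent K s - tent K (s + tau)) * weight tau)).
Proof.
move=> K0; have [i1 _] := integrable_step_weight K0.
apply: (integrable_le_dom _ _ i1) => //.
  apply: measurable_funTS; apply: measurable_funM; last exact: measurable_weight.
  apply: measurable_funB => //; apply: measurableT_comp; first exact: measurable_tent.
  exact: measurable_funD.
move=> tau /=; rewrite in_itv/= andbT => t0.
rewrite ger0_norm ?mulr_ge0 ?weight_ge0 ?tent_diff_ge0//.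
by rewrite ler_wpM2r ?weight_ge0 ?tent_diff_le.
Qed.

Lemma tent_adjoint_ge0 K s : 0 < K -> 0 <= tent_adjoint K s.
Proof.
move=> K0; apply: Rintegral_ge0 => tau /=; rewrite in_itv/= andbT => t0.
by rewrite mulr_ge0 ?weight_ge0 ?tent_diff_ge0.
Qed.

Lemma tent_adjoint_le K s : 0 < K -> tent_adjoint K s <= step_const * K `^ (- alpha).
Proof.
move=> K0; have [i1 <-] := integrable_step_weight K0.
apply: le_Rintegral => //; first exact: integrable_tent_diff.
move=> tau /=; rewrite in_itv/= andbT => t0.
by rewrite ler_wpM2r ?weight_ge0 ?tent_diff_le.
Qed.

Lemma tent_adjoint_lower K s : 0 < K -> 0 <= s ->
  step_const * K `^ (- alpha) * tent K s <= tent_adjoint K s.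
Proof.
move=> K0 s0; have [i1 <-] := integrable_step_weight K0.
have mI : measurable (`]0, +oo[%classic : set (measurableTypeR R)) by exact: measurable_itv.
rewrite mulrC -(RintegralZl _ mI i1); apply: le_Rintegral => //.
- exact: (integrable_scale (tent K s) mI i1).
- exact: integrable_tent_diff.
move=> tau /=; rewrite in_itv/= andbT => t0.
by rewrite mulrA ler_wpM2r ?weight_ge0 ?tent_diff_lower.
Qed.

Lemma measurable_tent_adjoint K : measurable_fun setT (tent_adjoint K).
Proof.
apply: (@measurable_Rintegral_param _ _ _ _ _ leb _
  (fun s tau => (tent K s - tent K (s + tau)) * weight tau)) => //.
apply: measurable_funM.
  apply: measurable_funB.
    exact: measurableT_comp (measurable_tent K) measurable_fst.
  apply: measurableT_comp; first exact: measurable_tent.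
  by apply: measurable_funD; [exact: measurable_fst|exact: measurable_snd].
exact: measurableT_comp measurable_weight measurable_snd.
Qed.

(** Fractional integration by parts: for fixed tau, the shift s -> s + tau moves the difference from
    [f] to the tent. The two exchanges of integrals need different dominations: before the shift,
    min(L tau, M) times the weight on [0, K]; after it, [f] times the step weight. *)
Lemma tent_frac_derive (K L M : R) (f : R -> R) : 0 < K ->
  measurable_fun setT f -> leb.-integrable setT (EFin \o f) ->
  (forall s, 0 <= f s) -> (forall s, s < 0 -> f s = 0) ->
  (forall s tau, 0 <= s <= K -> 0 < tau -> `|f (s - tau) - f s| <= L * tau) ->
  (forall s, s <= K -> f s <= M) ->
  \int[leb]_s (tent K s *
    \int[leb]_(tau in `]0, +oo[) ((f (s - tau) - f s) * weight tau)) =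
  - \int[leb]_s (f s * tent_adjoint K s).
Proof.
move=> K0 mf intf f0 fneg fL fM.
have mI : measurable (`]0, +oo[%classic : set (measurableTypeR R)) by exact: measurable_itv.
have L0 : 0 <= L.
  have := le_trans (normr_ge0 _) (fL 0 1 _ ltr01); rewrite mulr1; apply.
  by rewrite lexx/= ltW.
have M0 : 0 <= M by rewrite (le_trans (f0 0) (fM 0 _))// ltW.
pose B (tau : R) := Num.min (L * tau) M.
have mB : measurable_fun setT B.
  by apply: measurable_minr => //; exact: measurable_funM.
have B0 tau : 0 < tau -> 0 <= B tau.
  by move=> t0; rewrite le_min M0 mulr_ge0// ltW.
have iB : leb.-integrable `]0, +oo[ (EFin \o (fun tau => B tau * weight tau)).
  apply: (@weight_mix L M) => // tau t0; rewrite ger0_norm ?B0//.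
    by rewrite ge_min lexx.
  by rewrite ge_min lexx orbT.
pose A (s : R) : R := \1_(`[0, K] : set R) s.
have iA : leb.-integrable setT (EFin \o A) by exact: integrable_indic_itv.
have fB s tau : 0 <= s <= K -> 0 < tau -> `|f (s - tau) - f s| <= B tau.
  move=> sK t0; rewrite le_min fL//=.
  have h1 : f s <= M by apply: fM; case/andP: sK.
  have h2 : f (s - tau) <= M.
    by case/andP: sK => h3 h4; apply: fM; lra.
  by have := f0 s; have := f0 (s - tau); rewrite ler_norml => *; apply/andP; split; lra.
have mdiff : measurable_fun setT (fun z : measurableTypeR R * measurableTypeR R => f (z.1 - z.2)).
  apply: measurableT_comp => //.
  by apply: measurable_funB; [exact: measurable_fst|exact: measurable_snd].
have mf1 : measurable_fun setT (fun z : measurableTypeR R * measurableTypeR R => f z.1).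
  exact: measurableT_comp mf measurable_fst.
have mw2 : measurable_fun setT (fun z : measurableTypeR R * measurableTypeR R => weight z.2).
  exact: measurableT_comp measurable_weight measurable_snd.
have mt1 : measurable_fun setT (fun z : measurableTypeR R * measurableTypeR R => tent K z.1).
  exact: measurableT_comp (measurable_tent K) measurable_fst.
have mt2 : measurable_fun setT (fun z : measurableTypeR R * measurableTypeR R => tent K (z.1 + z.2)).
  apply: measurableT_comp; first exact: measurable_tent.
  by apply: measurable_funD; [exact: measurable_fst|exact: measurable_snd].
have mfs (tau : R) : measurable_fun setT (fun s : R => f (s - tau)).
  by apply: measurableT_comp => //; exact: measurable_funB.
(* For s > K the inner integral is not controlled, but the tent vanishes there; for s < 0 the
   difference itself is zero. *)
have iF s : leb.-integrable `]0, +oo[ (EFin \o (fun tau => (f (s - tau) - f s) * weight tau)) \/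
    (tent K s = 0 \/ s < 0).
  have [s0|s0] := ltP s 0; first by right; right.
  have [sK|sK] := leP s K; last by right; left; rewrite tent_eq0// ltW.
  left; apply: (integrable_le_dom _ _ iB) => //.
    apply: measurable_funTS; apply: measurable_funM; last exact: measurable_weight.
    apply: measurable_funB => //; apply: measurableT_comp => //.
    exact: measurable_funB.
  move=> tau /=; rewrite in_itv/= andbT => t0.
  by rewrite normrM (ger0_norm (weight_ge0 _)) ler_wpM2r ?weight_ge0 ?fB ?s0.
transitivity (\int[leb]_s \int[leb]_(tau in `]0, +oo[)
    (tent K s * ((f (s - tau) - f s) * weight tau))).
  apply: eq_Rintegral => s _; case: (iF s) => [is1|[ts|s0]].
  - by rewrite RintegralZl.
  - rewrite ts mul0r (@eq_Rintegral _ _ _ _ _ (cst 0)) ?Rintegral_cst ?mul0r// => tau _.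
    by rewrite mul0r.
  - have E tau : 0 < tau -> f (s - tau) - f s = 0.
      by move=> t0; rewrite !fneg ?subrr//; lra.
    rewrite (@eq_Rintegral _ _ _ _ _ (cst 0)) ?Rintegral_cst ?mul0r ?mulr0//; last first.
      by move=> tau; rewrite inE/= in_itv/= andbT => t0; rewrite E// mul0r.
    rewrite (@eq_Rintegral _ _ _ _ _ (cst 0)) ?Rintegral_cst ?mul0r// => tau.
    by rewrite inE/= in_itv/= andbT => t0; rewrite E// mul0r mulr0.
rewrite (@Rintegral_swap_dom _ _ _ _ _ leb leb setT (`]0, +oo[%classic : set (measurableTypeR R))
  (fun s tau => tent K s * ((f (s - tau) - f s) * weight tau)) A
  (fun tau => B tau * weight tau))//; last 2 first.
- apply: measurable_funTS; apply: measurable_funM => //.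
  by apply: measurable_funM => //; exact: measurable_funB.
- move=> s tau _ /=; rewrite in_itv/= andbT => t0.
  rewrite /A indicE mem_setE in_itv/=.
  have [s0|s0] /= := leP 0 s; last first.
    by rewrite mul0r !fneg ?subrr ?mul0r ?mulr0 ?normr0//; lra.
  have [sK|sK] := leP s K; last by rewrite tent_eq0 ?mul0r ?normr0// ltW.
  rewrite mul1r normrM (ger0_norm (tent_ge0 _ _)) -[leRHS]mul1r.
  rewrite ler_pM ?tent_ge0 ?tent_le1// normrM (ger0_norm (weight_ge0 _)).
  by rewrite ler_wpM2r ?weight_ge0 ?fB ?s0.
pose sw tau := step_weight K tau * weight tau.
have [isw _] := integrable_step_weight K0.
transitivity (- \int[leb]_(tau in `]0, +oo[) \int[leb]_s
    (f s * ((tent K s - tent K (s + tau)) * weight tau))).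
  rewrite -mulN1r -RintegralZl//; last first.
    apply: (@integrable_Rintegral_dom _ _ _ _ _ leb leb (`]0, +oo[%classic : set (measurableTypeR R)) setT
      (fun tau s => f s * ((tent K s - tent K (s + tau)) * weight tau)) sw f) => //.
    + apply: measurable_funTS; apply: measurable_funM.
        exact: measurableT_comp mf measurable_snd.
      apply: measurable_funM; last exact: measurableT_comp measurable_weight measurable_fst.
      apply: measurable_funB; first exact: measurableT_comp (measurable_tent K) measurable_snd.
      apply: measurableT_comp; first exact: measurable_tent.
      by apply: measurable_funD; [exact: measurable_snd|exact: measurable_fst].
    + move=> tau s /=; rewrite in_itv/= andbT => t0 _.
      rewrite ger0_norm ?mulr_ge0 ?weight_ge0 ?tent_diff_ge0// mulrC.
      by rewrite ler_wpM2r// ler_wpM2r ?weight_ge0 ?tent_diff_le.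
  apply: eq_Rintegral => tau; rewrite inE/= in_itv/= andbT => t0.
  have itf (h : R -> R) : measurable_fun setT h -> (forall s, `|h s| <= 1) ->
      leb.-integrable setT (EFin \o (fun s => f s * h s)).
    move=> mh h1; apply: (integrable_le_dom _ _ intf) => //; first exact: measurable_funM.
    by move=> s _; rewrite normrM (ger0_norm (f0 s)) ler_piMr.
  have tn s : `|tent K s| <= 1 by rewrite ger0_norm ?tent_ge0 ?tent_le1.
  have i1 : leb.-integrable setT (EFin \o (fun s => f s * tent K s)).
    by apply: itf => //; exact: measurable_tent.
  have i2 : leb.-integrable setT (EFin \o (fun s => f s * tent K (s + tau))).
    apply: itf => //; apply: measurableT_comp; first exact: measurable_tent.
    exact: measurable_funD.
  (* The shift that moves the increment from [f] to the tent. *)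
  have [i3 E3] := @Rintegral_shift _ (- tau) _ i2.
  rewrite (_ : (fun s => f (s - tau) * tent K (s - tau + tau)) =
    (fun s => f (s - tau) * tent K s)) in i3 E3; last first.
    by apply/funext => s; rewrite subrK.
  have -> : (fun s => tent K s * ((f (s - tau) - f s) * weight tau)) =
      (fun s => weight tau * (f (s - tau) * tent K s - f s * tent K s)).
    by apply/funext => s; ring.
  have -> : (fun s => f s * ((tent K s - tent K (s + tau)) * weight tau)) =
      (fun s => weight tau * (f s * tent K s - f s * tent K (s + tau))).
    by apply/funext => s; ring.
  rewrite !RintegralZl//; [|exact: integrable_sub..].
  by rewrite !RintegralB// E3; ring.
rewrite -(@Rintegral_swap_dom _ _ _ _ _ leb leb setT (`]0, +oo[%classic : set (measurableTypeR R))
  (fun s tau => f s * ((tent K s - tent K (s + tau)) * weight tau)) f sw)//; last 2 first.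
- apply: measurable_funTS; apply: measurable_funM => //.
  by apply: measurable_funM => //; exact: measurable_funB.
- move=> s tau _ /=; rewrite in_itv/= andbT => t0.
  rewrite ger0_norm ?mulr_ge0 ?weight_ge0 ?tent_diff_ge0//.
  by rewrite ler_wpM2l// ler_wpM2r ?weight_ge0 ?tent_diff_le.
congr (- _); apply: eq_Rintegral => s _; rewrite RintegralZl//.
exact: integrable_tent_diff.
Qed.

End test_function.

(** * Evolution of the mass of the tent *)

Section stable_evolution.
Context {R : realType}.
Local Notation leb := (@lebesgue_measure R).
Variables (alpha : R) (g : R -> R -> R).
Hypothesis alpha01 : 0 < alpha < 1.
Hypothesis gP : is_frac_green alpha g.

Let a0 : 0 < alpha. Proof. by case/andP: alpha01. Qed.
Let a1 : alpha < 1. Proof. by case/andP: alpha01. Qed.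

Lemma Euler_Gamma_gt0 : 0 < Euler_Gamma (1 - alpha).
Proof.
have mf : measurable_fun setT (fun u : R => u `^ (1 - alpha - 1) * expR (- u)).
  apply: measurable_funM; first exact: measurable_powR.
  by apply: measurableT_comp => //; exact: measurableT_comp.
rewrite /Euler_Gamma.
apply: (@Rintegral_gt0 _ _ _ _ _ (`]0, 1[%classic : set (measurableTypeR R))) => //.
- by move=> x /=; rewrite !in_itv/= => /andP[->].
- apply: (@integrable_powR_mix _ alpha (1 + alpha) 1) => //.
  + by rewrite ltrDl.
  + exact: measurable_funTS.
  + move=> x x0 x1; rewrite ger0_norm ?mulr_ge0 ?powR_ge0 ?expR_ge0// mul1r.
    rewrite (_ : 1 - alpha - 1 = - alpha); last by ring.
    by rewrite ler_piMr ?powR_ge0// -[leRHS]expR0 ler_expR oppr_le0 ltW.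
  + move=> x x1; have x0 : 0 < x by rewrite (lt_le_trans ltr01).
    rewrite ger0_norm ?mulr_ge0 ?powR_ge0 ?expR_ge0// mul1r.
    rewrite (_ : 1 - alpha - 1 = - alpha); last by ring.
    rewrite opprD addrC powRD ?(gt_eqF x0) ?implybT//.
    rewrite ler_wpM2l ?powR_ge0// powR_inv1 ?(ltW x0)// expRN lef_pV2 ?posrE ?expR_gt0//.
    by rewrite (le_trans _ (expR_ge1Dx _))// lerDr.
- by move=> x _; rewrite mulr_ge0 ?powR_ge0 ?expR_ge0.
- by move=> x /=; rewrite in_itv/= => /andP[x0 _]; rewrite mulr_gt0 ?powR_gt0 ?expR_gt0.
- exact: lebesgue_measure_oo_gt0.
Qed.

(** This is -1/Gamma(-alpha), the positive constant of the fractional derivative. *)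
Let C : R := alpha / Euler_Gamma (1 - alpha).

Let C0 : 0 < C. Proof. by rewrite divr_gt0 ?Euler_Gamma_gt0. Qed.

Lemma continuous_frac_green t : 0 < t -> continuous (g t).
Proof.
move=> t0 s; have [_ ds] := frac_green_derivable gP s t0.
exact/differentiable_continuous/derivable1_diffP.
Qed.

Lemma measurable_frac_green t : 0 < t -> measurable_fun setT (g t).
Proof. by move=> t0; apply: continuous_measurable_fun; exact: continuous_frac_green. Qed.

Lemma frac_green0 t : 0 < t -> g t 0 = 0.
Proof.
move=> t0; have c0 : g t x @[x --> 0^'-] --> g t 0.
  exact/cvg_at_left_filter/continuous_frac_green.
apply/esym; apply: (cvg_unique _ _ c0) => //.
apply: (@cvg_near_cst _ _ (0 : R)).
by near=> s; rewrite (frac_green_one_sided gP).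
Unshelve. all: by end_near. Qed.

Lemma frac_green_le0 t s : 0 < t -> s <= 0 -> g t s = 0.
Proof.
move=> t0; rewrite le_eqVlt => /predU1P[->|s0]; first exact: frac_green0.
exact: (frac_green_one_sided gP).
Qed.

Lemma integrable_frac_green t : 0 < t -> leb.-integrable setT (EFin \o g t).
Proof.
move=> t0; apply: integrable_ge0_lty => //; first exact: measurable_frac_green.
  by move=> s _; exact: (frac_green_ge0 gP).
by rewrite (frac_green_mass gP)// ltry.
Qed.

Lemma integrable_frac_greenM t (h : R -> R) M : 0 < t -> measurable_fun setT h ->
  (forall s, `|h s| <= M) -> leb.-integrable setT (EFin \o (fun s => g t s * h s)).
Proof.
move=> t0 mh hM; have mg := measurable_frac_green t0.
have := integrable_scale M measurableT (integrable_frac_green t0) => iM.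
apply: (integrable_le_dom _ _ iM) => //; first exact: measurable_funM.
move=> s _; rewrite normrM (ger0_norm (frac_green_ge0 gP _ t0)) mulrC.
by rewrite ler_wpM2r// (frac_green_ge0 gP).
Qed.

Lemma Rintegral_frac_green t : 0 < t -> \int[leb]_s g t s = 1.
Proof. by move=> t0; rewrite /Rintegral (frac_green_mass gP). Qed.

(** [g t] is of class C^1, so the maximum of |g'| on [-1, K] is a Lipschitz constant there. A step
    ending left of -1 is cut at -1, since [g t] vanishes at both points. *)
Lemma frac_green_lipschitz t K : 0 < t -> 0 < K -> exists L M : R,
  (forall s tau, 0 <= s <= K -> 0 < tau -> `|g t (s - tau) - g t s| <= L * tau) /\
  (forall s, s <= K -> g t s <= M).
Proof.
move=> t0 K0.
have K1 : -1 <= K by rewrite (le_trans _ (ltW K0))// lerN10.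
have cg : {within `[-1, K], continuous (g t)}.
  by apply: continuous_subspaceT; exact: continuous_frac_green.
have cd : continuous (derive1 (g t)).
  move=> s; have [_ _ c] := frac_green_C1 gP s t0.
  have ct : cst t x @[x --> s] --> t by exact: cvg_cst.
  have c2 : {for s, continuous (fun u : R => (t, u))} by exact: (cvg_pair ct cvg_id).
  exact: (@continuous_comp _ _ _ (fun u : R => (t, u)) (fun z : R * R => derive1 (g z.1) z.2) s c2 c).
have cnd : {within `[-1, K], continuous (fun s => `|derive1 (g t) s|)}.
  apply: continuous_subspaceT => s; apply: continuous_comp; first exact: cd.
  exact: norm_continuous.
have [sM _ HM] := EVT_max K1 cg.
have [sL _ HL] := EVT_max K1 cnd.
have M0 : 0 <= g t sM by exact: (frac_green_ge0 gP).
exists (`|derive1 (g t) sL|), (g t sM); split; last first.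
  move=> s sK; have [s1|s1] := ltP s (-1).
    by rewrite frac_green_le0// (le_trans (ltW s1))// lerN10.
  by apply: HM; rewrite in_itv/= s1.
have mvt x y : -1 <= x -> x <= y -> y <= K ->
    `|g t x - g t y| <= `|derive1 (g t) sL| * (y - x).
  move=> x1 xy yK.
  have dg z : z \in `]x, y[ -> is_derive z 1 (g t) (derive1 (g t) z).
    by move=> _; rewrite derive1E; apply: derivableP; have [] := frac_green_derivable gP z t0.
  have cxy : {within `[x, y], continuous (g t)}.
    by apply: continuous_subspaceT; exact: continuous_frac_green.
  have [c cxyc Hc] := MVT_segment xy dg cxy.
  rewrite distrC Hc normrM (@ger0_norm _ (y - x)) ?subr_ge0//.
  rewrite ler_wpM2r ?subr_ge0//; apply: HL.
  move: cxyc; rewrite !in_itv/= => /andP[h1 h2].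
  by rewrite (le_trans x1 h1) (le_trans h2 yK).
move=> s tau /andP[s0 sK] tau0; have [h|h] := leP (-1) (s - tau).
  apply: (le_trans (mvt _ _ h _ sK)); first by rewrite lerBlDr lerDl ltW.
  by rewrite opprB addrC subrK.
rewrite (frac_green_le0 t0 (_ : s - tau <= 0)); last by rewrite (le_trans (ltW h))// lerN10.
rewrite -(frac_green_le0 t0 (lerN10 R)).
apply: (le_trans (mvt _ _ (lexx _) _ sK)); first by rewrite (le_trans (lerN10 R)).
by rewrite ler_wpM2l//; lra.
Qed.

(** A smoothed P(S <= K) for a variable S with density [g t]. *)
Definition tent_mass (K t : R) : R := \int[leb]_s (g t s * tent K s).

Definition tent_loss (K t : R) : R := \int[leb]_s (g t s * tent_adjoint alpha K s).

Lemma integrable_tent_mass K t : 0 < t ->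
  leb.-integrable setT (EFin \o (fun s => g t s * tent K s)).
Proof.
move=> t0; apply: (@integrable_frac_greenM _ _ 1) => //; first exact: measurable_tent.
by move=> s; rewrite ger0_norm ?tent_ge0 ?tent_le1.
Qed.

Lemma integrable_tent_loss K t : 0 < K -> 0 < t ->
  leb.-integrable setT (EFin \o (fun s => g t s * tent_adjoint alpha K s)).
Proof.
move=> K0 t0; apply: (@integrable_frac_greenM _ _ (step_const alpha * K `^ (- alpha))) => //.
  exact: measurable_tent_adjoint.
by move=> s; rewrite ger0_norm ?tent_adjoint_ge0 ?tent_adjoint_le.
Qed.

Lemma frac_green_dt_neg t s : 0 < t -> s < 0 -> derive1 (g ^~ s) t = 0.
Proof.
move=> t0 s0; rewrite derive1E (@near_eq_derive _ _ _ _ (cst 0)) ?derive_cst//.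
near=> u; rewrite (frac_green_one_sided gP)//; near: u.
exact: lt_nbhsr.
Unshelve. all: by end_near. Qed.

(** The time derivative is jointly continuous, hence bounded on the rectangle [a, b] x [0, K], and
    it vanishes for s < 0. This is the domination for exchanging the time and space integrals. *)
Lemma frac_green_dt_bounded a b K : 0 < a -> a <= b -> 0 <= K ->
  exists M : R, forall u s, a <= u <= b -> s <= K ->
    `|derive1 (g ^~ s) u| <= M * \1_(`[0, K]%classic : set R) s.
Proof.
move=> a00 ab K0.
pose h (z : R * R) := `|derive1 (g ^~ z.2) z.1|.
have ch : {within (`[a, b]%classic `*` `[0, K]%classic : set (R * R)), continuous h}.
  apply: continuous_in_subspaceT => z; rewrite inE => -[] /=.
  rewrite !in_itv/= => /andP[az _] _.
  have [_ c _] := frac_green_C1 gP z.2 (lt_le_trans a00 az).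
  rewrite -surjective_pairing in c.
  apply: (@continuous_comp _ _ _ (fun z : R * R => derive1 (g ^~ z.2) z.1) (fun y : R => `|y|)) => //.
  exact: norm_continuous.
have cX : compact (`[a, b]%classic `*` `[0, K]%classic : set (R * R)).
  by apply: compact_setX; exact: segment_compact.
have nX : (`[a, b]%classic `*` `[0, K]%classic : set (R * R)) !=set0.
  by exists (a, 0); split; rewrite /= in_itv/= lexx.
have [c _ Hc] := compact_EVT_max nX cX ch.
exists (h c) => u s uab sK; have [s0|s0] := ltP s 0.
  rewrite frac_green_dt_neg//; last by apply: (lt_le_trans a00); case/andP: uab.
  by rewrite normr0 mulr_ge0//; exact: normr_ge0.
rewrite indicE mem_setE in_itv/= s0 sK/= mulr1.
have := Hc (u, s); apply; rewrite inE; split; rewrite /= in_itv/= ?uab//.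
by rewrite s0 sK.
Qed.

Lemma measurable_frac_green_dt : measurable_fun
  ([set u : measurableTypeR R | 0 < u] `*` [set: measurableTypeR R])
  (fun z => derive1 (g ^~ z.2) z.1).
Proof.
apply: (@measurable_fun_continuous_pair _ (fun z => derive1 (g ^~ z.2) z.1)) => -[t s] /= t0.
by have [_ c _] := frac_green_C1 gP s t0.
Qed.

Lemma tent_frac_green_dt_le a b K : 0 < a -> a <= b -> 0 < K ->
  exists M : R, forall u s, a <= u <= b ->
    `|tent K s * derive1 (g ^~ s) u| <= \1_(`[0, K]%classic : set R) s * M.
Proof.
move=> a00 ab K0; have [M HM] := frac_green_dt_bounded a00 ab (ltW K0).
exists M => u s uab; have [sK|sK] := ltP K s.
  by rewrite tent_eq0 ?(ltW sK)// mul0r normr0 indicE mem_setE in_itv/= (leNgt s) sK andbF mul0r.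
rewrite normrM (ger0_norm (tent_ge0 _ _)) [leRHS]mulrC.
by rewrite (le_trans _ (HM _ _ uab sK))// ler_piMl ?tent_le1.
Qed.

Lemma integrable_tent_dt K t : 0 < K -> 0 < t ->
  leb.-integrable setT (EFin \o (fun s => tent K s * derive1 (g ^~ s) t)).
Proof.
move=> K0 t0; have [M HM] := tent_frac_green_dt_le t0 (lexx t) K0.
have iA : leb.-integrable setT (EFin \o (fun s => \1_(`[0, K]%classic : set R) s : R)).
  exact: integrable_indic_itv.
have iM := integrable_scale M measurableT iA.
apply: (integrable_le_dom _ _ iM) => //; last first.
  by move=> s _; rewrite [leRHS]mulrC; apply: HM; rewrite lexx.
apply: measurable_funM; first exact: measurable_tent.
apply: continuous_measurable_fun => s; have [_ c _] := frac_green_C1 gP s t0.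
have ct : cst t x @[x --> s] --> t by exact: cvg_cst.
have c2 : {for s, continuous (fun u : R => (t, u))} by exact: (cvg_pair ct cvg_id).
exact: (@continuous_comp _ _ _ (fun u : R => (t, u)) (fun z : R * R => derive1 (g ^~ z.2) z.1) s c2 c).
Qed.

(** The equation is paired with the tent, and [tent_frac_derive] moves the fractional derivative
    onto it. *)
Lemma tent_derive1 K t : 0 < K -> 0 < t ->
  \int[leb]_s (tent K s * derive1 (g ^~ s) t) = - C * tent_loss K t.
Proof.
move=> K0 t0; have [L [M [HL HM]]] := frac_green_lipschitz t0 K0.
have := @tent_frac_derive _ _ alpha01 K L M (g t) K0 (measurable_frac_green t0)
  (integrable_frac_green t0) (fun s => frac_green_ge0 gP s t0)
  (fun s => frac_green_one_sided gP t0) HL HM.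
rewrite -/(tent_loss K t) => E.
have D s : tent K s * derive1 (g ^~ s) t = C * (tent K s * \int[leb]_(tau in `]0, +oo[)
    ((g t (s - tau) - g t s) * weight alpha tau)).
  have /eqP := frac_green_equation gP s t0.
  rewrite addr_eq0 => /eqP ->; rewrite /frac_derive /C.
  rewrite (_ : \int[leb]_(tau in `]0, +oo[) ((g t (s - tau) - g t s) / tau `^ (1 + alpha)) =
    \int[leb]_(tau in `]0, +oo[) ((g t (s - tau) - g t s) * weight alpha tau)); last first.
    by apply: eq_Rintegral => tau _; rewrite /weight -opprD powRN.
  by rewrite mulNr mulNr opprK mulrCA.
have iD := integrable_tent_dt K0 t0.
have iCD := integrable_scale C^-1 measurableT iD.
have D' s : C^-1 * (tent K s * derive1 (g ^~ s) t) = tent K s * \int[leb]_(tau in `]0, +oo[)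
    ((g t (s - tau) - g t s) * weight alpha tau).
  by rewrite D mulKf// gt_eqF.
rewrite mulNr -mulrN -E.
transitivity (C * \int[leb]_s (C^-1 * (tent K s * derive1 (g ^~ s) t))).
  by rewrite (RintegralZl _ measurableT iD) mulVKf// gt_eqF.
by congr (_ * _); apply: eq_Rintegral => s _; exact: D'.
Qed.

Lemma continuous_frac_green_dt s u : 0 < u -> {for u, continuous (derive1 (g ^~ s))}.
Proof.
move=> u0; have [_ c _] := frac_green_C1 gP s u0.
have ct : cst s x @[x --> u] --> s by exact: cvg_cst.
have c2 : {for u, continuous (fun v : R => (v, s))} by exact: (cvg_pair cvg_id ct).
exact: (@continuous_comp _ _ _ (fun v : R => (v, s)) (fun z : R * R => derive1 (g ^~ z.2) z.1) u c2 c).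
Qed.

Lemma continuous_within_frac_green_dt s (t0 t : R) : 0 < t0 ->
  {within `[t0, t], continuous (derive1 (g ^~ s))}.
Proof.
move=> t00; apply: continuous_in_subspaceT => u; rewrite inE/= in_itv/= => /andP[h _].
by apply: continuous_frac_green_dt; rewrite (lt_le_trans t00).
Qed.

Lemma frac_green_increment t0 t s : 0 < t0 -> t0 < t ->
  g t s - g t0 s = \int[leb]_(u in `[t0, t]) derive1 (g ^~ s) u.
Proof.
move=> t00 t0t.
have dg u : 0 < u -> derivable (g ^~ s) u 1.
  by move=> u0; have [] := frac_green_derivable gP s u0.
have cg u : 0 < u -> {for u, continuous (g ^~ s)}.
  by move=> /dg du; exact/differentiable_continuous/derivable1_diffP.
rewrite /Rintegral (@continuous_FTC2 _ (derive1 (g ^~ s)) (g ^~ s))//.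
- exact: continuous_within_frac_green_dt.
- split.
  + by move=> u; rewrite in_itv/= => /andP[h _]; apply: dg; rewrite (lt_trans t00).
  + by apply: cvg_at_right_filter; apply: cg.
  + by apply: cvg_at_left_filter; apply: cg; rewrite (lt_trans t00).
Qed.

(** The evolution of the mass in integrated form: writing g t s - g t0 s as a time integral and
    exchanging integrals avoids differentiating under the integral sign. *)
Lemma tent_mass_increment K t0 t : 0 < K -> 0 < t0 -> t0 < t ->
  leb.-integrable `[t0, t] (EFin \o (tent_loss K)) /\
  tent_mass K t - tent_mass K t0 = - C * \int[leb]_(u in `[t0, t]) tent_loss K u.
Proof.
move=> K0 t00 t0t.
have t1 : 0 < t by rewrite (lt_trans t00).
have mI : measurable (`[t0, t]%classic : set (measurableTypeR R)) by exact: measurable_itv.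
have [M HM] := tent_frac_green_dt_le t00 (ltW t0t) K0.
have iA : leb.-integrable setT (EFin \o (fun s => \1_(`[0, K]%classic : set R) s : R)).
  exact: integrable_indic_itv.
have iB : leb.-integrable `[t0, t] (EFin \o (cst M : R -> R)).
  have iI : leb.-integrable setT (EFin \o (fun s => \1_(`[t0, t]%classic : set R) s : R)).
    exact: integrable_indic_itv.
  have := integrableS measurableT mI (@subsetT _ _) (integrable_scale M measurableT iI).
  apply: eq_integrable => // u; rewrite inE /= => tu.
  by rewrite indicE mem_set// mulr1.
have mS : measurable_fun (`[t0, t]%classic `*` setT : set (measurableTypeR R * measurableTypeR R))
    (fun z => tent K z.2 * derive1 (g ^~ z.2) z.1).
  apply: measurable_funM.
    apply: measurable_funTS.
    exact: measurableT_comp (measurable_tent K) measurable_snd.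
  apply: measurable_funS measurable_frac_green_dt.
    apply: measurableX => //.
    by rewrite (_ : [set _ | _] = `]0, +oo[%classic); [exact: measurable_itv|rewrite set_itvoy].
  by move=> z [/=]; rewrite in_itv/= => /andP[h _] _; split => //=; rewrite (lt_le_trans t00).
have dom (u s : R) : `[t0, t]%classic u -> setT s ->
    `|tent K s * derive1 (g ^~ s) u| <= cst M u * \1_(`[0, K]%classic : set R) s.
  by move=> tu _; rewrite [leRHS]mulrC; apply: HM; move: tu; rewrite /= in_itv.
have E u : u \in `[t0, t]%classic ->
    \int[leb]_s (tent K s * derive1 (g ^~ s) u) = - C * tent_loss K u.
  rewrite inE/= in_itv/= => /andP[h _]; apply: tent_derive1 => //.
  by rewrite (lt_le_trans t00).
have iJ : leb.-integrable `[t0, t] (EFin \o (fun u => - C * tent_loss K u)).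
  have := @integrable_Rintegral_dom _ _ _ _ _ leb leb (`[t0, t]%classic : set (measurableTypeR R)) setT
    (fun u s => tent K s * derive1 (g ^~ s) u) (cst M) (\1_(`[0, K]%classic : set R))
    mI measurableT mS iB iA dom.
  by apply: eq_integrable => // u tu /=; rewrite E.
have iJ' : leb.-integrable `[t0, t] (EFin \o (tent_loss K)).
  have := integrable_scale (- C^-1) mI iJ.
  by apply: eq_integrable => // u _ /=; rewrite mulNr mulNr mulrN opprK mulKf ?gt_eqF.
split => //; rewrite -(RintegralZl _ mI iJ').
transitivity (\int[leb]_(u in `[t0, t]) \int[leb]_s (tent K s * derive1 (g ^~ s) u)); last first.
  by apply: eq_Rintegral => u tu; rewrite E.
rewrite (@Rintegral_swap_dom _ _ _ _ _ leb leb (`[t0, t]%classic : set (measurableTypeR R)) setT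
    (fun u s => tent K s * derive1 (g ^~ s) u) (cst M) (\1_(`[0, K]%classic : set R)))//.
rewrite /tent_mass -RintegralB//; last 2 first.
- exact: integrable_tent_mass.
- exact: integrable_tent_mass.
apply: eq_Rintegral => s _.
rewrite RintegralZl//; last first.
  apply: continuous_compact_integrable; first exact: segment_compact.
  exact: continuous_within_frac_green_dt.
by rewrite -frac_green_increment// mulrBr ![tent K s * _]mulrC.
Qed.

Let kappa : R := C * step_const alpha.

Let kappa_gt0 : 0 < kappa. Proof. by rewrite mulr_gt0// step_const_gt0. Qed.

Lemma tent_loss_ge0 K t : 0 < K -> 0 < t -> 0 <= tent_loss K t.
Proof.
move=> K0 t0; apply: Rintegral_ge0 => s _.
by rewrite mulr_ge0 ?tent_adjoint_ge0// (frac_green_ge0 gP).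
Qed.

Lemma tent_loss_le K t : 0 < K -> 0 < t ->
  tent_loss K t <= step_const alpha * K `^ (- alpha).
Proof.
move=> K0 t0; have ig := integrable_frac_green t0.
rewrite -[leRHS]mulr1 -(Rintegral_frac_green t0) -(RintegralZl _ measurableT ig).
apply: le_Rintegral => //.
- exact: integrable_tent_loss.
- exact: (integrable_scale _ measurableT ig).
by move=> s _; rewrite mulrC ler_wpM2r ?tent_adjoint_le// (frac_green_ge0 gP).
Qed.

Lemma tent_loss_lower K t : 0 < K -> 0 < t ->
  step_const alpha * K `^ (- alpha) * tent_mass K t <= tent_loss K t.
Proof.
move=> K0 t0; have ig := integrable_tent_mass K t0.
rewrite -(RintegralZl _ measurableT ig).
apply: le_Rintegral => //.
- exact: (integrable_scale _ measurableT ig).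
- exact: integrable_tent_loss.
move=> s _; have [s0|s0] := ltP s 0.
  by rewrite (frac_green_one_sided gP)// !mul0r mulr0.
by rewrite mulrCA ler_wpM2l ?tent_adjoint_lower// (frac_green_ge0 gP).
Qed.

Lemma tent_mass_ge0 K t : 0 < t -> 0 <= tent_mass K t.
Proof.
by move=> t0; apply: Rintegral_ge0 => s _; rewrite mulr_ge0 ?tent_ge0// (frac_green_ge0 gP).
Qed.

Lemma tent_mass_le1 K t : 0 < t -> tent_mass K t <= 1.
Proof.
move=> t0; rewrite -(Rintegral_frac_green t0); apply: le_Rintegral => //.
- exact: integrable_tent_mass.
- exact: integrable_frac_green.
by move=> s _; rewrite ler_piMr ?tent_le1// (frac_green_ge0 gP).
Qed.

Lemma tent_mass_nonincreasing K t0 t : 0 < K -> 0 < t0 -> t0 < t ->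
  tent_mass K t <= tent_mass K t0.
Proof.
move=> K0 t00 t0t; have [iJ E] := tent_mass_increment K0 t00 t0t.
rewrite -subr_le0 E mulNr oppr_le0 mulr_ge0 ?(ltW C0)//.
apply: Rintegral_ge0 => u /=; rewrite in_itv/= => /andP[h _].
by rewrite tent_loss_ge0// (lt_le_trans t00).
Qed.

Lemma Rintegral_segment_cst (a b c : R) : a < b ->
  leb.-integrable `[a, b] (EFin \o (cst c : R -> R)) /\
  \int[leb]_(u in `[a, b]) c = c * (b - a).
Proof.
move=> ab; split; last first.
  rewrite Rintegral_cst//; congr (_ * _).
  apply: (@etrans _ _ (fine (b - a)%:E)) => //; congr fine.
  by have := @lebesgue_measure_itv R `[a, b]; rewrite /= lte_fin ab.
apply: continuous_compact_integrable; first exact: segment_compact.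
by apply: continuous_subspaceT; exact: cst_continuous.
Qed.

(** The rate of decrease is at most kappa K^(-alpha), because the adjoint of the tent has that order
    and [g] has mass 1. *)
Lemma tent_mass_decrease_le K t0 t : 0 < K -> 0 < t0 -> t0 < t ->
  tent_mass K t0 - kappa * K `^ (- alpha) * (t - t0) <= tent_mass K t.
Proof.
move=> K0 t00 t0t; have [iJ E] := tent_mass_increment K0 t00 t0t.
have [ic Ec] := Rintegral_segment_cst (step_const alpha * K `^ (- alpha)) t0t.
have h : \int[leb]_(u in `[t0, t]) tent_loss K u <=
    step_const alpha * K `^ (- alpha) * (t - t0).
  rewrite -Ec; apply: le_Rintegral => // u /=; rewrite in_itv/= => /andP[h _].
  exact: tent_loss_le K0 (lt_le_trans t00 h).
have := ler_wpM2l (ltW C0) h; rewrite /kappa.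
by move: E; rewrite mulNr -!mulrA => E; lra.
Qed.

(** The mass decreases in time, so on [t0, t] the loss is at least the one computed from the final
    mass. This is an implicit Euler step for y' <= - kappa K^(-alpha) y and replaces an exponential
    bound. *)
Lemma tent_mass_decrease_ge K t0 t : 0 < K -> 0 < t0 -> t0 < t ->
  tent_mass K t * (1 + kappa * K `^ (- alpha) * (t - t0)) <= tent_mass K t0.
Proof.
move=> K0 t00 t0t; have [iJ E] := tent_mass_increment K0 t00 t0t.
have [ic Ec] := Rintegral_segment_cst
  (step_const alpha * K `^ (- alpha) * tent_mass K t) t0t.
have h : step_const alpha * K `^ (- alpha) * tent_mass K t * (t - t0) <=
    \int[leb]_(u in `[t0, t]) tent_loss K u.
  rewrite -Ec; apply: le_Rintegral => // u /=; rewrite in_itv/= => /andP[h1 h2].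
  have u0 : 0 < u by rewrite (lt_le_trans t00).
  apply: (le_trans _ (tent_loss_lower K0 u0)).
  rewrite ler_wpM2l ?mulr_ge0 ?powR_ge0 ?(ltW (step_const_gt0 alpha01))//.
  move: h2; rewrite le_eqVlt => /predU1P[->//|ut].
  exact: tent_mass_nonincreasing.
have := ler_wpM2l (ltW C0) h; rewrite /kappa.
move: E; rewrite mulNr => E F.
rewrite mulrDr mulr1; rewrite (_ : tent_mass K t * _ =
  C * (step_const alpha * K `^ (- alpha) * tent_mass K t * (t - t0))); last by ring.
by lra.
Qed.

(** The section-local constant under a name usable outside; it depends on alpha alone. *)
Definition tent_rate : R := kappa.

Lemma tent_rate_gt0 : 0 < tent_rate. Proof. exact: kappa_gt0. Qed.

(** The decrease between a small time t and 1 is at most kappa K^(-alpha), and as t -> 0+ the mass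
    tends to tent K 0 = 1 by the initial condition. *)
Lemma tent_mass1_lower K : 0 < K -> 1 - tent_rate * K `^ (- alpha) <= tent_mass K 1.
Proof.
move=> K0.
have := @frac_green_initial _ _ _ gP (tent K) (@continuous_tent _ K).
have h1 : exists M : R, forall s, `|tent K s| <= M.
  by exists 1 => s; rewrite ger0_norm ?tent_ge0 ?tent_le1.
move=> /(_ h1); rewrite tent0 => cI.
have cI2 : tent_mass K t - tent_rate * K `^ (- alpha) @[t --> 0^'+] -->
    1 - tent_rate * K `^ (- alpha).
  by apply: cvgB => //; exact: cvg_cst.
apply: (cvgr_to_le cI2).
near=> t.
have t0 : 0 < t by near: t; exact: nbhs_right_gt.
have t1 : t < 1 by near: t; exact: nbhs_right_lt.
apply: (le_trans _ (tent_mass_decrease_le K0 t0 t1)).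
rewrite lerB// ler_piMr ?gerBl ?(ltW t0)//.
by rewrite mulr_ge0 ?powR_ge0// ltW ?tent_rate_gt0.
Unshelve. all: by end_near. Qed.

(** Two Euler steps, from 1/3 to 2/3 and from 2/3 to 1, starting from a mass of at most 1. One step
    would give only O(K^alpha) as K -> 0, which in the moment of order -alpha leaves the divergent
    integral of 1/K. *)
Lemma tent_mass1_upper K : 0 < K ->
  tent_mass K 1 * (1 + tent_rate * K `^ (- alpha) / 3) ^+ 2 <= 1.
Proof.
move=> K0.
have t1 : 0 < 3^-1 :> R by rewrite invr_gt0.
have t2 : 0 < 2 / 3 :> R by lra.
have t12 : 3^-1 < 2 / 3 :> R by lra.
have t23 : 2 / 3 < 1 :> R by lra.
have h1 := tent_mass_decrease_ge K0 t1 t12.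
have h2 := tent_mass_decrease_ge K0 t2 t23.
have h3 := tent_mass_le1 K t1.
move: h1 h2; rewrite (_ : 2 / 3 - 3^-1 = 3^-1 :> R); last by lra.
rewrite (_ : 1 - 2 / 3 = 3^-1 :> R); last by lra.
rewrite -/tent_rate => h1 h2.
apply: le_trans h3; apply: le_trans h1; rewrite expr2 mulrA ler_wpM2r//.
by rewrite addr_ge0// mulr_ge0// mulr_ge0 ?powR_ge0// ltW ?tent_rate_gt0.
Qed.

End stable_evolution.

(** * Moments of the stable density *)

Section moments.
Context {R : realType}.
Local Notation leb := (@lebesgue_measure R).

(* Tonelli: the weight [s^e] is dominated by an average over [K] of [q K s]. *)
Lemma moment_lty (f : R -> R) (q : R -> R -> R) (e a b : R) :
  measurable_fun setT f -> (forall s, 0 <= f s) ->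
  measurable_fun setT (fun z : measurableTypeR R * measurableTypeR R => q z.1 z.2) ->
  (forall K s, 0 <= q K s) ->
  e != 0 -> 0 < a -> a < b -> 0 < e^-1 * (b `^ e - a `^ e) ->
  (forall K s, 0 < s -> a * s <= K <= b * s -> 2^-1 <= q K s) ->
  (\int[leb]_(K in `]0%R, +oo[) ((K `^ (e - 1))%:E * \int[leb]_s (f s * q K s)%:E) < +oo)%E ->
  (\int[leb]_(s in `]0%R, +oo[) (f s * s `^ e)%:E < +oo)%E.
Proof.
move=> mf f0 mq q0 e0 a0 ab c0 hq fin.
have mI : measurable (`]0, +oo[%classic : set (measurableTypeR R)) by exact: measurable_itv.
have b0 : 0 < b by rewrite (lt_trans a0).
set c := e^-1 * (b `^ e - a `^ e) in c0.
pose w (K : R) : R := \1_(`]0, +oo[%classic : set R) K * K `^ (e - 1).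
have mw : measurable_fun setT w.
  apply: measurable_funM; last exact: measurable_powR.
  exact: measurable_indic.
have w0 K : 0 <= w K by rewrite mulr_ge0 ?powR_ge0// indicE.
pose F (z : measurableTypeR R * measurableTypeR R) : \bar R := (w z.1 * (f z.2 * q z.1 z.2))%:E.
have mF : measurable_fun setT F.
  apply/measurable_EFinP; apply: measurable_funM.
    exact: measurableT_comp mw measurable_fst.
  by apply: measurable_funM => //; exact: measurableT_comp mf measurable_snd.
have F0 z : (0 <= F z)%E by rewrite lee_fin; apply: mulr_ge0 => //; exact: mulr_ge0.
have tonelli := @fubini_tonelli _ _ _ _ _ leb leb F mF F0.
have mfq K : measurable_fun setT (fun s => (f s * q K s)%:E).
  apply/measurable_EFinP; apply: measurable_funM => //.
  exact: (measurableT_comp mq (pair1_measurable K)).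
have EL : (\int[leb]_K \int[leb]_s F (K, s) =
    \int[leb]_(K in `]0%R, +oo[) ((K `^ (e - 1))%:E * \int[leb]_s (f s * q K s)%:E))%E.
  rewrite [RHS]integral_mkcond; apply: eq_integral => K _; rewrite /patch.
  have -> : (\int[leb]_s F (K, s) = (w K)%:E * \int[leb]_s (f s * q K s)%:E)%E.
    transitivity (\int[leb]_s ((w K)%:E * (f s * q K s)%:E))%E.
      by apply: eq_integral => s _; rewrite /F -EFinM.
    have nn s : setT s -> (0 <= (f s * q K s)%:E)%E by rewrite lee_fin mulr_ge0.
    exact: (@ge0_integralZl_EFin _ _ _ leb setT measurableT _ nn (mfq K) (w K) (w0 K)).
  rewrite /w indicE; case: ifPn => h; first by rewrite mul1r.
  by rewrite mul0r mul0e.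
rewrite -EL tonelli in fin.
have key : ((c / 2)%:E * \int[leb]_(s in `]0%R, +oo[) (f s * s `^ e)%:E < +oo)%E.
  apply: le_lt_trans fin.
  have mfe : measurable_fun (`]0, +oo[ : set R) (fun s => (f s * s `^ e)%:E).
    by apply/measurable_EFinP; apply: measurable_funTS; apply: measurable_funM.
  rewrite -ge0_integralZl_EFin//; last 2 first.
  - by move=> s _; rewrite lee_fin mulr_ge0 ?powR_ge0.
  - by rewrite divr_ge0// ltW.
  have mG : measurable_fun setT (fun s => \int[leb]_K F (K, s))%E.
    exact: measurable_fun_fubini_tonelli_G.
  apply: (@le_trans _ _ (\int[leb]_(s in `]0%R, +oo[) \int[leb]_K F (K, s))%E); last first.
    apply: ge0_subset_integral => //.
    by move=> s _; apply: integral_ge0.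
  apply: ge0_le_integral => //.
  - move=> s _; rewrite -EFinM lee_fin mulr_ge0 ?divr_ge0 ?(ltW c0)//.
    by rewrite mulr_ge0 ?powR_ge0.
  - apply/measurable_EFinP; apply: measurable_funM => //.
    by apply/measurable_EFinP.
  - exact: measurable_funTS.
  move=> s; rewrite /= in_itv/= andbT => s0.
  have mJ : measurable (`[a * s, b * s]%classic : set (measurableTypeR R)) by exact: measurable_itv.
  have mFs : measurable_fun setT (fun K => F (K, s)).
    exact: (measurableT_comp mF (pair2_measurable s)).
  (* Only K in [a s, b s] is kept: there q >= 1/2, and the integral of K^(e-1) over this segment is
     c s^e. *)
  apply: (@le_trans _ _ (\int[leb]_(K in `[(a * s)%R, (b * s)%R]) F (K, s))%E); last first.
    by apply: ge0_subset_integral.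
  have mp (D : set R) : measurable_fun D (fun K : R => (K `^ (e - 1))%:E).
    by apply: measurable_funTS; apply/measurable_EFinP; exact: measurable_powR.
  apply: (@le_trans _ _ (\int[leb]_(K in `[(a * s)%R, (b * s)%R]) ((f s / 2)%:E * (K `^ (e - 1))%:E))%E).
    rewrite ge0_integralZl_EFin//; last 3 first.
    - by move=> K _; rewrite lee_fin powR_ge0.
    - exact: mp.
    - by rewrite divr_ge0.
    rewrite integral_powR_segment ?mulr_gt0 ?ltr_pM2r// -EFinM lee_fin.
    rewrite !powRM ?(ltW a0) ?(ltW b0) ?(ltW s0)// /c.
    by rewrite le_eqVlt; apply/orP; left; apply/eqP; field.
  apply: ge0_le_integral => //.
  - by move=> K _; rewrite -EFinM lee_fin mulr_ge0 ?divr_ge0 ?powR_ge0.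
  - by apply: emeasurable_funM => //; exact: mp.
  - exact: measurable_funTS.
  move=> K; rewrite /= in_itv/= => Ks.
  have K0 : 0 < K by case/andP: Ks => h _; rewrite (lt_le_trans _ h)// mulr_gt0.
  rewrite -EFinM lee_fin /F/= /w indicE mem_set/= ?in_itv/= ?K0// mul1r.
  rewrite mulrC ler_wpM2l ?powR_ge0// ler_wpM2l//.
  exact: hq.
have [i|i] := eqVneq (\int[leb]_(s in `]0%R, +oo[) (f s * s `^ e)%:E)%E +oo%E.
  by move: key; rewrite i gt0_muley// lte_fin divr_gt0.
by rewrite ltey.
Qed.

End moments.

Section stable_moments.
Context {R : realType}.
Local Notation leb := (@lebesgue_measure R).
Variables (alpha : R) (g : R -> R -> R).
Hypothesis alpha01 : 0 < alpha < 1.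
Hypothesis gP : is_frac_green alpha g.

Let a0 : 0 < alpha. Proof. by case/andP: alpha01. Qed.
Let a1 : alpha < 1. Proof. by case/andP: alpha01. Qed.

Let f := g 1.

Let f0 s : 0 <= f s. Proof. exact: (frac_green_ge0 gP). Qed.

Let mf : measurable_fun setT f. Proof. exact: (measurable_frac_green gP). Qed.

Let kappa : R := tent_rate alpha.

Let kappa_gt0 : 0 < kappa. Proof. exact: tent_rate_gt0. Qed.

(** With 1/K written as a power, joint measurability in (K, s) follows from that of [powR]; for K >
    0 this is the tent. *)
Let tentq (K s : R) : R := Num.min 1 (Num.max (1 - s * K `^ (- 1)) 0).

Let tentqE K s : 0 < K -> tentq K s = tent K s.
Proof. by move=> K0; rewrite /tentq powR_inv1// ltW. Qed.

Let mtentq : measurable_fun setT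
  (fun z : measurableTypeR R * measurableTypeR R => tentq z.1 z.2).
Proof.
apply: measurable_minr => //; apply: measurable_maxr => //.
apply: measurable_funB => //; apply: measurable_funM; first exact: measurable_snd.
exact: measurableT_comp (measurable_powR _) measurable_fst.
Qed.

Let tentq_ge0 K s : 0 <= tentq K s.
Proof. by rewrite le_min ler01 le_max lexx orbT. Qed.

Let tentq_le1 K s : tentq K s <= 1.
Proof. by rewrite ge_min lexx. Qed.

Let ifq K : leb.-integrable setT (EFin \o (fun s => f s * tentq K s)).
Proof.
apply: (integrable_frac_greenM gP (M := 1)) => //.
  exact: (measurableT_comp mtentq (pair1_measurable K)).
by move=> s; rewrite ger0_norm.
Qed.

Let intf : leb.-integrable setT (EFin \o f).
Proof. exact: (integrable_frac_green gP). Qed.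

Let I K := tent_mass g K 1.

Let IE K : 0 < K -> (\int[leb]_s (f s * tentq K s)%:E = (I K)%:E)%E.
Proof.
move=> K0; rewrite /I /tent_mass Rintegral_EFin//; last exact: (integrable_tent_mass gP).
by apply: eq_integral => s _; rewrite tentqE.
Qed.

Let mI : measurable (`]0, +oo[%classic : set (measurableTypeR R)).
Proof. exact: measurable_itv. Qed.

Let measurable_I : measurable_fun (`]0, +oo[ : set R) I.
Proof.
apply: (@eq_measurable_fun _ _ _ _ _ (fun K => \int[leb]_s (f s * tentq K s))).
  move=> K; rewrite inE/= in_itv/= andbT => K0.
  by rewrite /Rintegral IE.
apply: measurable_funTS.
apply: (@measurable_Rintegral_param _ _ _ _ _ leb setT (fun K s => f s * tentq K s)) => //.
by apply: measurable_funM => //; exact: measurableT_comp mf measurable_snd.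
Qed.

Let I_ge0 K : 0 <= I K. Proof. exact: (tent_mass_ge0 gP). Qed.

Let I_le1 K : I K <= 1. Proof. exact: (tent_mass_le1 gP). Qed.

(** For K in [2s, 3s] the tent at s is at least 1/2, so [moment_lty] reduces the claim to the
    integral of K^(-alpha-1) times the tent mass. At infinity the mass is at most 1; at 0 it is
    O(K^(2 alpha)), leaving K^(alpha-1). *)
Lemma moment_neg_lty : (\int[leb]_(s in `]0%R, +oo[) (f s * s `^ (- alpha))%:E < +oo)%E.
Proof.
apply: (@moment_lty _ f tentq (- alpha) 2 3) => //.
- by rewrite oppr_eq0 gt_eqF.
- by rewrite ltr_nat.
- rewrite invrN mulNr -mulrN opprB mulr_gt0 ?invr_gt0// subr_gt0 !powRN.
  by rewrite ltf_pV2 ?posrE ?powR_gt0// gt0_ltr_powR ?nnegrE//; lra.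
- move=> K s s0 /andP[h1 h2]; have K0 : 0 < K by lra.
  rewrite tentqE// tentE ?(ltW s0)// lerBrDl -lerBrDr.
  rewrite ge_min ler_pdivrMr//; apply/orP; left; lra.
have i : leb.-integrable `]0, +oo[ (EFin \o (fun K => K `^ (- alpha - 1) * I K)).
  (* 9/kappa^2 comes from keeping only (kappa x/3)^2 of the square in [tent_mass1_upper], with x =
     K^(-alpha). *)
  apply: (@integrable_powR_mix _ (1 - alpha) (1 + alpha) (1 + 9 / kappa ^+ 2)).
  - by rewrite gtrBl.
  - by rewrite ltrDl.
  - apply: measurable_funM => //; apply: measurable_funTS; exact: measurable_powR.
  - move=> K K0 K1; rewrite ger0_norm ?mulr_ge0 ?powR_ge0//.
    have h := tent_mass1_upper alpha01 gP K0.
    rewrite -/kappa -/(I K) in h.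
    set x := K `^ (- alpha) in h.
    have x0 : 0 < x by exact: powR_gt0.
    have kx : 0 < kappa * x by rewrite mulr_gt0.
    have E : K `^ (- (1 - alpha)) = K `^ (- alpha - 1) * x ^- 2.
      rewrite /x -powR_mulrn ?powR_ge0// -powRrM -powRN -powRD; last by rewrite (gt_eqF K0) implybT.
      by congr (_ `^ _); ring.
    rewrite E mulrCA ler_wpM2l ?powR_ge0// ler_pdivlMr ?exprn_gt0//.
    apply: (@le_trans _ _ (9 / kappa ^+ 2)); last by rewrite lerDr.
    rewrite ler_pdivlMr ?exprn_gt0//.
    have : I K * (kappa * x / 3) ^+ 2 <= 1.
      apply: (le_trans _ h); rewrite ler_wpM2l// lerXn2r ?nnegrE; lra.
    move: (I K) => y; nra.
  - move=> K K1; rewrite ger0_norm ?mulr_ge0 ?powR_ge0//.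
    rewrite (_ : - (1 + alpha) = - alpha - 1); last by ring.
    apply: (@le_trans _ _ (K `^ (- alpha - 1))).
      by rewrite ler_piMr ?powR_ge0.
    by rewrite ler_peMl ?powR_ge0// lerDl divr_ge0// exprn_ge0// ltW.
have /integrableP[_] := i; apply: le_lt_trans.
rewrite le_eqVlt; apply/orP; left; apply/eqP/eq_integral => K; rewrite inE/= in_itv/= andbT => K0.
by rewrite IE// -EFinM ger0_norm ?mulr_ge0 ?powR_ge0.
Qed.

(** The complementary argument: 1 - tent is at least 1/2 for K in [s, 2s]. Its mass is at most 1
    near 0, where e > 0 is used, and at most kappa K^(-alpha) at infinity, which is integrable
    against K^(e-1) because e < alpha. *)
Lemma moment_pos_lty (e : R) : 0 < e < alpha ->
  (\int[leb]_(s in `]0%R, +oo[) (f s * s `^ e)%:E < +oo)%E.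
Proof.
move=> /andP[e0 ea].
apply: (@moment_lty _ f (fun K s => 1 - tentq K s) e 1 2) => //.
- exact: measurable_funB.
- by move=> K s; rewrite subr_ge0.
- by rewrite gt_eqF.
- by rewrite ltr1n.
- by rewrite mulr_gt0 ?invr_gt0// subr_gt0 gt0_ltr_powR ?nnegrE// ltr1n.
- move=> K s s0 /andP[h1 h2]; have K0 : 0 < K by lra.
  rewrite tentqE// tentE ?(ltW s0)// opprB addrCA subrr addr0.
  by rewrite le_min ler_pdivlMr//; apply/andP; split; lra.
have i : leb.-integrable `]0, +oo[ (EFin \o (fun K => K `^ (e - 1) * (1 - I K))).
  apply: (@integrable_powR_mix _ (1 - e) (1 - e + alpha) (1 + kappa)).
  - by rewrite gtrBl.
  - by lra.
  - apply: measurable_funM; first by apply: measurable_funTS; exact: measurable_powR.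
    exact: measurable_funB.
  - move=> K K0 K1; rewrite ger0_norm ?mulr_ge0 ?powR_ge0 ?subr_ge0//.
    rewrite opprB mulrC ler_wpM2r ?powR_ge0//.
    by have := I_ge0 K; have := kappa_gt0; lra.
  - move=> K K1; rewrite ger0_norm ?mulr_ge0 ?powR_ge0 ?subr_ge0//.
    have K0 : 0 < K by rewrite (lt_le_trans ltr01).
    have h := tent_mass1_lower alpha01 gP K0.
    rewrite -/kappa -/(I K) in h.
    rewrite (_ : - (1 - e + alpha) = (e - 1) + - alpha); last by ring.
    rewrite [X in _ <= _ * X]powRD ?(gt_eqF K0) ?implybT// mulrCA ler_wpM2l ?powR_ge0//.
    have := powR_ge0 K (- alpha); move: h; move: (_ `^ _) (I K) => x y; lra.
have /integrableP[_] := i; apply: le_lt_trans.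
rewrite le_eqVlt; apply/orP; left; apply/eqP/eq_integral => K; rewrite inE/= in_itv/= andbT => K0.
rewrite ger0_norm ?mulr_ge0 ?powR_ge0 ?subr_ge0// EFinM; congr (_ * _)%E.
have -> : (fun s => (f s * (1 - tentq K s))%:E) =
    (fun s => (f s)%:E - (f s * tentq K s)%:E)%E.
  by apply/funext => s; rewrite mulrBr mulr1.
rewrite (integralB_EFin measurableT intf (ifq K)).
by rewrite IE// (frac_green_mass gP).
Qed.

End stable_moments.

Lemma powR_lt1 {R : realType} (x r : R) : 0 <= x -> x < 1 -> 0 < r -> x `^ r < 1.
Proof.
move=> x0 x1 r0; have := gt0_ltr_powR r0 _ _ x1.
by rewrite powR1; apply; rewrite nnegrE.
Qed.

Lemma powR_le1 {R : realType} (x r : R) : 0 <= x -> x <= 1 -> 0 <= r -> x `^ r <= 1.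
Proof.
move=> x0 x1 r0; have := ge0_ler_powR r0 _ _ x1.
by rewrite powR1; apply; rewrite nnegrE.
Qed.

(** * Tail of the stable density and the mixing weight *)

Section stable_mixing.
Context {R : realType}.
Local Notation leb := (@lebesgue_measure R).
Variables (alpha : R) (g : R -> R -> R).
Hypothesis alpha01 : 0 < alpha < 1.
Hypothesis gP : is_frac_green alpha g.

Let a0 : 0 < alpha. Proof. by case/andP: alpha01. Qed.
Let a1 : alpha < 1. Proof. by case/andP: alpha01. Qed.

Let f := g 1.

Let f0 s : 0 <= f s. Proof. exact: (frac_green_ge0 gP). Qed.

Let mf : measurable_fun setT f. Proof. exact: (measurable_frac_green gP). Qed.

Let kappa : R := tent_rate alpha.

Let kappa_gt0 : 0 < kappa. Proof. exact: tent_rate_gt0. Qed.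

(** A smoothed tail probability: for s >= 0 the second factor is min(s/K, 1). *)
Let T K := \int[leb]_s (f s * (1 - tent K s)).

Let iT K : leb.-integrable setT (EFin \o (fun s => f s * (1 - tent K s))).
Proof.
apply: (integrable_frac_greenM gP (M := 1)) => //.
  by apply: measurable_funB => //; exact: measurable_tent.
by move=> s; rewrite ger0_norm ?subr_ge0 ?tent_le1// gerBl tent_ge0.
Qed.

Let TE K : T K = 1 - tent_mass g K 1.
Proof.
have i1 := integrable_frac_green gP ltr01.
have i2 := integrable_tent_mass gP K ltr01.
rewrite /T -[X in _ = X - _](Rintegral_frac_green gP ltr01) /tent_mass -RintegralB//.
by apply: eq_Rintegral => s _; rewrite mulrBr mulr1.
Qed.

Let T_le K : 0 < K -> T K <= kappa * K `^ (- alpha).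
Proof.
move=> K0; have := tent_mass1_lower alpha01 gP K0; rewrite TE -/kappa.
by move: (_ `^ _) (tent_mass _ _ _) => x y; lra.
Qed.

(** With x = K^(-alpha) <= 1, the tent mass is at most 1/(1 + kappa x/3), which leaves a tail of at
    least (kappa x/3)/(1 + kappa x/3) >= c x. *)
Let c : R := kappa / 3 / (1 + kappa / 3).

Let c_gt0 : 0 < c.
Proof. by rewrite !divr_gt0// addr_gt0// divr_gt0. Qed.

Let T_ge K : 1 <= K -> c * K `^ (- alpha) <= T K.
Proof.
move=> K1; have K0 : 0 < K by rewrite (lt_le_trans ltr01).
have := tent_mass1_upper alpha01 gP K0; have := tent_mass_ge0 gP K ltr01.
rewrite TE -/kappa /c.
have x1 : K `^ (- alpha) <= 1.
  by rewrite -(powRr0 K) ler_powR// oppr_le0 ltW.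
have := powR_ge0 K (- alpha); move: x1.
move: (_ `^ _) (tent_mass _ _ _) => x y x1 x0 y0 h.
have kx0 : 0 <= kappa * x by rewrite mulr_ge0// ltW.
have kx1 : kappa * x <= kappa by rewrite ler_piMr// ltW.
have k3 : 0 < 1 + kappa / 3 by have := kappa_gt0; lra.
rewrite mulrAC ler_pdivrMr// mulrAC.
have h1 : y * (1 + kappa * x / 3) <= 1.
  apply: le_trans h; rewrite ler_wpM2l// expr2 ler_peMr//; lra.
by nra.
Qed.

Let split_bound (C P x y z w : R) : x <= P + (y + z) -> C * w <= x ->
  y <= C / 4 * w -> z <= C / 4 * w -> C / 2 * w <= P.
Proof. by move=> h1 h2 h3 h4; lra. Qed.

(** On s >= 0, min(s/K, 1) is at most the indicator of [kK, lK] plus k min(s/(kK), 1) plus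
    min(s/(lK), 1). The last two integrate to at most kappa k^(1-alpha) K^(-alpha) and kappa
    l^(-alpha) K^(-alpha), which are small for small k, because alpha < 1, and for large l. The rest
    of the tail sits in the segment. *)
Lemma stable_tail : exists k l e : R, [/\ 0 < k, k < l, 0 < e &
  forall K, 1 <= K -> ((e * K `^ (- alpha))%:E <=
    \int[leb]_(s in `[(k * K)%R, (l * K)%R]) (f s)%:E)%E].
Proof.
have ck0 : 0 < c / (4 * kappa) by rewrite divr_gt0// mulr_gt0.
have ck1 : c / (4 * kappa) < 1.
  have kg := kappa_gt0; rewrite ltr_pdivrMr; last by rewrite mulr_gt0.
  have : c <= kappa / 3 by rewrite ler_pdivrMr; [nra|lra].
  by lra.
(* Chosen so that k^(1-alpha) and l^(-alpha) both equal c/(4 kappa): each correction is then at most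
   (c/4) K^(-alpha), and c/2 remains out of c. *)
pose k := (c / (4 * kappa)) `^ (1 - alpha)^-1.
pose l := (c / (4 * kappa)) `^ (- alpha^-1).
have k0 : 0 < k by exact: powR_gt0.
have a1' : 0 < 1 - alpha by rewrite subr_gt0.
have k1 : k < 1.
  by apply: powR_lt1; rewrite ?invr_gt0// ltW.
have l1 : 1 < l.
  rewrite /l powRN invf_gt1 ?powR_gt0//.
  by apply: powR_lt1; rewrite ?invr_gt0// ltW.
have l0 : 0 < l by rewrite (lt_trans ltr01).
have kE : k `^ (1 - alpha) = c / (4 * kappa).
  by rewrite /k -powRrM mulVf ?gt_eqF// powRr1 ?ltW.
have lE : l `^ (- alpha) = c / (4 * kappa).
  by rewrite /l -powRrM mulrNN mulVf ?gt_eqF// powRr1 ?ltW.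
exists k, l, (c / 2); split => //; [exact: lt_trans l1|by rewrite divr_gt0|].
move=> K K1; have K0 : 0 < K by rewrite (lt_le_trans ltr01).
have mJ : measurable (`[k * K, l * K]%classic : set (measurableTypeR R)) by exact: measurable_itv.
pose J (s : R) : R := \1_(`[k * K, l * K]%classic : set R) s.
have iJ : leb.-integrable setT (EFin \o (fun s => f s * J s)).
  apply: (integrable_frac_greenM gP (M := 1)) => //; first exact: measurable_indic.
  by move=> s; rewrite /J indicE; case: (_ \in _); rewrite ?normr1 ?normr0.
have -> : (\int[leb]_(s in `[(k * K)%R, (l * K)%R]) (f s)%:E = (\int[leb]_s (f s * J s))%:E)%E.
  rewrite (Rintegral_EFin measurableT iJ) [LHS]integral_mkcond; apply: eq_integral => s _.
  by rewrite /patch /J indicE; case: (_ \in _); rewrite ?mulr1 ?mulr0.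
have i2 := integrable_scale k measurableT (iT (k * K)).
have i3 := iT (l * K).
have i23 := integrable_add measurableT i2 i3.
have h : T K <= \int[leb]_s (f s * J s) + (k * T (k * K) + T (l * K)).
  rewrite /T -(RintegralZl _ measurableT (iT (k * K))) -(RintegralD measurableT i2 i3).
  rewrite -(RintegralD measurableT iJ i23).
  apply: le_Rintegral => //; first exact: integrable_add.
  move=> s _ /=; have [s0|s0] := ltP s 0.
    by rewrite {1 2 3 4}/f (frac_green_one_sided gP)// !mul0r mulr0 !addr0.
  rewrite [k * _]mulrCA -!mulrDr ler_wpM2l//.
  rewrite !tentE ?mulr_gt0// !opprB ![1 + _]addrC !subrK minr_pMr ?(ltW k0)// mulr1.
  have -> : k * (s / (k * K)) = s / K by field; rewrite !gt_eqF.
  have x0 : 0 <= s / K by rewrite divr_ge0// ltW.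
  have y0 : 0 <= s / (l * K) by rewrite divr_ge0// ltW// mulr_gt0.
  have m0 x y : 0 <= x -> 0 <= y -> 0 <= Num.min x y :> R by rewrite le_min => -> ->.
  have J0 : 0 <= J s by rewrite /J indicE.
  have [sk|sk] := ltP s (k * K).
    rewrite [Num.min _ k]min_l; last by rewrite ler_pdivrMr// ltW.
    rewrite (le_trans (_ : _ <= s / K)) ?ge_min ?lexx//.
    by rewrite addrCA lerDl addr_ge0// m0.
  have [sl|sl] := leP s (l * K).
    have -> : J s = 1 by rewrite /J indicE mem_set//= in_itv/= sk sl.
    by rewrite (le_trans (_ : _ <= 1)) ?ge_min ?lexx ?orbT// lerDl addr_ge0// m0// ltW.
  rewrite [Num.min (s / (l * K)) 1]min_r; last by rewrite ler_pdivlMr ?mulr_gt0// mul1r ltW.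
  rewrite (le_trans (_ : _ <= 1)) ?ge_min ?lexx ?orbT// addrA lerDr addr_ge0// m0//.
  exact: ltW.
rewrite lee_fin.
have hK := T_ge K1; have hk := T_le (mulr_gt0 k0 K0); have hl := T_le (mulr_gt0 l0 K0).
rewrite powRM ?(ltW K0) ?(ltW l0)// lE in hl.
rewrite powRM ?(ltW K0) ?(ltW k0)// in hk.
have hk2 : k * T (k * K) <= c / 4 * K `^ (- alpha).
  apply: (le_trans (ler_wpM2l (ltW k0) hk)).
  rewrite (_ : k * _ = kappa * (k * k `^ (- alpha)) * K `^ (- alpha)); last by ring.
  rewrite -[X in X * k `^ _](powRr1 (ltW k0)) -powRD ?(gt_eqF k0) ?implybT// kE.
  by rewrite le_eqVlt; apply/orP; left; apply/eqP; field; rewrite gt_eqF.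
have hl2 : T (l * K) <= c / 4 * K `^ (- alpha).
  apply: (le_trans hl).
  by rewrite le_eqVlt; apply/orP; left; apply/eqP; field; rewrite gt_eqF.
exact: (split_bound h hK hk2 hl2).
Qed.

Definition mixing (s : R) : R := s `^ (- alpha^-1) * g 1 (s `^ (- alpha^-1)).

Lemma mixing_ge0 s : 0 <= mixing s.
Proof. by rewrite mulr_ge0 ?powR_ge0//; exact: f0. Qed.

Lemma measurable_mixing : measurable_fun setT mixing.
Proof.
apply: measurable_funM; first exact: measurable_powR.
by apply: measurableT_comp => //; exact: measurable_powR.
Qed.

(** Substitution u = s^(-1/alpha): the mixing weight is u g(u), and s = u^(-alpha) contributes alpha
    u^(-alpha-1). On a compact segment of ]0, +oo[ the substitution is smooth. *)
Lemma mixing_segment (a A B : R) : 0 < A -> A < B ->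
  (\int[leb]_(s in `[A, B]) (s `^ (- a) * mixing s)%:E =
   \int[leb]_(u in `[(B `^ (- alpha^-1))%R, (A `^ (- alpha^-1))%R])
     (alpha * (f u * u `^ (alpha * (a - 1))))%:E)%E.
Proof.
move=> A0 AB; have B0 : 0 < B by rewrite (lt_trans A0).
pose F (s : R) := s `^ (- alpha^-1).
pose G (u : R) := alpha * (f u * u `^ (alpha * (a - 1))).
have iF (s : R) : 0 < s -> is_derive s 1 F (- alpha^-1 * s `^ (- alpha^-1 - 1)).
  by move=> s0; exact: is_derive1_powR.
have dF (s : R) : 0 < s -> derive1 F s = - alpha^-1 * s `^ (- alpha^-1 - 1).
  by move=> s0; have hF := iF s s0; rewrite derive1E derive_val.
have cD (s : R) : 0 < s -> {for s, continuous (fun u : R => - alpha^-1 * u `^ (- alpha^-1 - 1))}.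
  by move=> s0; apply: cvgM; [exact: cvg_cst|exact: continuous_powR_gt0].
have cF' (s : R) : 0 < s -> {for s, continuous (derive1 F)}.
  move=> s0; rewrite /prop_for /continuous_at dF//.
  apply: cvg_trans (cD s s0); apply: near_eq_cvg.
  by near=> u; rewrite dF//; near: u; exact: lt_nbhsr.
have cF (s : R) : 0 < s -> {for s, continuous F} by move=> s0; exact: continuous_powR_gt0.
rewrite -/(F A) -/(F B) -[LHS]/(\int[leb]_(s in `[A, B]) _)%E.
have := @integration_by_substitution_decreasing R F G A B (ltW AB).
move=> ->.
- apply: eq_integral => s; rewrite inE/= in_itv/= => /andP[As _].
  have s0 : 0 < s by rewrite (lt_le_trans A0).
  congr EFin; rewrite -[RHS]/(G (F s) * - derive1 F s) dF// /G /F /mixing -/f -powRrM.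
  have -> : - alpha^-1 * (alpha * (a - 1)) = 1 - a by field; rewrite gt_eqF.
  rewrite mulNr opprK.
  rewrite (_ : alpha * _ * _ = f (s `^ (- alpha^-1)) * (s `^ (1 - a) * s `^ (- alpha^-1 - 1))); last first.
    by field; rewrite gt_eqF.
  rewrite -powRD ?(gt_eqF s0) ?implybT// mulrA mulrC -powRD ?(gt_eqF s0) ?implybT//.
  by congr (_ * _ `^ _); ring.
- move=> x y; rewrite !in_itv/= => /andP[Ax _] /andP[Ay _] xy.
  have x0 : 0 < x by rewrite (lt_le_trans A0).
  have y0 : 0 < y by rewrite (lt_le_trans A0).
  rewrite /F !powRN ltf_pV2 ?posrE ?powR_gt0//.
  by rewrite gt0_ltr_powR ?nnegrE ?invr_gt0// ltW.
- by move=> x; rewrite in_itv/= => /andP[Ax _]; apply: cF'; rewrite (lt_trans A0).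
- by apply/cvg_ex; eexists; apply: cvg_at_right_filter; exact: cF'.
- by apply/cvg_ex; eexists; apply: cvg_at_left_filter; exact: cF'.
- split.
  + move=> x; rewrite in_itv/= => /andP[Ax _].
    by have [] := iF x (lt_trans A0 Ax).
  + by apply: cvg_at_right_filter; exact: cF.
  + by apply: cvg_at_left_filter; exact: cF.
- apply: continuous_in_subspaceT => u; rewrite inE/= in_itv/= => /andP[h _].
  have u0 : 0 < u by rewrite (lt_le_trans _ h)// powR_gt0.
  apply: cvgM; first exact: cvg_cst.
  by apply: cvgM; [exact: (continuous_frac_green gP)|exact: continuous_powR_gt0].
Unshelve. all: by end_near. Qed.

Lemma mixing_moment (a : R) : 0 <= a -> a < 2 ->
  (\int[leb]_(s in `]0%R, +oo[) (s `^ (- a) * mixing s)%:E < +oo)%E.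
Proof.
move=> a00 a2.
have mI : measurable (`]0, +oo[%classic : set (measurableTypeR R)) by exact: measurable_itv.
(* For a < 2 this lies strictly between max(0, alpha (a-1)) and alpha: it bounds the exponent where
   u >= 1 and still has a finite moment. Where u < 1 the moment of order -alpha takes over. *)
pose e := alpha * (a + 2) / 4.
have e01 : 0 < e < alpha by have h := a0; rewrite /e; apply/andP; split; nra.
have h1 := moment_pos_lty alpha01 gP e01; have h2 := moment_neg_lty alpha01 gP.
have mp (D : set R) (r : R) : measurable_fun D (fun s => (f s * s `^ r)%:E).
  apply: measurable_funTS; apply/measurable_EFinP; apply: measurable_funM => //.
pose M := (alpha%:E * (\int[leb]_(s in `]0%R, +oo[) (f s * s `^ e)%:E +
  \int[leb]_(s in `]0%R, +oo[) (f s * s `^ (- alpha))%:E))%E.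
have M_lty : (M < +oo)%E.
  by rewrite lte_mul_pinfty// ?lee_fin ?(ltW a0)// lte_add_pinfty.
apply: le_lt_trans M_lty.
have nn r s : (0 <= (f s * s `^ r)%:E)%E by rewrite lee_fin mulr_ge0 ?powR_ge0.
rewrite itv0y_bigcup; apply: integral_bigcup_le.
- exact: nondecreasing_itv0y.
- by move=> i; exact: measurable_itv.
- apply: measurable_funTS; apply/measurable_EFinP; apply: measurable_funM.
    exact: measurable_powR.
  exact: measurable_mixing.
- by move=> i s _; rewrite lee_fin mulr_ge0 ?powR_ge0 ?mixing_ge0.
(* For n = 0 the segment is the single point 1, and the substitution is stated for A < B. *)
move=> [|n].
  rewrite invr1 set_itv1 integral_set1.
  by rewrite mule_ge0 ?lee_fin ?(ltW a0)// adde_ge0// integral_ge0.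
set A := (n.+2%:R)^-1; set B := n.+2%:R.
have A0 : 0 < A by rewrite invr_gt0.
have AB : A < B by rewrite (@lt_trans _ _ 1)// ?invf_lt1 ?ltr1n.
rewrite mixing_segment//.
have mJ : measurable (`[B `^ (- alpha^-1), A `^ (- alpha^-1)]%classic : set (measurableTypeR R)).
  exact: measurable_itv.
have JI : `[B `^ (- alpha^-1), A `^ (- alpha^-1)] `<=` `]0, +oo[%classic.
  move=> u; rewrite /= !in_itv/= andbT => /andP[h _].
  by rewrite (lt_le_trans _ h)// powR_gt0// (lt_trans A0).
have mD (D : set R) : measurable_fun D
    (fun s => (f s * s `^ e)%:E + (f s * s `^ (- alpha))%:E)%E.
  exact: (emeasurable_funD (mp D _) (mp D _)).
have EM : M = (\int[leb]_(s in `]0%R, +oo[)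
    (alpha%:E * ((f s * s `^ e)%:E + (f s * s `^ (- alpha))%:E)))%E.
  rewrite ge0_integralZl_EFin//; last 3 first.
  - by move=> s _; rewrite adde_ge0.
  - exact: mD.
  - exact: ltW.
  rewrite ge0_integralD//; exact: mp.
rewrite EM.
have mS : measurable_fun (`]0, +oo[ : set R)
    (fun s => alpha%:E * ((f s * s `^ e)%:E + (f s * s `^ (- alpha))%:E))%E.
  by apply: emeasurable_funM => //; exact: mD.
apply: (@le_trans _ _ (\int[leb]_(u in `[(B `^ (- alpha^-1))%R, (A `^ (- alpha^-1))%R])
    (alpha%:E * ((f u * u `^ e)%:E + (f u * u `^ (- alpha))%:E)))%E); last first.
  apply: ge0_subset_integral => // s _.
  by apply: mule_ge0; [rewrite lee_fin ltW|exact: adde_ge0].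
apply: ge0_le_integral => //.
- by move=> s _; rewrite lee_fin mulr_ge0 ?mulr_ge0 ?powR_ge0 ?(ltW a0)//; exact: f0.
- apply/measurable_EFinP; apply: measurable_funM => //; apply/measurable_EFinP; exact: mp.
- exact: measurable_funS mI JI mS.
move=> u /JI; rewrite /= in_itv/= andbT => u0.
rewrite -EFinD -EFinM lee_fin ler_wpM2l ?(ltW a0)// -mulrDr ler_wpM2l//.
have [u1|u1] := leP 1 u.
  apply: (@le_trans _ _ (u `^ e)); last by rewrite lerDl powR_ge0.
  by rewrite ler_powR// /e; have h := a0; nra.
apply: (@le_trans _ _ (u `^ (- alpha))); last by rewrite lerDr powR_ge0.
rewrite (_ : alpha * (a - 1) = alpha * a + - alpha); last by ring.
rewrite powRD ?(gt_eqF u0) ?implybT// ler_piMl ?powR_ge0//.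
by apply: powR_le1; rewrite ?mulr_ge0 ?(ltW a0) ?(ltW u0) ?(ltW u1).
Qed.

(** With v = K^(-alpha), the segment [kK, lK] has [g]-mass of order v by [stable_tail], and the
    factor u^(-alpha) from the substitution contributes the second v. Since s = u^(-alpha) reverses
    order, l produces the left end. *)
Lemma mixing_lower : exists k l e : R, [/\ 0 < k, k < l, 0 < e &
  forall v, 0 < v <= 1 ->
    ((e * v ^+ 2)%:E <= \int[leb]_(s in `[(k * v)%R, (l * v)%R]) (mixing s)%:E)%E].
Proof.
have [k [l [e [k0 kl e0 tail]]]] := stable_tail.
have l0 : 0 < l by rewrite (lt_trans k0).
exists (l `^ (- alpha)), (k `^ (- alpha)), (alpha * l `^ (- alpha) * e); split.
- exact: powR_gt0.
- by rewrite !powRN ltf_pV2 ?posrE ?powR_gt0// gt0_ltr_powR ?nnegrE ?ltW.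
- by rewrite !mulr_gt0 ?powR_gt0.
move=> v /andP[v0 v1].
pose K := v `^ (- alpha^-1).
have KE : K `^ (- alpha) = v by rewrite /K -powRrM mulrNN mulVf ?gt_eqF// powRr1 ?ltW.
have K1 : 1 <= K.
  rewrite /K powRN invf_ge1 ?powR_gt0//.
  by apply: powR_le1; rewrite ?invr_ge0 ?(ltW a0) ?(ltW v0).
have K0 : 0 < K by rewrite (lt_le_trans ltr01).
have end_ r : 0 < r -> (r `^ (- alpha) * v) `^ (- alpha^-1) = r * K.
  move=> r0; rewrite powRM ?powR_ge0 ?(ltW v0)// -powRrM mulrNN mulfV ?gt_eqF//.
  by rewrite powRr1 ?ltW.
have lk : l `^ (- alpha) * v < k `^ (- alpha) * v.
  by rewrite ltr_pM2r// !powRN ltf_pV2 ?posrE ?powR_gt0// gt0_ltr_powR ?nnegrE ?ltW.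
have lv0 : 0 < l `^ (- alpha) * v by rewrite mulr_gt0 ?powR_gt0.
have := mixing_segment 0 lv0 lk; rewrite !end_// => E.
have -> : (\int[leb]_(s in `[(l `^ (- alpha) * v)%R, (k `^ (- alpha) * v)%R]) (mixing s)%:E =
  \int[leb]_(s in `[(l `^ (- alpha) * v)%R, (k `^ (- alpha) * v)%R]) (s `^ (- 0) * mixing s)%:E)%E.
  by apply: eq_integral => s _; rewrite oppr0 powRr0 mul1r.
rewrite E.
have mJ : measurable (`[k * K, l * K]%classic : set (measurableTypeR R)) by exact: measurable_itv.
have mfJ : measurable_fun (`[k * K, l * K]%classic : set R) (EFin \o f).
  by apply: measurable_funTS; exact/measurable_EFinP.
have d0 : 0 <= alpha * (l `^ (- alpha) * v).
  by rewrite !mulr_ge0 ?powR_ge0 ?(ltW a0) ?(ltW v0).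
apply: (@le_trans _ _ (\int[leb]_(u in `[(k * K)%R, (l * K)%R])
    ((alpha * (l `^ (- alpha) * v))%:E * (f u)%:E))%E).
  rewrite ge0_integralZl_EFin//; last by move=> s _; rewrite lee_fin f0.
  have := tail _ K1; rewrite KE => h.
  apply: (le_trans _ (lee_wpmul2l _ h)); last by rewrite lee_fin.
  rewrite -EFinM lee_fin le_eqVlt; apply/orP; left; apply/eqP; ring.
apply: ge0_le_integral => //.
- by move=> u _; rewrite -EFinM lee_fin mulr_ge0//; exact: f0.
- exact: emeasurable_funM.
- apply: measurable_funTS; apply/measurable_EFinP; apply: measurable_funM => //.
  by apply: measurable_funM => //; exact: measurable_powR.
move=> u; rewrite /= in_itv/= => /andP[h1 h2].
have u0 : 0 < u by rewrite (lt_le_trans _ h1)// mulr_gt0.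
rewrite -EFinM lee_fin -mulrA ler_wpM2l ?(ltW a0)// mulrC ler_wpM2l//.
rewrite sub0r mulrN1 -{1}KE -powRM ?(ltW l0) ?(ltW K0)//.
rewrite !powRN lef_pV2 ?posrE ?powR_gt0 ?mulr_gt0//.
by rewrite ge0_ler_powR ?nnegrE ?(ltW a0) ?(ltW u0)// ltW// mulr_gt0.
Qed.

End stable_mixing.

(** * Subordination *)

Section subordination.
Context {R : realType} {d : nat}.
Local Notation leb := (@lebesgue_measure R).
Local Notation L := (@lebesgue_rV R d).
Variables (beta : R) (G : R -> 'rV[R]_d -> R) (m : R -> R) (M rho e : R).
Hypothesis b0 : 0 < beta.
Hypothesis G_ge0 : forall s x, 0 < s -> 0 <= G s x.
Hypothesis mG : measurable_fun setT (fun z : measurableTypeR R * 'rV[R]_d => G z.1 z.2).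
Hypothesis G_scale : forall s x, 0 < s ->
  G s x = s `^ (- (d%:R / beta)) * G 1 (s `^ (- beta^-1) *: x).
Hypothesis G1_int : L.-integrable setT (EFin \o G 1).
Hypothesis G1_le : forall x, G 1 x <= M.
Hypothesis rho0 : 0 < rho.
Hypothesis e0 : 0 < e.
Hypothesis G1_lower : forall x : 'rV[R]_d, (forall i, `|x ord0 i| <= rho) -> e <= G 1 x.
Hypothesis m_ge0 : forall s, 0 <= m s.
Hypothesis mm : measurable_fun setT m.
Hypothesis m_moment : forall a, 0 <= a -> a < 2 ->
  (\int[leb]_(s in `]0%R, +oo[) (s `^ (- a) * m s)%:E < +oo)%E.

(** Kept in [0, +oo]: for d > 2 beta the value at the origin is infinite, by [subordinate_lower] as
    r -> 0. *)
Definition subordinate (x : 'rV[R]_d) : \bar R :=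
  (\int[leb]_(s in `]0%R, +oo[) (G s x * m s)%:E)%E.

Let E := subordinate.

Let mI : measurable (`]0, +oo[%classic : set (measurableTypeR R)).
Proof. exact: measurable_itv. Qed.

Let ind (s : R) : R := \1_(`]0, +oo[%classic : set R) s.

Let indE s : 0 < s -> ind s = 1.
Proof. by move=> s0; rewrite /ind indicE mem_set//= in_itv/= s0. Qed.

Let ind0 s : s <= 0 -> ind s = 0.
Proof. by move=> s0; rewrite /ind indicE memNset//= in_itv/= andbT ltNge s0. Qed.

Let mind : measurable_fun setT ind.
Proof. exact: measurable_indic. Qed.

Let integral_ind (f : R -> R) :
  (\int[leb]_s (ind s * f s)%:E = \int[leb]_(s in `]0%R, +oo[) (f s)%:E)%E.
Proof.
rewrite [RHS]integral_mkcond; apply: eq_integral => s _.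
by rewrite /patch /ind indicE; case: (_ \in _); rewrite ?mul1r ?mul0r.
Qed.

Let M0 : 0 <= M.
Proof. by apply: le_trans (G1_le 0); exact: G_ge0. Qed.

Let mG1 s : measurable_fun setT (G s).
Proof. exact: (measurableT_comp mG (pair1_measurable s)). Qed.

Let mG2 x : measurable_fun setT (G ^~ x).
Proof. exact: (measurableT_comp mG (pair2_measurable x)). Qed.

(** A power of G is nonnegative for every s, also where G itself is not known to be, so Tonelli
    applies on the whole line; for p = 1 and r = 0 this is the integrand of [subordinate] on s >
    0. *)
Let weighted (p r : R) (s : R) (x : 'rV[R]_d) : R := G s x `^ p * (s `^ r * m s).

Let weighted_ge0 p r s x : 0 <= weighted p r s x.
Proof. by rewrite mulr_ge0 ?powR_ge0// mulr_ge0 ?powR_ge0. Qed.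

Let mw p r : measurable_fun setT
  (fun z : measurableTypeR R * 'rV[R]_d => (ind z.1 * weighted p r z.1 z.2)%:E).
Proof.
apply/measurable_EFinP; apply: measurable_funM.
  exact: measurableT_comp mind measurable_fst.
apply: measurable_funM; first exact: measurableT_comp (measurable_powR _) mG.
apply: measurable_funM; last exact: measurableT_comp mm measurable_fst.
exact: measurableT_comp (measurable_powR _) measurable_fst.
Qed.

Let w0 p r (z : measurableTypeR R * 'rV[R]_d) : (0 <= (ind z.1 * weighted p r z.1 z.2)%:E)%E.
Proof. by rewrite lee_fin mulr_ge0// /ind indicE. Qed.

Let A (p r : R) (x : 'rV[R]_d) : \bar R :=
  (\int[leb]_(s in `]0%R, +oo[) (weighted p r s x)%:E)%E.

Let AE p r x : A p r x = (\int[leb]_s (ind s * weighted p r s x)%:E)%E.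
Proof. by rewrite integral_ind. Qed.

Let mA p r : measurable_fun setT (A p r).
Proof.
rewrite (funext (AE p r)).
exact: (@measurable_fun_fubini_tonelli_G _ _ _ _ _ leb _ (mw p r) (w0 p r)).
Qed.

Let EA x : E x = A 1 0 x.
Proof.
apply: eq_integral => s; rewrite inE/= in_itv/= andbT => s0.
by rewrite /weighted powRr1 ?G_ge0// powRr0 mul1r.
Qed.

Lemma subordinate_ge0 x : (0 <= subordinate x)%E.
Proof. by rewrite -/E EA; apply: integral_ge0 => s _; rewrite lee_fin. Qed.

Lemma measurable_subordinate : measurable_fun setT subordinate.
Proof. by have -> : subordinate = A 1 0 by exact: (funext EA); exact: mA. Qed.

(** [G_scale] contributes s^(-dp/beta) from the factor and s^(d/beta) from the change of
    variables. *)
Let Gpow_integral p s : 1 <= p -> 0 < s ->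
  (\int[L]_x (G s x `^ p)%:E =
    (s `^ (- (d%:R / beta * (p - 1))))%:E * \int[L]_x (G 1 x `^ p)%:E)%E.
Proof.
move=> p1 s0.
have mGp t : measurable_fun setT (fun x => (G t x `^ p)%:E).
  by apply/measurable_EFinP; exact: measurableT_comp (measurable_powR _) (mG1 t).
transitivity (\int[L]_x ((s `^ (- (d%:R / beta) * p))%:E *
    (G 1 (s `^ (- beta^-1) *: x) `^ p)%:E))%E.
  apply: eq_integral => x _; rewrite G_scale// powRM ?powR_ge0 ?G_ge0//.
  by rewrite -powRrM EFinM.
have nn x : (0 <= (G 1 x `^ p)%:E)%E by rewrite lee_fin powR_ge0.
rewrite ge0_integralZl_EFin//; last 2 first.
- exact: (measurableT_comp (mGp 1) (measurable_scale_rV _)).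
- exact: powR_ge0.
rewrite (@ge0_integral_rV_scale _ _ (s `^ (- beta^-1)) (fun x => (G 1 x `^ p)%:E))//; last first.
  by rewrite gt_eqF// powR_gt0.
rewrite muleA -EFinM; congr (_%:E * _)%E.
rewrite ger0_norm ?powR_ge0// -powR_mulrn ?powR_ge0// -powRrM -powRN -powRD; last first.
  by rewrite (gt_eqF s0) implybT.
by congr (_ `^ _); ring.
Qed.

(** Boundedness and integrability interpolate: G^p <= M^(p-1) G. *)
Let Gpow_lty p : 1 <= p -> (\int[L]_x (G 1 x `^ p)%:E < +oo)%E.
Proof.
move=> p1; have p0 : 0 < p by rewrite (lt_le_trans ltr01).
have G10 x : 0 <= G 1 x by exact: G_ge0.
have : L.-integrable setT (EFin \o (fun x => M `^ (p - 1) * G 1 x)).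
  exact: (integrable_scale (M `^ (p - 1)) measurableT G1_int).
move=> /integrableP[_]; apply: le_lt_trans; apply: ge0_le_integral => //.
- by move=> x _; rewrite lee_fin powR_ge0.
- by apply/measurable_EFinP; exact: measurableT_comp (measurable_powR _) (mG1 1).
- apply: measurableT_comp => //; apply/measurable_EFinP; exact: measurable_funM.
move=> x _; rewrite /= lee_fin ger0_norm ?mulr_ge0 ?powR_ge0//.
have -> : G 1 x `^ p = G 1 x `^ (p - 1) * G 1 x.
  rewrite -[X in _ * X](powRr1 (G10 x)) -powRD ?subrK// (gt_eqF p0).
  by [].
by rewrite ler_wpM2r// ge0_ler_powR ?nnegrE ?subr_ge0.
Qed.

Let W a := (\int[leb]_(s in `]0%R, +oo[) (s `^ (- a) * m s)%:E)%E.

Let W_ge0 a : (0 <= W a)%E.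
Proof. by apply: integral_ge0 => s _; rewrite lee_fin mulr_ge0 ?powR_ge0. Qed.

(** The exponents close up: Hoelder's weight s^(a(p-1)) times the factor s^(-ap) from
    [Gpow_integral] is s^(-a), the weight of [W a] itself. *)
Let A_integral p a : 1 <= p -> a * p = d%:R / beta * (p - 1) ->
  (\int[L]_x A p (a * (p - 1)) x = \int[L]_x (G 1 x `^ p)%:E * W a)%E.
Proof.
move=> p1 ap.
have mGp t : measurable_fun setT (fun x => (G t x `^ p)%:E).
  by apply/measurable_EFinP; exact: measurableT_comp (measurable_powR _) (mG1 t).
have mWa : measurable_fun (`]0, +oo[ : set R) (fun s => (s `^ (- a) * m s)%:E).
  apply: measurable_funTS; apply/measurable_EFinP; apply: measurable_funM => //.
under eq_integral do rewrite AE.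
rewrite -(@fubini_tonelli _ _ _ _ _ leb L _ (mw p _) (w0 p _)).
transitivity (\int[leb]_(s in `]0%R, +oo[) ((\int[L]_x (G 1 x `^ p)%:E) * (s `^ (- a) * m s)%:E))%E.
  rewrite [RHS]integral_mkcond; apply: eq_integral => s _; rewrite /patch.
  case: ifPn => [|/negP ns]; last first.
    have s0 : s <= 0 by rewrite leNgt; apply/negP => s0; apply: ns; rewrite inE/= in_itv/= s0.
    by rewrite integral0_eq// => x _; rewrite /= ind0// mul0r.
  rewrite inE/= in_itv/= andbT => s0.
  transitivity (\int[L]_x ((s `^ (a * (p - 1)) * m s)%:E * (G s x `^ p)%:E))%E.
    by apply: eq_integral => x _; rewrite /= indE// mul1r /weighted mulrC EFinM.
  rewrite ge0_integralZl_EFin//; last 2 first.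
  - by move=> x _; rewrite lee_fin powR_ge0.
  - by rewrite mulr_ge0 ?powR_ge0.
  rewrite Gpow_integral// muleA -EFinM muleC; congr (_ * _%:E)%E.
  rewrite mulrAC -powRD ?(gt_eqF s0) ?implybT//; congr (_ `^ _ * _).
  by rewrite -ap; ring.
have := Gpow_lty p1.
have : (0 <= \int[L]_x (G 1 x `^ p)%:E)%E by apply: integral_ge0 => x _; rewrite lee_fin powR_ge0.
case: (\int[L]_x _)%E => // r r0 _; rewrite ge0_integralZl_EFin//.
by move=> s _; rewrite lee_fin mulr_ge0 ?powR_ge0.
Qed.

(* Hoelder with the weight [s^(-a)]. *)
Let subordinate_hoelder p a x : 1 <= p ->
  (E x `^ p <= A p (a * (p - 1)) x * W a `^ (p - 1))%E.
Proof.
(* For p = 1 the conjugate exponent is infinite, but the two sides coincide. *)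
rewrite le_eqVlt => /predU1P[<-|p1].
  by rewrite subrr mulr0 poweRe0 mule1 poweRe1 ?subordinate_ge0// EA.
have p0 : 0 < p by rewrite (lt_trans ltr01).
pose q := p / (p - 1).
have p10 : 0 < p - 1 by rewrite subr_gt0.
have q0 : 0 < q by rewrite divr_gt0.
have pq : p^-1 + q^-1 = 1 by rewrite /q; field; rewrite !gt_eqF.
have pqE : p * q^-1 = p - 1 by rewrite /q; field; rewrite !gt_eqF.
(* G m is split as (G s^(a/q) m^(1/p)) times (s^(-a/q) m^(1/q)). Since p/q = p - 1, the p-th power
   of the first factor is the integrand of [A p (a * (p - 1))], and the q-th power of the second
   that of [W a]. *)
pose f1 (s : R) : R := ind s * (G s x * (s `^ (a * q^-1) * m s `^ p^-1)).
pose f2 (s : R) : R := ind s * (s `^ (- a * q^-1) * m s `^ q^-1).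
have mpow (h : R -> R) r : measurable_fun setT h -> measurable_fun setT (fun s => h s `^ r).
  by move=> mh; exact: measurableT_comp (measurable_powR _) mh.
have mf1 : measurable_fun setT f1.
  apply: measurable_funM => //; apply: measurable_funM => //.
  by apply: measurable_funM; [exact: measurable_powR|exact: mpow].
have mf2 : measurable_fun setT f2.
  apply: measurable_funM => //.
  by apply: measurable_funM; [exact: measurable_powR|exact: mpow].
have := hoelder leb mf1 mf2 p0 q0 pq.
have i0 s : 0 <= ind s by rewrite /ind indicE.
have f20 s : 0 <= f2 s by rewrite mulr_ge0// mulr_ge0 ?powR_ge0.
have f10 s : 0 <= f1 s.
  have [s0|s0] := ltP 0 s; last by rewrite /f1 ind0// mul0r.
  by rewrite mulr_ge0// mulr_ge0 ?G_ge0// mulr_ge0 ?powR_ge0.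
have -> : ('N[leb]_1[EFin \o (f1 \* f2)%R] = E x)%E.
  rewrite Lnorm1 /E /subordinate -integral_ind; apply: eq_integral => s _ /=.
  rewrite (ger0_norm (mulr_ge0 (f10 s) (f20 s))); congr EFin.
  have [s0|s0] := ltP 0 s; last by rewrite /f1 ind0// !mul0r.
  rewrite /f1 /f2 indE// !mul1r.
  rewrite -mulrA; congr (_ * _); rewrite mulrACA.
  rewrite -!powRD ?pq ?(gt_eqF s0) ?implybT ?oner_eq0// powRr1//.
  by rewrite mulNr subrr powRr0 mul1r.
have -> : ('N[leb]_p%:E[EFin \o f1] = (A p (a * (p - 1)) x) `^ p^-1)%E.
  rewrite unlock AE; congr (_ `^ _)%E; apply: eq_integral => s _ /=.
  rewrite ger0_norm//; congr EFin.
  have [s0|s0] := ltP 0 s; last by rewrite /f1 ind0// !mul0r powR0// gt_eqF.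
  rewrite /f1 indE// !mul1r !powRM ?mulr_ge0 ?powR_ge0 ?G_ge0//.
  rewrite -!powRrM mulVf ?gt_eqF// powRr1// /weighted; congr (_ * (_ `^ _ * _)).
  by rewrite -mulrA [_^-1 * _]mulrC pqE.
have -> : ('N[leb]_q%:E[EFin \o f2] = W a `^ q^-1)%E.
  rewrite unlock /W -integral_ind; congr (_ `^ _)%E; apply: eq_integral => s _ /=.
  rewrite ger0_norm//; congr EFin.
  have [s0|s0] := ltP 0 s; last by rewrite /f2 ind0// !mul0r powR0// gt_eqF.
  rewrite /f2 indE// !mul1r powRM ?powR_ge0//.
  by rewrite -!powRrM -mulrA mulVf ?gt_eqF// mulr1 powRr1.
move=> h.
have A0 : (0 <= A p (a * (p - 1)) x)%E by apply: integral_ge0 => s _; rewrite lee_fin.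
have -> : (A p (a * (p - 1)) x * W a `^ (p - 1) =
    (A p (a * (p - 1)) x `^ p^-1 * W a `^ q^-1) `^ p)%E.
  rewrite poweRM ?poweR_ge0// -!poweRrM mulVf ?gt_eqF// poweRe1//.
  by rewrite [q^-1 * _]mulrC pqE.
apply: gt0_ler_poweR => //; first exact: ltW.
- by rewrite in_itv/= leey andbT subordinate_ge0.
- by rewrite in_itv/= leey andbT mule_ge0 ?poweR_ge0.
Qed.

(** Hoelder's bound integrated over x is the integral of (G 1)^p times W(a)^p, and the moment [W a]
    is finite for a < 2. *)
Lemma subordinate_pow_lty (p : R) : 1 <= p -> d%:R / beta * (1 - p^-1) < 2 ->
  (\int[L]_x (subordinate x `^ p) < +oo)%E.
Proof.
move=> p1; set a := d%:R / beta * (1 - p^-1) => a2.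
have p0 : 0 < p by rewrite (lt_le_trans ltr01).
have a0 : 0 <= a.
  by rewrite mulr_ge0 ?divr_ge0 ?(ltW b0)// subr_ge0 invf_le1.
have ap : a * p = d%:R / beta * (p - 1) by rewrite /a; field; rewrite !gt_eqF.
have Wfin : (W a < +oo)%E by exact: m_moment.
apply: (@le_lt_trans _ _ (\int[L]_x (A p (a * (p - 1)) x * W a `^ (p - 1)))%E).
  apply: ge0_le_integral => //.
  - by move=> x _; exact: poweR_ge0.
  - apply: (@measurableT_comp _ _ _ _ _ _ (fun y => (y `^ p)%E)); first exact: measurable_poweR.
    exact: measurable_subordinate.
  - by apply: emeasurable_funM => //; exact: mA.
  - by move=> x _; exact: subordinate_hoelder.
have Wp : (W a `^ (p - 1) < +oo)%E by exact: poweR_lty.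
have Wp0 : (0 <= W a `^ (p - 1))%E by exact: poweR_ge0.
rewrite ge0_integralZr//; last first.
  by move=> x _; apply: integral_ge0 => s _; rewrite lee_fin.
have I0 : (0 <= \int[L]_x (G 1 x `^ p)%:E)%E.
  by apply: integral_ge0 => x _; rewrite lee_fin powR_ge0.
have If : (\int[L]_x (G 1 x `^ p)%:E)%E \is a fin_num by rewrite ge0_fin_numE// Gpow_lty.
rewrite A_integral//; apply: lte_mul_pinfty => //; first exact: mule_ge0.
by rewrite fin_numM// ge0_fin_numE.
Qed.

(** The endpoint p = oo: G s x <= M s^(-d/beta), so the moment of order -d/beta bounds the integral
    uniformly in x. *)
Lemma subordinate_le : d%:R / beta < 2 ->
  exists C : R, forall x, (subordinate x <= C%:E)%E.
Proof.
move=> db2; have db0 : 0 <= d%:R / beta by rewrite divr_ge0// ltW.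
have Wfin := m_moment db0 db2; rewrite -/(W _) in Wfin.
have Wfn : W (d%:R / beta) \is a fin_num by rewrite ge0_fin_numE.
exists (M * fine (W (d%:R / beta))) => x; rewrite EFinM fineK//.
rewrite /W -ge0_integralZl_EFin//; last 2 first.
- by move=> s _; rewrite lee_fin mulr_ge0 ?powR_ge0.
- by apply: measurable_funTS; apply/measurable_EFinP; apply: measurable_funM.
apply: ge0_le_integral => //.
- by move=> s; rewrite /= in_itv/= andbT => s0; rewrite lee_fin mulr_ge0 ?G_ge0.
- apply: measurable_funTS; apply/measurable_EFinP.
  by apply: measurable_funM; [exact: mG2|exact: mm].
- apply: measurable_funTS; apply/measurable_EFinP; apply: measurable_funM => //.
  by apply: measurable_funM.
move=> s; rewrite /= in_itv/= andbT => s0.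
rewrite lee_fin mulrA ler_wpM2r// G_scale// mulrC ler_wpM2r ?powR_ge0//.
Qed.

Hypothesis m_lower : exists k l c : R, [/\ 0 < k, k < l, 0 < c &
  forall v, 0 < v <= 1 ->
    ((c * v ^+ 2)%:E <= \int[leb]_(s in `[(k * v)%R, (l * v)%R]) (m s)%:E)%E].

(** Only s of order v = r^beta is kept. There G s x is at least of order r^(-d) on a cube of side of
    order r, and [m] has mass at least c v^2 = c r^(2 beta). *)
Lemma subordinate_lower : exists r0 c : R, [/\ 0 < r0, 0 < c &
  forall (r : R) (x : 'rV[R]_d), 0 < r <= 1 -> (forall i, `|x ord0 i| <= r0 * r) ->
    ((c * r `^ (2 * beta - d%:R))%:E <= subordinate x)%E].
Proof.
have [k [l [c [k0 kl c0 h]]]] := m_lower.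
have l0 : 0 < l by rewrite (lt_trans k0).
have db0 : 0 <= d%:R / beta by rewrite divr_ge0// ltW.
(* For s in [k v, l v] the left end decides where [G1_lower] applies, namely |x_i| <= rho
   s^(1/beta), and the right end bounds s^(-d/beta) from below. *)
exists (rho * k `^ beta^-1), (e * l `^ (- (d%:R / beta)) * c); split.
- by rewrite mulr_gt0 ?powR_gt0.
- by rewrite !mulr_gt0 ?powR_gt0.
move=> r x /andP[r0 r1] xr.
pose v := r `^ beta.
have v0 : 0 < v by exact: powR_gt0.
have v1 : v <= 1 by apply: powR_le1; rewrite ?(ltW r0) ?(ltW b0).
have vE : v `^ beta^-1 = r by rewrite /v -powRrM mulfV ?gt_eqF// powRr1 ?ltW.
pose D : set R := `[k * v, l * v]%classic.
have mD : measurable (D : set (measurableTypeR R)) by exact: measurable_itv.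
have DI : D `<=` `]0, +oo[%classic.
  move=> s; rewrite /D /= !in_itv/= andbT => /andP[ks _].
  by rewrite (lt_le_trans _ ks)// mulr_gt0.
have mGm : measurable_fun setT (fun s => (G s x * m s)%:E).
  by apply/measurable_EFinP; apply: measurable_funM; [exact: mG2|exact: mm].
apply: (@le_trans _ _ (\int[leb]_(s in D) (G s x * m s)%:E)%E); last first.
  apply: ge0_subset_integral => //; first exact: measurable_funTS.
  by move=> s; rewrite /= in_itv/= andbT => s0; rewrite lee_fin mulr_ge0 ?G_ge0.
pose g0 := e * (l * v) `^ (- (d%:R / beta)).
have g00 : 0 <= g0 by rewrite mulr_ge0 ?powR_ge0 ?(ltW e0).
apply: (@le_trans _ _ (\int[leb]_(s in D) (g0%:E * (m s)%:E))%E).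
  rewrite ge0_integralZl_EFin//; last 2 first.
  - by move=> s _; rewrite lee_fin.
  - by apply: measurable_funTS; exact/measurable_EFinP.
  have := h v; rewrite v0 v1 => /(_ isT) hv.
  apply: (@le_trans _ _ (g0%:E * (c * v ^+ 2)%:E)%E); last first.
    by apply: lee_wpmul2l; rewrite ?lee_fin.
  rewrite -EFinM lee_fin /g0 powRM ?(ltW l0) ?(ltW v0)//.
  rewrite (_ : r `^ (2 * beta - d%:R) = v `^ (- (d%:R / beta)) * v ^+ 2); last first.
    rewrite -powR_mulrn ?(ltW v0)// -powRD; last by rewrite (gt_eqF v0) implybT.
    by rewrite /v -powRrM; congr (_ `^ _); field; rewrite gt_eqF.
  by rewrite le_eqVlt; apply/orP; left; apply/eqP; ring.
apply: ge0_le_integral => //.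
- by move=> s _; rewrite -EFinM lee_fin mulr_ge0.
- by apply: emeasurable_funM => //; apply: measurable_funTS; exact/measurable_EFinP.
- exact: measurable_funTS.
move=> s; rewrite /D /= in_itv/= => /andP[ks sl].
have s0 : 0 < s by rewrite (lt_le_trans _ ks)// mulr_gt0.
rewrite -EFinM lee_fin ler_wpM2r// /g0 G_scale// mulrC ler_pM ?powR_ge0 ?(ltW e0)//.
  rewrite !powRN lef_pV2 ?posrE ?powR_gt0 ?mulr_gt0//.
  by rewrite ge0_ler_powR ?nnegrE ?(ltW s0)// ltW// mulr_gt0.
apply: G1_lower => i; rewrite mxE normrM (ger0_norm (powR_ge0 _ _)).
rewrite powRN ler_pdivrMl ?powR_gt0//; apply: (le_trans (xr i)).
rewrite [leRHS]mulrC -mulrA ler_wpM2l ?(ltW rho0)// -vE -powRM ?(ltW k0) ?(ltW v0)//.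
by rewrite ge0_ler_powR ?nnegrE ?invr_ge0 ?(ltW b0) ?(ltW s0)// ltW// mulr_gt0.
Qed.

End subordination.

Section box.
Context {R : realType}.

(** A cube in the positive orthant with a corner at the origin. For n > 0 it excludes the origin, so
    boxes of side tending to 0 have empty intersection. *)
Definition box {n} (r : R) : set 'rV[R]_n :=
  [set v | forall i, v ord0 i \in `]0%R, r]].

Lemma measurable_box n r : measurable (box r : set 'rV[R]_n).
Proof.
rewrite (_ : box r = \bigcap_(i in [set: 'I_n])
    ((fun v : 'rV[R]_n => v ord0 i) @^-1` [set` `]0, r]])).
  apply: fin_bigcap_measurable => // i _.
  by rewrite -[X in measurable X]setTI; apply: measurable_coord_rV.
by apply/seteqP; split => [v h i _|v h i]; exact: h.
Qed.

Lemma lebesgue_rV_cube n (r : R) : 0 <= r -> lebesgue_rV n (box r) = (r ^+ n)%:E.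
Proof.
move=> r0; have := @lebesgue_rV_box R n 0 (const_mx r).
rewrite (_ : [set v | _] = box r); last first.
  by apply/seteqP; split => v h i; have := h i; rewrite !mxE.
move=> ->; last by move=> i; rewrite !mxE.
congr EFin; under eq_bigr do rewrite !mxE subr0.
by rewrite prodr_const card_ord.
Qed.

End box.

(** * Powers of a function with a pole at the origin *)

Section pole.
Context {R : realType} {d : nat}.
Local Notation L := (@lebesgue_rV R d).
Variables (E : 'rV[R]_d -> \bar R) (r0 c gamma : R).
Hypothesis E0 : forall x, (0 <= E x)%E.
Hypothesis mE : measurable_fun setT E.
Hypotheses (r00 : 0 < r0) (c0 : 0 < c).
Hypothesis E_lower : forall (r : R) (x : 'rV[R]_d), 0 < r <= 1 ->
  (forall i, `|x ord0 i| <= r0 * r) -> ((c * r `^ gamma)%:E <= E x)%E.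

Let mEp p : measurable_fun setT (fun x => E x `^ p)%E.
Proof.
apply: (@measurableT_comp _ _ _ _ _ _ (fun y => (y `^ p)%E)) => //.
exact: measurable_poweR.
Qed.

Let box_pow p r : 0 < p -> 0 < r <= 1 ->
  ((c `^ p * r0 ^+ d * r `^ (gamma * p + d%:R))%:E <=
    \int[L]_(x in box (r0 * r)) (E x `^ p))%E.
Proof.
move=> p0 /andP[r1 r2].
have mB := @measurable_box R d (r0 * r).
apply: (@le_trans _ _ (\int[L]_(x in box (r0 * r)) ((c * r `^ gamma) `^ p)%:E)%E).
  have r0r : 0 <= r0 * r by rewrite mulr_ge0// ltW.
  rewrite integral_cst// [X in (_ * X)%E](lebesgue_rV_cube d r0r).
  rewrite -EFinM lee_fin powRM ?powR_ge0 ?(ltW c0)// -powRrM exprMn.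
  rewrite powRD; last by rewrite (gt_eqF r1) implybT.
  rewrite powR_mulrn ?(ltW r1)//.
  by rewrite le_eqVlt; apply/orP; left; apply/eqP; ring.
apply: ge0_le_integral => //.
- by move=> x _; rewrite lee_fin powR_ge0.
- exact: measurable_funTS.
move=> x Bx; rewrite -poweR_EFin; apply: gt0_ler_poweR; first exact: ltW.
- by rewrite in_itv/= leey andbT lee_fin mulr_ge0 ?powR_ge0 ?(ltW c0).
- by rewrite in_itv/= leey andbT.
apply: E_lower; first by rewrite r1.
move=> i; have := Bx i; rewrite in_itv/= => /andP[h1 h2].
by rewrite gtr0_norm.
Qed.

Lemma pow_integral_gt0 p : 0 < p -> (0 < \int[L]_x (E x `^ p))%E.
Proof.
move=> p0; have := @box_pow p 1 p0; rewrite ltr01 lexx => /(_ isT).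
rewrite powR1 mulr1 => h.
apply: (@lt_le_trans _ _ (c `^ p * r0 ^+ d)%:E).
  by rewrite lte_fin mulr_gt0 ?powR_gt0 ?exprn_gt0.
apply: (le_trans h); apply: ge0_subset_integral => //.
- exact: measurable_box.
- by move=> x _; exact: poweR_ge0.
Qed.

(* The boxes shrink to the empty set while the integrals over them stay
   bounded below; this covers the critical exponent as well. *)
Lemma pow_integral_pole p : (0 < d)%N -> 0 < p -> gamma * p + d%:R <= 0 ->
  ~ (\int[L]_x (E x `^ p) < +oo)%E.
Proof.
move=> d0 p0 gp fin.
pose B (n : nat) : set 'rV[R]_d := box (r0 * n.+1%:R^-1).
pose f_ (n : nat) : 'rV[R]_d -> \bar R := (fun x => (E x `^ p)%E) \_ (B n).
have mB n : measurable (B n) by exact: measurable_box.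
have mf_ n : measurable_fun setT (f_ n).
  by apply/(measurable_restrictT _ (mB n)); exact: measurable_funTS.
have iE : L.-integrable setT (fun x => E x `^ p)%E.
  apply/integrableP; split => //.
  by under eq_integral do rewrite gee0_abs ?poweR_ge0//.
have cvf x : f_ n x @[n --> \oo] --> (0 : \bar R).
  apply: cvg_near_cst; pose i0 := Ordinal d0.
  have [x0|x0] := ltP 0 (x ord0 i0); last first.
    apply: nearW => n; rewrite /f_ /patch memNset// => /(_ i0).
    by rewrite in_itv/= ltNge x0.
  have : \forall n \near \oo, n.+1%:R^-1 < x ord0 i0 / r0.
    by apply: near_infty_natSinv_lt (PosNum (divr_gt0 x0 r00)).
  apply: filterS => n nx; rewrite /f_ /patch memNset// => /(_ i0).
  by rewrite in_itv/= leNgt mulrC -ltr_pdivlMr// nx andbF.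
have [||||_ _ cv] := @dominated_convergence _ _ _ L setT measurableT f_ (cst 0%E)
  (fun x => E x `^ p)%E mf_.
- exact: measurable_cst.
- by apply: aeW => x _; exact: cvf.
- exact: iE.
- apply: aeW => x n _; rewrite /f_ /patch; case: ifPn => _.
    by rewrite gee0_abs ?poweR_ge0.
  by rewrite abse0 poweR_ge0.
rewrite integral0 in cv.
have lower n : ((c `^ p * r0 ^+ d)%:E <= \int[L]_x f_ n x)%E.
  rewrite /f_ -integral_mkcond.
  have n1 : 0 < (n.+1%:R^-1 : R) <= 1 by rewrite invr_gt0 ltr0n invf_le1// ler1n.
  apply: le_trans (box_pow p0 n1); rewrite lee_fin ler_peMr//.
    by rewrite mulr_ge0 ?powR_ge0 ?exprn_ge0 ?(ltW r00).
  rewrite -(opprK (gamma * p + d%:R)) powRN invf_ge1 ?powR_gt0//.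
  by case/andP: n1 => h1 h2; apply: powR_le1; rewrite ?oppr_ge0// ltW.
have pos : 0 < c `^ p * r0 ^+ d by rewrite mulr_gt0 ?powR_gt0 ?exprn_gt0.
have : ((c `^ p * r0 ^+ d)%:E <= limn (fun n => \int[L]_x f_ n x))%E.
  by apply: lime_ge; [apply/cvg_ex; eexists; exact: cv|exact: nearW].
rewrite (cvg_lim (@ereal_hausdorff R) cv) lee_fin => /(lt_le_trans pos).
by rewrite ltxx.
Qed.

(** [E] is integrable, hence finite almost everywhere, so sending its infinite values to 0 does not
    change the norm. *)
Lemma Lnorm_fine p : 0 < p -> (\int[L]_x E x < +oo)%E ->
  ('N[L]_p%:E[(fun x => (fine (E x))%:E)] = (\int[L]_x (E x `^ p)) `^ p^-1)%E.
Proof.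
move=> p0 fin.
rewrite unlock; congr (_ `^ _)%E.
have iE : L.-integrable setT E.
  apply/integrableP; split => //.
  by under eq_integral do rewrite gee0_abs//.
apply: ae_eq_integral => //.
- apply: (@measurableT_comp _ _ _ _ _ _ (fun y => (y `^ p)%E)); first exact: measurable_poweR.
  apply: measurableT_comp => //; apply/measurable_EFinP.
  by apply: measurableT_comp.
apply: filterS (integrable_ae measurableT iE) => x /(_ I) Ex _.
by rewrite fineK// gee0_abs.
Qed.

End pole.

(** * The kernel Y *)

(** Infinite arguments are included, both sides being 0 there; this lets the scaling of Y hold at
    every point and not just almost everywhere. *)
Lemma fine_scale {R : realType} (K : R) (x : \bar R) : K != 0 -> fine (K%:E * x) = K * fine x.
Proof.
case: x => [r| |] //; rewrite neq_lt => /orP[]K1; rewrite [RHS]mulr0.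
- by rewrite lt0_muley ?lte_fin.
- by rewrite gt0_muley ?lte_fin.
- by rewrite lt0_muleNy ?lte_fin.
- by rewrite gt0_muleNy ?lte_fin.
Qed.

Section Lnorm_scaling.
Context {R : realType} {d : nat}.
Local Notation L := (@lebesgue_rV R d).

Lemma Lnorm_scale (f : 'rV[R]_d -> R) (K la p : R) : 0 < K -> 0 < la -> 0 < p ->
  measurable_fun setT f ->
  ('N[L]_p%:E[(fun x => (K * f (la *: x))%:E)] =
   (K * la `^ (- (d%:R / p)))%:E * 'N[L]_p%:E[EFin \o f])%E.
Proof.
move=> K0 la0 p0 mf.
have mfp : measurable_fun setT (fun x => (`|f x| `^ p)%:E).
  apply/measurable_EFinP; apply: (@measurableT_comp _ _ _ _ _ _ (fun y : R => y `^ p)) => //.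
  exact: measurableT_comp.
rewrite unlock.
have -> : (\int[L]_x (`|(K * f (la *: x))%:E| `^ p) =
    (K `^ p * la ^- d)%:E * \int[L]_x (`|(EFin \o f) x| `^ p))%E.
  transitivity (\int[L]_x ((K `^ p)%:E * (`|f (la *: x)| `^ p)%:E))%E.
    apply: eq_integral => x _; rewrite /= normrM (gtr0_norm K0) powRM ?(ltW K0)//.
  rewrite ge0_integralZl_EFin ?powR_ge0//; last first.
    exact: (measurableT_comp mfp (measurable_scale_rV _)).
  rewrite (@ge0_integral_rV_scale _ _ la (fun x => (`|f x| `^ p)%:E)) ?gt_eqF//.
  by rewrite muleA -EFinM gtr0_norm.
rewrite poweRM; last 2 first.
- by rewrite lee_fin mulr_ge0 ?powR_ge0// invr_ge0 exprn_ge0// ltW.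
- by apply: integral_ge0 => x _; exact: poweR_ge0.
congr (_ * _)%E; rewrite poweR_EFin; congr EFin.
rewrite powRM ?powR_ge0 ?invr_ge0 ?exprn_ge0 ?(ltW la0)// -powRrM mulfV ?gt_eqF//.
rewrite powRr1 ?(ltW K0)//; congr (_ * _).
rewrite -powR_mulrn ?(ltW la0)// -powRN -powRrM mulNr.
by [].
Qed.

End Lnorm_scaling.

Section kernel.
Context {R : realType} {d : nat}.
Local Notation L := (@lebesgue_rV R d).
Local Notation leb := (@lebesgue_measure R).
Variables (alpha beta : R) (mu : {finite_measure set 'rV[R]_d -> \bar R}).
Variable g : R -> R -> R.
Hypothesis d_gt0 : (0 < d)%N.
Hypothesis alpha01 : 0 < alpha < 1.
Hypothesis beta02 : 0 < beta < 2.
Variable c : R.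
Hypothesis c0 : 0 < c.
Hypothesis psi_lower : forall xi, c * enorm xi `^ beta <= psi mu beta xi.
Hypothesis gP : is_frac_green alpha g.

Let b0 : 0 < beta. Proof. by case/andP: beta02. Qed.
Let a0 : 0 < alpha. Proof. by case/andP: alpha01. Qed.

Let E := subordinate (green_re beta mu) (mixing alpha g).

Let H (x : 'rV[R]_d) : R := fine (E x).

Let G_ge0 s x : 0 < s -> 0 <= green_re beta mu s x.
Proof. exact: green_re_ge0 beta02 c0 d_gt0 psi_lower s x. Qed.

Let m_ge0 s : 0 <= mixing alpha g s.
Proof. exact: mixing_ge0 gP s. Qed.

Let E_ge0 x : (0 <= E x)%E.
Proof. by apply: subordinate_ge0. Qed.

Let mG : measurable_fun setT (fun z : measurableTypeR R * 'rV[R]_d => green_re beta mu z.1 z.2).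
Proof. exact: measurable_green_re. Qed.

Let mE : measurable_fun setT E.
Proof.
apply: measurable_subordinate => //.
exact: measurable_mixing gP.
Qed.

Let mH : measurable_fun setT H.
Proof. by apply: measurableT_comp. Qed.

Let H_ge0 x : 0 <= H x. Proof. exact: fine_ge0. Qed.

Definition kernel_factor (t : R) : R := t `^ (alpha - 1 - alpha * d%:R / beta).

Definition kernel_dilation (t : R) : R := t `^ (- (alpha / beta)).

(** Both G(t^alpha s, x) and G(s, t^(-alpha/beta) x) are scaled to time 1, where they agree up to a
    power of t; no substitution in s is made. Where the integral diverges, both sides are 0. *)
Lemma kernelYE t x : 0 < t -> kernelY alpha beta mu g t x =
  (kernel_factor t * H (kernel_dilation t *: x))%:C%C.
Proof.
move=> t0; have ta0 : 0 < t `^ alpha by exact: powR_gt0.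
have Es s : 0 < s -> ((t `^ (alpha - 1))%:C * green beta mu (t `^ alpha * s) x *
     (s `^ (- alpha^-1) * g 1 (s `^ (- alpha^-1)))%:C)%C =
    (kernel_factor t * (green_re beta mu s (kernel_dilation t *: x) * mixing alpha g s))%:C%C.
  move=> s0; rewrite (greenE beta02 c0 d_gt0 psi_lower) ?mulr_gt0// -!rmorphM /=.
  congr (_%:C)%C; rewrite -/(mixing alpha g s).
  rewrite (green_re_scale beta02 c0 d_gt0 psi_lower x (mulr_gt0 ta0 s0)).
  rewrite (green_re_scale beta02 c0 d_gt0 psi_lower (kernel_dilation t *: x) s0).
  rewrite !powRM ?(ltW ta0) ?(ltW s0)// -!powRrM scalerA.
  rewrite [s `^ (- beta^-1) * kernel_dilation t]mulrC /kernel_dilation.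
  rewrite (_ : alpha * - beta^-1 = - (alpha / beta)); last by ring.
  rewrite /kernel_factor (_ : alpha - 1 - alpha * d%:R / beta =
    (alpha - 1) + alpha * - (d%:R / beta)); last by ring.
  rewrite [in RHS]powRD; last by rewrite (gt_eqF t0) implybT.
  by ring.
have pos s : s \in (`]0, +oo[%classic : set R) -> 0 < s.
  by rewrite inE/= in_itv/= andbT.
rewrite /kernelY /cintegral; congr Complex; last first.
  rewrite (@eq_Rintegral _ _ _ _ _ (cst 0)) ?Rintegral_cst ?mul0r// => s /pos s0.
  by rewrite Es.
rewrite /H -fine_scale; last by rewrite gt_eqF// powR_gt0.
rewrite /E /subordinate -ge0_integralZl_EFin//; last 3 first.
- by move=> s; rewrite /= in_itv/= andbT => s0; rewrite lee_fin mulr_ge0// G_ge0.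
- apply: measurable_funTS; apply/measurable_EFinP; apply: measurable_funM.
    exact: (measurableT_comp mG (pair2_measurable (kernel_dilation t *: x))).
  exact: measurable_mixing gP.
- exact: powR_ge0.
congr fine; apply: eq_integral => s /pos s0.
by rewrite Es.
Qed.

Lemma cLnorm_kernelY t p : 0 < t ->
  cLnorm L p (kernelY alpha beta mu g t) =
  ('N[L]_p[(fun x => (kernel_factor t * H (kernel_dilation t *: x))%:E)])%E.
Proof.
move=> t0; apply: eq_Lnorm => x; rewrite kernelYE// /ComplexField.Normc.normc /=.
rewrite expr0n addr0 sqrtr_sqr ger0_norm// mulr_ge0//; exact: powR_ge0.
Qed.

Let M : R := (2 * pi) ^- d * \int[L]_xi semigroup beta mu 1 xi.

Let G_scale s x : 0 < s -> green_re beta mu s x =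
  s `^ (- (d%:R / beta)) * green_re beta mu 1 (s `^ (- beta^-1) *: x).
Proof. by move=> s0; exact: (green_re_scale beta02 c0 d_gt0 psi_lower x s0). Qed.

Let G1_int : L.-integrable setT (EFin \o green_re beta mu 1).
Proof. exact: integrable_green_re1 beta02 c0 d_gt0 psi_lower. Qed.

Let G1_le x : green_re beta mu 1 x <= M.
Proof. exact: (green_re_le beta02 c0 d_gt0 psi_lower x ltr01). Qed.

Let mm : measurable_fun setT (mixing alpha g).
Proof. exact: measurable_mixing gP. Qed.

Let m_moment a : 0 <= a -> a < 2 ->
  (\int[leb]_(s in `]0%R, +oo[) (s `^ (- a) * mixing alpha g s)%:E < +oo)%E.
Proof. exact: mixing_moment alpha01 gP a. Qed.

Let E_pow_lty (p : R) : 1 <= p -> d%:R / beta * (1 - p^-1) < 2 ->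
  (\int[L]_x (E x `^ p) < +oo)%E.
Proof.
exact: (subordinate_pow_lty b0 G_ge0 mG G_scale G1_int G1_le m_ge0 mm m_moment).
Qed.

Let E_lty : (\int[L]_x E x < +oo)%E.
Proof.
have := @E_pow_lty 1 (lexx _); rewrite invr1 subrr mulr0 ltr0n => /(_ isT).
by under eq_integral do rewrite poweRe1//.
Qed.

Let E_lower : exists r0 e : R, [/\ 0 < r0, 0 < e &
  forall (r : R) (x : 'rV[R]_d), 0 < r <= 1 -> (forall i, `|x ord0 i| <= r0 * r) ->
    ((e * r `^ (2 * beta - d%:R))%:E <= E x)%E].
Proof.
have [rho [e [rho0 e0 G1_lower]]] := green_re1_lower beta02 c0 d_gt0 psi_lower.
exact: (subordinate_lower b0 G_ge0 mG G_scale rho0 e0 G1_lower m_ge0 mm (mixing_lower alpha01 gP)).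
Qed.

(** Multiplied out, both conditions read d (p - 1) < 2 beta p, which always holds when d <= 2
    beta. *)
Lemma lt_kappa2 (p : R) : 1 <= p ->
  (p%:E < kappa2 d beta)%E = (d%:R / beta * (1 - p^-1) < 2).
Proof.
move=> p1; have p0 : 0 < p by rewrite (lt_le_trans ltr01).
have dp : 0 < d%:R :> R by rewrite ltr0n.
have -> : d%:R / beta * (1 - p^-1) = (d%:R * (p - 1)) / (beta * p).
  by field; rewrite !gt_eqF.
rewrite ltr_pdivrMr ?mulr_gt0// /kappa2; case: ifPn => [bd|].
  rewrite lte_fin ltr_pdivlMr ?subr_gt0//.
  by apply/idP/idP => h; lra.
by rewrite -leNgt ltry => bd; apply/esym; nra.
Qed.

(** An exact equality: the factor has exponent alpha - 1 - alpha d/beta, and the dilation adds alpha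
    d/(beta p). *)
Lemma Lnorm_kernelY (t p : R) : 0 < t -> 1 <= p ->
  cLnorm L p%:E (kernelY alpha beta mu g t) =
  ((t `^ (- (alpha * d%:R / beta) * (1 - p^-1) + (alpha - 1)))%:E *
   (\int[L]_x (E x `^ p)) `^ p^-1)%E.
Proof.
move=> t0 p1; have p0 : 0 < p by rewrite (lt_le_trans ltr01).
rewrite cLnorm_kernelY// Lnorm_scale ?powR_gt0// -(Lnorm_fine E_ge0 mE p0 E_lty).
congr (_%:E * _)%E; rewrite /kernel_factor /kernel_dilation -powRrM.
rewrite -powRD; last by rewrite (gt_eqF t0) implybT.
by congr (_ `^ _); field; rewrite !gt_eqF.
Qed.

Lemma Lnorm_kernelY_lty (p : R) : 1 <= p -> (p%:E < kappa2 d beta)%E ->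
  ((\int[L]_x (E x `^ p)) `^ p^-1 < +oo)%E.
Proof. by move=> p1; rewrite lt_kappa2// => h; apply: poweR_lty; exact: E_pow_lty. Qed.

Lemma Lnorm_kernelY_gt0 (p : R) : 1 <= p ->
  (0 < (\int[L]_x (E x `^ p)) `^ p^-1)%E.
Proof.
move=> p1; have p0 : 0 < p by rewrite (lt_le_trans ltr01).
have [r0 [e [r00 e0 low]]] := E_lower.
by apply: poweR_gt0; exact: (pow_integral_gt0 E_ge0 mE r00 e0 low p0).
Qed.

Lemma cLp_kernelY (p : R) : 1 <= p ->
  (forall t, 0 < t -> cLp L p%:E (kernelY alpha beta mu g t)) <->
  (p%:E < kappa2 d beta)%E.
Proof.
move=> p1; have p0 : 0 < p by rewrite (lt_le_trans ltr01).
split=> [/(_ _ ltr01)[_ _]|pk t t0].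
  (* Time t = 1 suffices for this direction: the power of t is then 1. *)
  rewrite Lnorm_kernelY// powR1 mul1e => /lty_poweRy fin.
  rewrite lt_kappa2// ltNge; apply/negP => h.
  have [r0 [e [r00 e0 low]]] := E_lower.
  (* p >= kappa_2 means 2 beta p <= d (p - 1), which is the condition gamma p + d <= 0 with gamma =
     2 beta - d. *)
  apply: (pow_integral_pole E_ge0 mE r00 e0 low d_gt0 p0).
    have : 2 * (beta * p) <= d%:R * (p - 1).
      rewrite -ler_pdivlMr ?mulr_gt0//; apply: (le_trans h).
      by rewrite le_eqVlt; apply/orP; left; apply/eqP; field; rewrite !gt_eqF.
    by lra.
  by apply: fin; rewrite invr_neq0// gt_eqF.
have ReE : (fun x => complex.Re (kernelY alpha beta mu g t x)) =
    (fun x => kernel_factor t * H (kernel_dilation t *: x)).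
  by apply/funext => x; rewrite kernelYE.
have ImE : (fun x => complex.Im (kernelY alpha beta mu g t x)) = cst 0.
  by apply/funext => x; rewrite kernelYE.
split.
- rewrite ReE; apply: measurable_funM; first exact: measurable_cst.
  exact: (measurableT_comp mH (measurable_scale_rV _)).
- by rewrite ImE; exact: measurable_cst.
rewrite Lnorm_kernelY// lte_mul_pinfty ?lee_fin ?powR_ge0//.
exact: Lnorm_kernelY_lty.
Qed.

(** The norm is its value at t = 1 times the power of t, so that value, positive and finite, serves
    as both constants. *)
Lemma asymp_kernelY (p : R) : 1 <= p -> (p%:E < kappa2 d beta)%E ->
  asymp (fun t => cLnorm L p%:E (kernelY alpha beta mu g t))
    (fun t => t `^ (- (alpha * d%:R / beta) * (1 - p^-1) + (alpha - 1))).
Proof.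
move=> p1 pk; have Ny := Lnorm_kernelY_lty p1 pk; have N0 := Lnorm_kernelY_gt0 p1.
set N := ((\int[L]_x (E x `^ p)) `^ p^-1)%E in Ny N0.
have Nf : N \is a fin_num by rewrite ge0_fin_numE// ltW.
have fN0 : 0 < fine N by rewrite fine_gt0// N0.
exists (fine N), (fine N); split => // t t0.
by rewrite Lnorm_kernelY// -/N -(fineK Nf) -EFinM mulrC lexx.
Qed.

(** From above, [subordinate_le] bounds H everywhere. From below, H >= e on a box of positive
    measure, so a smaller essential supremum would place the dilated box inside a null set. *)
Lemma asymp_kernelY_infty : d%:R < 2 * beta ->
  asymp (fun t => cLnorm L +oo%E (kernelY alpha beta mu g t))
    (fun t => t `^ (- (alpha * d%:R / beta) + (alpha - 1))).
Proof.
move=> db.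
have db2 : d%:R / beta < 2 by rewrite ltr_pdivrMr.
have [C EC] := subordinate_le b0 G_ge0 mG G_scale G1_le m_ge0 mm m_moment db2.
have [r0 [e [r00 e0 low]]] := E_lower.
have Ef x : E x \is a fin_num by rewrite ge0_fin_numE// (le_lt_trans (EC x))// ltry.
have HC x : H x <= C by rewrite -lee_fin fineK.
have He x : box r0 x -> e <= H x.
  move=> Bx; rewrite -lee_fin fineK//.
  have := low 1 x; rewrite ltr01 lexx powR1 !mulr1; apply => // i.
  by have := Bx i; rewrite in_itv/= => /andP[h1 h2]; rewrite gtr0_norm.
have B0 (r : R) : 0 < r -> (0 < L (box r))%E.
  move=> r1; apply: (@lt_le_trans _ _ (r ^+ d)%:E); first by rewrite lte_fin exprn_gt0.
  by have := lebesgue_rV_cube d (ltW r1) => ->.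
have C0 : 0 < C.
  apply: lt_le_trans e0 _; apply: le_trans (HC (const_mx r0)); apply: He => i.
  by rewrite mxE in_itv/= r00 lexx.
exists e, C; split => // t t0.
have K0 : 0 < kernel_factor t by exact: powR_gt0.
have l0 : 0 < kernel_dilation t by exact: powR_gt0.
have -> : t `^ (- (alpha * d%:R / beta) + (alpha - 1)) = kernel_factor t.
  by rewrite /kernel_factor addrC.
rewrite cLnorm_kernelY// unlock lebesgue_rV_setT_gt0.
apply/andP; split; last first.
  apply/ess_supP/aeW => x /=.
  by rewrite lee_fin ger0_norm ?mulr_ge0 ?(ltW K0)// mulrC ler_wpM2r ?(ltW K0).
set f := (fun x : 'rV[R]_d => _).
rewrite leNgt; apply/negP => lt.
have [N [mN N0 sub]] := ess_sup_ge L (abse \o f).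
have : (L (box (r0 / kernel_dilation t)) <= L N)%E.
  apply: le_measure; rewrite ?inE//; first exact: measurable_box.
  move=> x Bx; apply: sub => /= h.
  have := le_lt_trans h lt; rewrite /f/= lte_fin ltNge => /negP; apply.
  rewrite ger0_norm ?mulr_ge0 ?(ltW K0)// mulrC ler_wpM2l ?(ltW K0)//.
  apply: He => i; have := Bx i; rewrite !in_itv/= mxE => /andP[h1 h2].
  by rewrite mulr_gt0//= mulrC -ler_pdivlMr.
by rewrite N0 leNgt B0// divr_gt0.
Qed.

End kernel.

Theorem theorem2p3 (R : realType) (d : nat) (alpha beta : R)
    (mu : {finite_measure set 'rV[R]_d -> \bar R}) (Galpha : R -> R -> R)
    (d_gt0 : (0 < d)%N)
    (alpha01 : 0 < alpha < 1)
    (beta02 : 0 < beta < 2)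
    (mu_spectral : spectral_measure mu)
    (mu_density : has_positive_density mu)
    (omega_gt0 : forall theta, sphere theta -> 0 < omega mu beta theta)
    (omega_smooth : Ck_sphere (d + 1 + `|Num.floor beta|) (omega mu beta))
    (GalphaP : is_frac_green alpha Galpha) :
  let Y := kernelY alpha beta mu Galpha in
  [/\ forall p : R, 1 <= p ->
        (forall t, 0 < t -> cLp (lebesgue_rV d) p%:E (Y t)) <->
        (p%:E < kappa2 d beta)%E,
      forall p : R, 1 <= p -> (p%:E < kappa2 d beta)%E ->
        asymp (fun t => cLnorm (lebesgue_rV d) p%:E (Y t))
          (fun t => t `^ (- (alpha * d%:R / beta) * (1 - p^-1) + (alpha - 1))) &
      d%:R < 2 * beta ->
        asymp (fun t => cLnorm (lebesgue_rV d) +oo%E (Y t))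
          (fun t => t `^ (- (alpha * d%:R / beta) + (alpha - 1)))].
Proof.
have [c c0 psi_lower] := psi_lower_bound beta02 omega_gt0 omega_smooth.
move=> Y; split.
- exact: (cLp_kernelY d_gt0 alpha01 beta02 c0 psi_lower GalphaP).
- exact: (asymp_kernelY d_gt0 alpha01 beta02 c0 psi_lower GalphaP).
- exact: (asymp_kernelY_infty d_gt0 alpha01 beta02 c0 psi_lower GalphaP).
Qed.
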